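(* Let $d\ge3$ be a fixed integer, let $\beta_c=\operatorname{atanh}(1/(d-1))$, and let $\varphi_n^{\beta,B}(t)$ be the normalized logarithm of the quenched fixed-spin partition function on the $d$-regular configuration model $G_n$. Let $\tilde\varphi_n^{\beta,B}(t)=\mathbb E[\varphi_n^{\beta,B}(t)]$. (i) For all $\beta\ge0$, $B\ge0$ and $t\in(0,1)$, $\varphi_n^{\beta,B}(t)-\tilde\varphi_n^{\beta,B}(t)\to0$ almost surely as $n\to\infty$. (ii) There exists a subsequence $(n_k)_{k\ge1}$ such that for all $\beta\geq 0$, $B\geq 0$ the functions $(\tilde\varphi_{n_k}^{\beta,B})_{k\ge1}$ converge uniformly on every compact subset of $[0,1]$ to a continuous (non-random) function $\varphi_{\beta,B}$. Moreover, $\varphi_{\beta,B}(t)=\varphi_{\beta,0}(t)+B(2t-1)$. Furthermore, let $$B_c=B_c(\beta):=\sup_{0<s<t<1/2}\frac{\varphi_{\beta,0}(s)-\varphi_{\beta,0}(t)}{2(t-s)}.$$ Then $B_c(\beta)\in(0,\beta d)$ for all $\beta>\beta_c$. Moreover, there exists a positive constant $c$ (independent of $\beta$) such that $B_c(\beta)\ge c\beta$ whenever $\beta\ge12$.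
   Context: The $d$-regular configuration model on $[n]=\{1,\dots,n\}$ ($nd$ even; only such $n$ are considered): attach $d$ half-edges to each vertex and pair the $nd$ half-edges uniformly at random, giving a random multigraph $G_n$; $\mathbb E$ is expectation over $G_n$, and $k_{i,j}$ is the number of edges between $i$ and $j$. The graphs $G_n$ for different $n$ live on a common probability space. For $\sigma\in\Omega_n=\{-1,1\}^n$, $H_n(\sigma)=-\beta\sum_{i\le j}k_{i,j}\sigma_i\sigma_j-B\sum_i\sigma_i$, and $|\sigma_+|=\#\{i:\sigma_i=1\}$. For $t\in[0,1]$, $$Z_n^{\beta,B}(t)=\sum_{\sigma:\,|\sigma_+|=\lceil nt\rceil}e^{-H_n(\sigma)},\qquad \varphi_n^{\beta,B}(t)=\frac1n\log Z_n^{\beta,B}(t).$$ *)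

(* Defs.v *)
From HB Require Import structures.
From mathcomp Require Import all_boot all_order all_algebra.
From mathcomp Require Import all_classical all_reals all_analysis.

Set Implicit Arguments.
Unset Strict Implicit.
Unset Printing Implicit Defensive.
Import Order.TTheory GRing.Theory Num.Theory.
Import numFieldNormedType.Exports.

Local Open Scope ring_scope.

(* The pair (i, a) is the a-th half-edge attached to the vertex i. *)
Definition half_edge (n d : nat) : finType := ('I_n * 'I_d)%type.

(* A multigraph on 'I_n is given by the set of its edges, an edge being the
   set of the half-edges it consists of. *)
Definition multigraph (n d : nat) : finType := {set {set half_edge n d}}.

Definition pairings (n d : nat) : {set multigraph n d} :=
  [set M : multigraph n d |
    finset.partition M [set: half_edge n d] && [forall e in M, #|e| == 2%N]]%SET.

(* An edge lies between i and j when {i, j} is the set of the vertices of its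
   half-edges; for i = j this is a loop, which counts once. *)
Definition edge_mult (n d : nat) (M : multigraph n d) (i j : 'I_n) : nat :=
  #|[set e in M | [set h.1 | h in e] == [set i; j]]%SET|.

(* true encodes the spin 1 and false the spin -1. *)
Definition configuration (n : nat) : finType := {ffun 'I_n -> bool}.

Definition spin (R : realType) (n : nat) (s : configuration n) (i : 'I_n) : R :=
  if s i then 1 else -1.

Definition nplus (n : nat) (s : configuration n) : nat := #|[set i | s i]%SET|.

Definition hamiltonian (R : realType) (n d : nat) (beta B : R)
    (M : multigraph n d) (s : configuration n) : R :=
  - beta * (\sum_(i < n) \sum_(j < n | (i <= j)%N)
              (edge_mult M i j)%:R * spin R s i * spin R s j)
  - B * (\sum_(i < n) spin R s i).

Definition partition_fun (R : realType) (n d : nat) (beta B : R)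
    (M : multigraph n d) (t : R) : R :=
  \sum_(s : configuration n | (nplus s)%:Z == Num.ceil (n%:R * t))
     expR (- hamiltonian beta B M s).

Definition free_energy (R : realType) (n d : nat) (beta B : R)
    (M : multigraph n d) (t : R) : R :=
  n%:R^-1 * ln (partition_fun beta B M t).

Local Open Scope classical_set_scope.

(* For every n with n * d even, G n is a uniformly random pairing.  Nothing is
   assumed on the joint law of the graphs G n, nor on G n for n * d odd (there
   is then no pairing). *)
Definition configuration_model (R : realType) (dsp : measure_display)
    (T : measurableType dsp) (P : probability T R) (d : nat)
    (G : forall n, T -> multigraph n d) : Prop :=
  forall n, ~~ odd (n * d) -> forall M : multigraph n d,
    measurable (G n @^-1` [set M]) /\
    P (G n @^-1` [set M]) = ((M \in pairings n d)%:R / #|pairings n d|%:R)%:E.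

Definition mean_free_energy (R : realType) (dsp : measure_display)
    (T : measurableType dsp) (P : probability T R) (d : nat)
    (G : forall n, T -> multigraph n d) (n : nat) (beta B t : R) : R :=
  fine ('E_P[fun w => free_energy beta B (G n w) t])%E.

Definition atanh (R : realType) (x : R) : R := ln ((1 + x) / (1 - x)) / 2.

Definition beta_c (R : realType) (d : nat) : R := atanh (d%:R - 1)^-1.

(* The supremum is taken in the extended reals: no boundedness is assumed. *)
Definition B_c (R : realType) (f : R -> R) : \bar R :=
  ereal_sup [set x : \bar R | exists s t : R,
    [/\ 0 < s, s < t, t < 1 / 2 & x = ((f s - f t) / (2 * (t - s)))%:E]].

(* Main.v *)
(* Write the energy as a sum over the edges of products of half-edge spins.

   (i) Exchanging two half-edges changes the log of the partition function by
   at most 4 beta.  Writing a uniform pairing as the result of one random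
   transposition per half-edge, this gives exponential concentration, and
   Borel-Cantelli applies.

   (ii) Flipping one spin changes log Z_n by O(1) plus the logarithm of a ratio
   of counts, which gives a modulus of continuity in t uniform in n, and log Z_n
   is n d-Lipschitz in beta.  Limits along an ultrafilter therefore exist for
   all (beta, t) at once, and a subsequence (of even n) follows them on finer
   and finer finite grids.

   - B_c < beta d holds for every pairing: swapping spins shows that a positive
     fraction of the minus vertices have a plus neighbour, so that a flip costs
     on average strictly less than 2 beta d.
   - B_c > 0: the loop expansion of Z at a Bethe fixed point of positive
     magnetization has only nonnegative terms, hence Z is at least its Bethe
     value for every d-regular multigraph.  For beta > beta_c this beats the
     paramagnetic value log 2 + (d/2) log cosh beta, which by the first moment
     method bounds phi(1/2).
   - B_c >= c beta: phi(0) = beta d / 2, whereas Z_beta <= Z_1^beta gives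
     phi_beta(1/2) <= beta phi_1(1/2) <= beta (log 2 + (d/2) log cosh 1). *)

Require Import Defs.
From HB Require Import structures.
From mathcomp Require Import all_boot all_order all_algebra all_fingroup.
From mathcomp Require Import all_classical all_reals all_analysis.
From mathcomp Require Import ring lra zify.
Import Order.TTheory GRing.Theory Num.Theory.
Import numFieldNormedType.Exports.
Set Implicit Arguments.
Unset Strict Implicit.
Local Open Scope ring_scope.

(** * Energy of a pairing *)

(** Spins are carried by half-edges, so that permuting the half-edges of a pairing amounts to
    permuting the spins. The loop expansion is then used twice: with spins constant on each vertex,
    where a gauge makes every term nonnegative, and with free half-edge spins, where only the empty
    loop survives and the sum behind the first moment bound becomes exact. The field only sees the
    number of plus spins, so the estimates are made at [B = 0]. The main mismatch is that the Bethe
    bound concerns the sum over all configurations, whereas [B_c] needs a fixed number of plus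
    spins. Pigeonhole gives such a number at the cost [ln (n + 1)], and spin reversal brings it to
    at most [n / 2], but it depends on the pairing. Concentration provides one pairing that is close
    to the mean at all [n + 1] counts at once, and its count then serves for the mean. In the upper
    bound on [B_c], swapping spins is of no help when plus spins are rare; there the entropy of a
    flip gives a factor 2 instead. *)

Section Energy.
Context {R : realType} {H : finType}.
Implicit Types (M : {set {set H}}) (e : {set H}) (s : H -> bool).

Definition is_pairing M : bool :=
  finset.partition M [set: H]%SET && [forall e in M, #|e| == 2%N].

Definition sg (b : bool) : R := if b then 1 else -1.

Definition edge_spin s e : R := \prod_(h in e) sg (s h).

Definition energy s M : R := \sum_(e in M) edge_spin s e.

Lemma normr_sg b : `|sg b| = 1.
Proof. by case: b => /=; rewrite ?normrN normr1. Qed.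

Lemma normr_edge_spin s e : `|edge_spin s e| = 1.
Proof.
by rewrite /edge_spin normr_prod big1 // => h _; rewrite normr_sg.
Qed.

Lemma pairing_partition M : is_pairing M -> finset.partition M [set: H]%SET.
Proof. by case/andP. Qed.

Lemma card_pairing_edge M e : is_pairing M -> e \in M -> #|e| = 2%N.
Proof. by case/andP=> _ /forall_inP h /h /eqP. Qed.

Lemma card_pairing M : is_pairing M -> #|H| = (#|M| * 2)%N.
Proof.
move=> pM; rewrite -cardsT; apply: card_uniform_partition (pairing_partition pM).
by move=> e; apply: card_pairing_edge.
Qed.

Lemma pblock_pairing M h : is_pairing M -> finset.pblock M h \in M /\ h \in
  finset.pblock M h.
Proof.
move=> pM; have /and3P[/eqP cM _ _] := pairing_partition pM.
by rewrite pblock_mem ?mem_pblock cM inE.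
Qed.

Lemma pblock_pairingE M e h :
  is_pairing M -> e \in M -> h \in e -> finset.pblock M h = e.
Proof.
move=> pM; have /and3P[_ tM _] := pairing_partition pM.
exact: def_pblock.
Qed.

Lemma big_pairing (A : Type) (idx : A) (op : Monoid.com_law idx) M
    (F : H -> A) :
  is_pairing M -> \big[op/idx]_h F h = \big[op/idx]_(e in M) \big[op/idx]_(h in
    e) F h.
Proof.
move=> pM; rewrite -(set_partition_big _ (pairing_partition pM)).
by apply: eq_bigl => h; rewrite inE.
Qed.

Lemma norm_edge_spinB s s' e :
  `|edge_spin s e - edge_spin s' e| <= 2 * #|[set h in e | s h != s' h]%SET|%:R.
Proof.
have [/eqP|] := posnP #|[set h in e | s h != s' h]%SET|.
  rewrite cards_eq0 => /eqP D0; rewrite (_ : edge_spin s e = edge_spin s' e).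
    by rewrite subrr normr0 mulr_ge0.
  apply: eq_bigr => h he; congr sg; apply/eqP.
  by move/finset.setP: D0 => /(_ h); rewrite !inE he /= => /negbFE.
move=> D1; apply: le_trans (_ : 2 <= _).
  by rewrite (le_trans (ler_normB _ _))// !normr_edge_spin.
by rewrite ler_peMr// ler1n.
Qed.

Lemma sum_card_pairing M (p : pred H) : is_pairing M ->
  \sum_(e in M) (#|[set h in e | p h]%SET|%:R : R) = #|[set h | p h]%SET|%:R.
Proof.
move=> pM; rewrite -natr_sum; congr _%:R.
rewrite -[RHS]sum1_card [RHS]big_mkcond [RHS](big_pairing _ _ pM)/=.
apply: eq_bigr => e _; rewrite -sum1_card big_mkcond [RHS]big_mkcond/=.
by apply: eq_bigr => h _; rewrite !inE; case: (h \in e).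
Qed.

Lemma norm_energyB M s s' : is_pairing M ->
  `|energy s M - energy s' M| <= 2 * #|[set h | s h != s' h]%SET|%:R.
Proof.
move=> pM; rewrite -(sum_card_pairing _ pM) mulr_sumr -sumrB.
apply: le_trans (ler_norm_sum _ _ _) _; apply: ler_sum => e _.
exact: norm_edge_spinB.
Qed.

(** In [norm_energyB] the edge [e0] is charged at least 2, since it carries a changed half-edge; if
    it does not lose energy, this charge is refunded. The saving of 2 is what makes [B_c] strictly
    smaller than [beta d]. *)
Lemma energyB_edge M s s' e0 : is_pairing M -> e0 \in M ->
  edge_spin s e0 <= edge_spin s' e0 -> [exists h in e0, s h != s' h] ->
  - (2 * (#|[set h | s h != s' h]%SET|%:R - 1)) <= energy s' M - energy s M.
Proof.
move=> pM e0M le0 /exists_inP[h he0 hs].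
rewrite -(sum_card_pairing _ pM) /energy -sumrB.
rewrite (bigD1 e0)//= [leRHS](bigD1 e0)//=.
have c1 : (1 : R) <= #|[set h in e0 | s h != s' h]%SET|%:R.
  by rewrite ler1n card_gt0; apply/set0Pn; exists h; rewrite inE he0.
set T := (X in - (2 * (_ + X - 1)) <= _).
set T' := (X in _ <= _ + X).
have : - (2 * T) <= T'.
  rewrite /T /T' mulr_sumr -sumrN; apply: ler_sum => e _.
  have := norm_edge_spinB s' s e; rewrite ler_norml => /andP[+ _].
  rewrite (_ : [set h in e | s' h != s h]%SET = [set h in e | s h != s' h]%SET)//.
  by apply/finset.setP => x; rewrite !inE eq_sym.
move: le0 c1; set x := edge_spin _ _; set y := edge_spin _ _.
set z := (X in 1 <= X).
lra.
Qed.

Lemma norm_energy M s : is_pairing M -> `|energy s M| <= #|M|%:R.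
Proof.
move=> pM; apply: le_trans (ler_norm_sum _ _ _) _.
rewrite (eq_bigr (fun=> 1)) => [|e _]; first by rewrite sumr_const.
exact: normr_edge_spin.
Qed.

Lemma energy_const M s b : is_pairing M -> (forall h, s h = b) ->
  energy s M = #|M|%:R.
Proof.
move=> pM sb; rewrite /energy (eq_bigr (fun=> 1)) ?sumr_const// => e eM.
rewrite /edge_spin (eq_bigr (fun=> sg b)) => [|h _]; last by rewrite sb.
rewrite prodr_const (card_pairing_edge pM eM).
by case: b {sb}; rewrite /= ?expr1n// sqrrN expr1n.
Qed.

End Energy.

(** * Loop expansion and the Bethe lower bound *)

Section LoopExpansion.
Context {R : realType}.

Lemma prodr_1D (I : finType) (A : {set I}) (F : I -> R) :
  \prod_(i in A) (1 + F i) = \sum_(J : {set I} | J \subset A) \prod_(i in J) F i.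
Proof.
rewrite big_mkcond/= (eq_bigr (fun i => (i \in A)%:R * F i + 1)); last first.
  by move=> i _; case: ifP => _; rewrite ?mul1r ?mul0r ?add0r// addrC.
rewrite bigA_distr [RHS]big_mkcond; apply: eq_bigr => J _.
rewrite -big_mkcond/=; case: ifPn => [/fintype.subsetP JA|/fintype.subsetPn[i iJ iA]].
  by apply: eq_bigr => i /JA ->; rewrite mul1r.
by rewrite (bigD1 i)//= (negbTE iA) !mul0r.
Qed.

Variables (H V : finType) (v : H -> V) (M : {set {set H}}).
Hypothesis pM : is_pairing M.

Definition loop_degree (J : {set {set H}}) (i : V) : nat :=
  #|[set h in finset.cover J | v h == i]%SET|.

(** Expanding the product over the edges leaves a choice [J] of edges. These are disjoint, so their
    factors regroup by vertex, and the sum over spins splits into one moment per vertex, whose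
    exponent is the degree of that vertex in [J]. *)
Lemma loop_expansion (w : bool -> R) (m k : R) :
  \sum_(s : {ffun V -> bool}) (\prod_i w (s i)) *
     \prod_(e in M) (1 + k * \prod_(h in e) (m - sg (s (v h)))) =
  \sum_(J : {set {set H}} | J \subset M)
     k ^+ #|J| * \prod_i \sum_b w b * (m - sg b) ^+ loop_degree J i.
Proof.
under eq_bigr do rewrite prodr_1D mulr_sumr.
rewrite exchange_big/=; apply: eq_bigr => J JM.
have /and3P[_ tM _] := pairing_partition pM.
have tJ := finset.trivIsetS JM tM.
rewrite bigA_distr_bigA mulr_sumr; apply: eq_bigr => s _.
rewrite big_split/= prodr_const mulrCA; congr (_ * _).
rewrite big_split/=; congr (_ * _).
rewrite -(finset.big_trivIset J tJ)/= (partition_big v xpredT)//=.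
apply: eq_bigr => i _.
rewrite (eq_bigr (fun=> m - sg (s i))) => [|h /andP[_ /eqP ->]]//.
by rewrite prodr_const; congr (_ ^+ _); apply: eq_card => h; rewrite !inE.
Qed.

End LoopExpansion.

Section BetheBound.
Context {R : realType}.

(** The hypothesis is [tanh a <= m], which is the case [q = 1]. Only odd [q] with [m < 1] is at
    issue: the negative term is [(1 - m) e^a (1 - m)^p] with [p = q - 1], and it is compared factor
    by factor with [(1 + m) e^(- a) (1 + m)^p]. *)
Lemma tilted_moment_ge0 (a m : R) q : 0 <= m ->
  (1 - m) * expR a <= (1 + m) * expR (- a) ->
  0 <= \sum_(b : bool) expR (a * sg b) * (m - sg b) ^+ q.
Proof.
move=> m0 am; rewrite big_bool/= mulr1 mulrN1.
have [qo|qe] := boolP (odd q); last first.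
  by rewrite addr_ge0// mulr_ge0 ?expR_ge0// exprn_even_ge0.
have [m1|m1] := leP 1 m.
  by rewrite addr_ge0// mulr_ge0 ?expR_ge0// exprn_ge0; lra.
case: q qo => // p /= po.
rewrite -(opprB 1 m) exprNn -signr_odd /= po mulN1r mulrN addrC subr_ge0 !exprS.
rewrite opprK !mulrA; apply: ler_pM => //.
- by rewrite mulr_ge0 ?expR_ge0//; lra.
- by rewrite exprn_ge0//; lra.
- by rewrite mulrC [leRHS]mulrC [m + 1]addrC.
- by apply: lerXn2r; rewrite ?nnegrE; lra.
Qed.

Section Bound.
Variables (H V : finType) (v : H -> V) (M : {set {set H}}) (d : nat).
Hypothesis pM : is_pairing M.
Hypothesis vd : forall i : V, #|[set h | v h == i]%SET| = d.

Lemma prod_half_edges (f : V -> R) :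
  \prod_(e in M) \prod_(h in e) f (v h) = \prod_i f i ^+ d.
Proof.
rewrite -(big_pairing _ _ pM) (partition_big v xpredT)//=.
apply: eq_bigr => i _; rewrite (eq_bigr (fun=> f i)) => [|h /eqP ->]//.
by rewrite prodr_const -(vd i); congr (_ ^+ _); apply: eq_card => h; rewrite !inE.
Qed.

(* Gauge transformation: [a] and [m] are chosen so that every generalized loop
   contributes a nonnegative term to the loop expansion. *)
Lemma bethe_lower_bound (beta a A k m : R) : 0 <= A -> 0 <= k -> 0 <= m ->
  (1 - m) * expR (a *+ d) <= (1 + m) * expR (- (a *+ d)) ->
  (forall b c : bool, expR (beta * (sg b * sg c)) =
     A * (expR (a * sg b) * expR (a * sg c)) *
       (1 + k * ((m - sg b) * (m - sg c)))) ->
  A ^+ #|M| * (expR (a *+ d) + expR (- (a *+ d))) ^+ #|V| <=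
  \sum_(s : {ffun V -> bool}) expR (beta * energy (fun h => s (v h)) M).
Proof.
move=> A0 k0 m0 am gauge.
have edgeE (s : {ffun V -> bool}) e : e \in M ->
    expR (beta * edge_spin (fun h => s (v h)) e) =
    A * (\prod_(h in e) expR (a * sg (s (v h)))) *
    (1 + k * \prod_(h in e) (m - sg (s (v h)))).
  move=> /(card_pairing_edge pM)/eqP/cards2P[h [h' [hh' ->]]].
  by rewrite /edge_spin !big_setU1 ?inE//= !big_set1 gauge.
have -> : \sum_(s : {ffun V -> bool}) expR (beta * energy (fun h => s (v h)) M) =
   A ^+ #|M| * \sum_(s : {ffun V -> bool}) (\prod_i expR (a *+ d * sg (s i))) *
     \prod_(e in M) (1 + k * \prod_(h in e) (m - sg (s (v h)))).
  rewrite mulr_sumr; apply: eq_bigr => s _.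
  rewrite /energy mulr_sumr expR_sum (eq_bigr _ (edgeE s)) !big_split/=.
  rewrite prodr_const (prod_half_edges (fun i => expR (a * sg (s i)))).
  rewrite mulrA; congr (_ * _ * _); apply: eq_bigr => i _.
  by rewrite -expRM_natl mulrA mulr_natl.
rewrite (loop_expansion v pM (fun b => expR (a *+ d * sg b))).
apply: ler_wpM2l; first exact: exprn_ge0.
(* The empty [J], all of whose loop degrees are 0, alone gives the announced bound. *)
rewrite (bigD1 finset.set0) ?finset.sub0set//= cards0 expr0 mul1r -[leLHS]addr0.
apply: lerD; last first.
  apply: sumr_ge0 => J _; rewrite mulr_ge0 ?exprn_ge0//.
  by apply: prodr_ge0 => i _; apply: tilted_moment_ge0.
rewrite le_eqVlt -prodr_const; apply/orP; left; apply/eqP; apply: eq_bigr => i _.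
rewrite big_bool/= mulr1 mulrN1 (_ : loop_degree _ _ _ = 0%N) ?expr0 ?mulr1//.
apply/eqP; rewrite cards_eq0; apply/eqP/finset.setP => h.
by rewrite !inE /finset.cover big_set0 inE.
Qed.

End Bound.
End BetheBound.

(** * Elementary estimates for cosh and sinh *)

Section Hyperbolic.
Context {R : realType}.
Implicit Types x a : R.

Definition ch x : R := (expR x + expR (- x)) / 2.
Definition sh x : R := (expR x - expR (- x)) / 2.

Lemma expR_mulN x : expR x * expR (- x) = 1.
Proof. by rewrite -expRD subrr expR0. Qed.

Lemma ch_gt0 x : 0 < ch x.
Proof. by rewrite /ch; have := expR_gt0 x; have := expR_gt0 (- x); lra. Qed.

Lemma sh_ge0 x : 0 <= x -> 0 <= sh x.
Proof.
move=> x0; rewrite /sh divr_ge0// subr_ge0 ler_expR; lra.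
Qed.

Lemma is_derive_ch x : is_derive x 1 ch (sh x).
Proof.
rewrite /ch /sh; apply: is_derive_eq.
by rewrite /GRing.scale/=; ring.
Qed.

Lemma is_derive_sh x : is_derive x 1 sh (ch x).
Proof.
rewrite /ch /sh; apply: is_derive_eq.
by rewrite /GRing.scale/=; ring.
Qed.

Lemma sh_le a : 0 <= a < 1 -> sh a <= a / (1 - a).
Proof.
move=> /andP[a0 a1]; rewrite /sh.
have h1 : 1 - a <= expR (- a) by have := expR_ge1Dx (- a); lra.
have h2 : expR a <= (1 - a)^-1.
  rewrite -[leLHS]invrK lef_pV2 ?posrE ?invr_gt0 ?expR_gt0//; last by lra.
  by rewrite -expRN.
rewrite ler_pdivrMr// mulrAC.
have : (1 - a)^-1 * (1 - a) = 1 by rewrite mulVf//; lra.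
have : 0 < (1 - a)^-1 by rewrite invr_gt0; lra.
set i := (1 - a)^-1 in h2 *.
nra.
Qed.

(** Half-angle formula: [ch x - 1] is half the square of [expR z - expR (- z)] with [z = x / 2]. The
    coefficient of [x ^ 2] at 0 is the exact one, which [bethe_pos_near0] needs in order to reach
    every [b < d]. *)
Lemma ch_ge x : 0 <= x -> 1 + x ^+ 2 / (2 * (1 + x / 2) ^+ 2) <= ch x.
Proof.
move=> x0; pose z := x / 2; have z0 : 0 <= z by rewrite divr_ge0.
have E : expR x = expR z ^+ 2 /\ expR (- x) = expR (- z) ^+ 2.
  by rewrite -!expRM_natl; split; congr expR; rewrite /z; field.
rewrite /ch E.1 E.2.
have -> : x ^+ 2 / (2 * (1 + x / 2) ^+ 2) = 2 * (z / (1 + z)) ^+ 2.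
  by rewrite /z; field; lra.
have h1 := expR_ge1Dx z.
have h2 : expR (- z) <= (1 + z)^-1.
  by rewrite expRN lef_pV2 ?posrE ?expR_gt0//; lra.
have h3 := expR_mulN z.
have h4 : 2 * (z / (1 + z)) <= expR z - expR (- z).
  have : (1 + z)^-1 * (1 + z) = 1 by rewrite mulVf//; lra.
  have : 0 < (1 + z)^-1 by rewrite invr_gt0; lra.
  set i := (1 + z)^-1 in h2 *; nra.
have h5 : 0 <= z / (1 + z) by rewrite divr_ge0//; lra.
move: h4 h5; set t := z / (1 + z); nra.
Qed.

End Hyperbolic.

(** * The Bethe free energy and its maximiser *)

Section BetheFunction.
Context {R : realType}.
Variables (d : nat) (b : R).
Hypotheses (d3 : (3 <= d)%N) (b2 : 2 < b) (bd : b < d%:R).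

(* Bethe free energy per vertex, relative to its value at the paramagnetic
   point [a = 0]; here [b = 1 + coth beta]. *)
Definition bethe (a : R) : R :=
  ln (ch (a *+ d)) - d%:R / 2 * ln (1 + b * sh a ^+ 2).

Lemma bethe_den_gt0 a : 0 < 1 + b * sh a ^+ 2.
Proof. by rewrite ltr_wpDr// mulr_ge0 ?sqr_ge0//; move: b2; lra. Qed.

Lemma is_derive_bethe (a : R) : is_derive a 1 bethe
  (d%:R * (sh (a *+ d) / ch (a *+ d) - b * sh a * ch a / (1 + b * sh a ^+ 2))).
Proof.
have h1 : is_derive a 1 (fun a : R => a *+ d) (d%:R : R).
  rewrite (_ : (fun a : R => a *+ d) = (fun a => d%:R *: id a)); last first.
    by apply/funext => x; rewrite /= /GRing.scale/= mulr_natl.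
  by apply: is_derive_eq; rewrite /GRing.scale/= mulr1.
have h2 := @is_derive1_comp R ch (fun a => a *+ d) a _ _ (is_derive_ch (a *+ d)) h1.
have h3 := @is_derive1_comp R (@ln R) (fun a => ch (a *+ d)) a _ _ (is_derive1_ln
  (ch_gt0 (a *+ d))) h2.
have h4 : is_derive a 1 (fun a : R => 1 + b * sh a ^+ 2) (b * (2 * sh a * ch a)).
  have h := is_derive_sh a.
  by apply: is_derive_eq; rewrite /GRing.scale/=; ring.
have h5 := @is_derive1_comp R (@ln R) (fun a => 1 + b * sh a ^+ 2) a _ _
  (is_derive1_ln (bethe_den_gt0 a)) h4.
have h6 : is_derive a 1 (fun a => d%:R / 2 * ln (1 + b * sh a ^+ 2))
   (d%:R / 2 * ((1 + b * sh a ^+ 2)^-1 * (b * (2 * sh a * ch a)))).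
  by apply: is_derive_eq; rewrite /GRing.scale/=.
have h7 : is_derive a 1 bethe _ := is_deriveB h3 h6.
apply: (@is_derive_eq _ _ _ _ _ _ _ _ h7).
have := ch_gt0 (a *+ d); have := bethe_den_gt0 a => p1 p2.
by field; rewrite !gt_eqF.
Qed.

(** To second order at 0, [bethe a] is [d (d - b) a^2 / 2], positive because [b < d]. The upper end
    of the range makes this effective: it forces [a d <= 1 / 8] and lets [d - b] dominate the error
    terms. *)
Lemma bethe_pos_near0 (a : R) : 0 < a <= (d%:R - b) / (8 * d%:R ^+ 2) -> 0 < bethe a.
Proof.
move=> /andP[a0 ale].
have d3R : 3 <= d%:R :> R by rewrite ler_nat.
have := bd; have := b2 => b2' bd'.
have dd : a * (8 * d%:R ^+ 2) <= d%:R - b by rewrite -ler_pdivlMr//; nra.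
have da : a * d%:R <= 1 / 8 by nra.
have a1 : a < 1 by nra.
rewrite /bethe subr_gt0 (_ : a *+ d = a * d%:R) ; last by rewrite mulr_natr.
set z := a * d%:R.
have z0 : 0 < z by rewrite mulr_gt0//; lra.
pose y := z ^+ 2 / (2 * (1 + z / 2) ^+ 2).
have y0 : 0 < y by rewrite divr_gt0 ?mulr_gt0 ?exprn_gt0//; lra.
have yE : y = z ^+ 2 / (2 * (1 + z / 2) ^+ 2) by [].
have : 1 + y <= ch z by apply: ch_ge; lra.
clearbody y => ychz; have hy : y / (1 + y) <= ln (ch z).
  have y1 : 0 < 1 + y by lra.
  apply: le_trans (_ : ln (1 + y) <= _); last by rewrite ler_ln ?posrE ?ch_gt0.
  have := @le_ln1Dx R (- (y / (1 + y))).
  have -> : 1 - y / (1 + y) = (1 + y)^-1 by field; rewrite gt_eqF.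
  rewrite lnV ?posrE// lerN2; apply.
  by rewrite ltrN2 ltr_pdivrMr//; lra.
have hs : ln (1 + b * sh a ^+ 2) <= b * (a / (1 - a)) ^+ 2.
  have := bethe_den_gt0 a => den0.
  apply: (@le_trans _ _ (b * sh a ^+ 2)); first by apply: le_ln1Dx; lra.
  rewrite ler_pM2l; last by move: b2; lra.
  by apply: lerXn2r; rewrite ?nnegrE ?sh_ge0 ?divr_ge0 ?sh_le//; lra.
apply: le_lt_trans (_ : d%:R / 2 * (b * (a / (1 - a)) ^+ 2) < _).
  by rewrite ler_pM2l//; lra.
apply: lt_le_trans hy.
have -> : y / (1 + y) = z ^+ 2 / (2 * (1 + z / 2) ^+ 2 + z ^+ 2).
  rewrite yE; field; have := sqr_ge0 z; have := sqr_ge0 (1 + z / 2).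
  by nra.
have p1 : 0 < 2 * (1 + z / 2) ^+ 2 + z ^+ 2.
  by have := sqr_ge0 z; have := sqr_ge0 (1 + z / 2); nra.
have p2 : 0 < (1 - a) ^+ 2 by rewrite exprn_gt0//; lra.
have key : b * (2 * (1 + z / 2) ^+ 2 + z ^+ 2) < 2 * d%:R * (1 - a) ^+ 2.
  have z8 : z <= 1 / 8 by [].
  have k1 : b * (2 * (1 + z / 2) ^+ 2 + z ^+ 2) <= 2 * b + 9 / 4 * (d%:R * z).
    have : 2 * (1 + z / 2) ^+ 2 + z ^+ 2 <= 2 + 9 / 4 * z by nra.
    have : b * z <= d%:R * z by rewrite ler_pM2r// ltW.
    by nra.
  have k2 : 2 * d%:R * (1 - 2 * a) <= 2 * d%:R * (1 - a) ^+ 2.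
    by rewrite ler_pM2l; nra.
  have k3 : a * d%:R * 3 <= a * d%:R ^+ 2.
    by rewrite expr2 mulrA ler_pM2l// mulr_gt0//; lra.
  have k4 : d%:R * z = a * d%:R ^+ 2 by rewrite /z; ring.
  by rewrite k4 in k1; nra.
have -> : d%:R / 2 * (b * (a / (1 - a)) ^+ 2) =
    a ^+ 2 * d%:R / 2 * b / (1 - a) ^+ 2.
  by field; lra.
rewrite ltr_pdivrMr// [ltRHS]mulrAC ltr_pdivlMr//.
move: key p1 p2; set p := 2 * _ + _; set q := (1 - a) ^+ 2 => key p0 q0.
have -> : z ^+ 2 = (a ^+ 2 * d%:R / 2) * (2 * d%:R) by rewrite /z; field.
have w0 : 0 < a ^+ 2 * d%:R / 2 by rewrite divr_gt0// mulr_gt0 ?exprn_gt0//; lra.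
by move: key; rewrite -(ltr_pM2l w0) !mulrA.
Qed.

(** The function is maximised on [[0, B]] instead of solving the fixed point equation. Only
    [tanh (d a) <= m] is wanted, with [m] the right-hand ratio: an interior maximiser gives
    equality, and at the endpoint [B] the hypothesis says that [m = 1]. The maximiser is not 0,
    where [bethe] vanishes. *)
Lemma bethe_argmax (B : R) : 0 < B -> b * sh B * ch B = 1 + b * sh B ^+ 2 ->
  exists2 a, 0 < bethe a & 0 <= a /\ sh (a *+ d) / ch (a *+ d) <= b * sh a * ch a
    / (1 + b * sh a ^+ 2).
Proof.
move=> B0 BE; have := bd; have := b2 => b2' bd'.
have d3R : 3 <= d%:R :> R by rewrite ler_nat.
have drv a : derivable bethe a 1 by have [] := is_derive_bethe a.
have [c cB cmax] : exists2 c, c \in `[0, B] & forall t, t \in `[0, B] -> bethe t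
  <= bethe c.
  apply: EVT_max; first exact: ltW.
  by apply: derivable_within_continuous.
pose a0 := Num.min B ((d%:R - b) / (8 * d%:R ^+ 2)).
have a00 : 0 < a0.
  by rewrite lt_min B0 divr_gt0//; nra.
have bc : 0 < bethe c.
  apply: lt_le_trans (bethe_pos_near0 (_ : 0 < a0 <= _)) (cmax _ _).
    by rewrite a00 ge_min lexx orbT.
  by rewrite in_itv/= ltW// ge_min lexx.
move: cB; rewrite in_itv/= => /andP[c0 cB].
exists c => //; split => //.
have [cltB|] := ltP c B; last first.
  move=> Bc; have -> : c = B by apply/eqP; rewrite eq_le cB.
  rewrite BE divff ?gt_eqF ?bethe_den_gt0//.
  rewrite ler_pdivrMr ?ch_gt0// mul1r /sh /ch.
  by have := expR_gt0 (- (B *+ d)); lra.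
have c_gt0 : 0 < c.
  rewrite lt_neqAle c0 andbT; apply: contraTneq bc => <-.
  by rewrite /bethe /sh /ch mul0rn oppr0 expR0 subrr !mul0r expr0n/= mulr0 addr0
    ln1 mulr0 subr0 (_ : (1 + 1) / 2 = 1) ?ln1 ?ltxx//; field.
have h0 : is_derive c 1 bethe 0.
  apply: (@derive1_at_max _ _ 0 B) => //; first exact: ltW.
    by rewrite in_itv/= c_gt0.
  by move=> t; rewrite in_itv/= => /andP[t0 tB]; apply: cmax; rewrite in_itv/= !ltW.
have := @derive_val _ _ _ _ _ _ _ (is_derive_bethe c).
rewrite (@derive_val _ _ _ _ _ _ _ h0) => /esym/eqP.
rewrite mulf_eq0 gt_eqF/=; last by lra.
by rewrite subr_eq0 => /eqP ->.
Qed.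
End BetheFunction.

Section BetheGap.
Context {R : realType}.

(** Here [atanh (1 / (d - 1)) = ln (d / (d - 2)) / 2]. The second conclusion is [1 + coth beta < d],
    the form in which the Bethe function uses the supercritical regime. *)
Lemma beta_c_lt (d : nat) (beta : R) : (3 <= d)%N -> beta_c R d < beta ->
  0 < beta /\ expR (- (2 * beta)) * d%:R < d%:R - 2.
Proof.
move=> d3; have d3R : 3 <= d%:R :> R by rewrite ler_nat.
rewrite /beta_c /atanh.
have -> : (1 + (d%:R - 1)^-1) / (1 - (d%:R - 1)^-1) = d%:R / (d%:R - 2) :> R.
  by field; apply/andP; split; rewrite gt_eqF //; lra.
rewrite ltr_pdivrMr// => lb.
have r0 : 0 < d%:R / (d%:R - 2) :> R by rewrite divr_gt0//; lra.
have eb : d%:R / (d%:R - 2) < expR (2 * beta) by rewrite -[ltLHS]lnK ?posrE//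
  ltr_expR (mulrC 2).
have d20 : 0 < d%:R - 2 :> R by lra.
split.
  have : 0 < ln (d%:R / (d%:R - 2) : R).
    by apply: ln_gt0; rewrite ltr_pdivlMr//; lra.
  lra.
move: eb; rewrite ltr_pdivrMr// mulrC => eb.
rewrite mulrC expRN ltr_pdivrMr ?expR_gt0//.
Qed.

(** [Q] is the Bethe value: it exceeds the paramagnetic value by [bethe a] at the maximiser [a]. It
    is fixed before the graph, so the gap is uniform in the number of vertices. *)
Lemma bethe_gap (d : nat) (beta : R) : (3 <= d)%N -> beta_c R d < beta ->
  exists2 Q, ln 2 + d%:R / 2 * ln (ch beta) < Q &
  forall (H V : finType) (v : H -> V) (M : {set {set H}}), is_pairing M ->
    (forall i : V, #|[set h | v h == i]%SET| = d) ->
    expR (#|V|%:R * Q) <=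
    \sum_(s : {ffun V -> bool}) expR (beta * energy (fun h => s (v h)) M).
Proof.
move=> d3 /(beta_c_lt d3)[beta0 db].
have d3R : 3 <= d%:R :> R by rewrite ler_nat.
pose yi := expR (- beta); pose y := expR beta.
have yyi : y * yi = 1 by exact: expR_mulN.
have y1 : 1 < y by rewrite expR_gt1.
have yi0 : 0 < yi by exact: expR_gt0.
have yiE : expR (- (2 * beta)) = yi ^+ 2.
  by rewrite -expRM_natl; congr expR; ring.
rewrite yiE in db.
have yi1 : yi < 1 by rewrite -expR0 ltr_expR; lra.
have yi21 : yi ^+ 2 < 1 by rewrite expr_lt1// ltW.
pose b := 2 / (1 - yi ^+ 2).
have bE : b * (1 - yi ^+ 2) = 2 by rewrite mulfVK// gt_eqF// subr_gt0.
have b2 : 2 < b.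
  by rewrite ltr_pdivlMr ?subr_gt0//; have := exprn_gt0 2 yi0; lra.
have bd : b < d%:R by rewrite ltr_pdivrMr ?subr_gt0//; lra.
(* This identity yields [m = 1] at [a = beta], the endpoint condition of [bethe_argmax]. *)
have byE : b * sh beta = y.
  rewrite /sh -/y -/yi.
  have -> : y - yi = y * (1 - yi ^+ 2) by ring: yyi.
  by rewrite mulrA mulrCA bE; field.
have [|a G0 [a0 am]] := bethe_argmax d3 b2 bd beta0.
  rewrite expr2 mulrA byE /ch /sh -/y -/yi.
  have -> : y * ((y + yi) / 2) = (y * y + y * yi) / 2 by field.
  have -> : y * ((y - yi) / 2) = (y * y - y * yi) / 2 by field.
  by rewrite yyi; field.
(* [A], [k] and [m] solve the gauge equation
   [e^(beta s s') = A e^(a (s + s')) (1 + k (m - s) (m - s'))], and the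
   stationarity of [bethe] at [a] is [m = tanh (d a)]. *)
pose W := 1 + b * sh a ^+ 2.
have W0 : 0 < W := bethe_den_gt0 b2 a.
pose A := ch beta / W.
have A0 : 0 < A by rewrite divr_gt0// ch_gt0.
pose m := b * sh a * ch a / W.
pose k := sh beta * W ^+ 2 / ch beta.
exists (ln (2 * ch (a *+ d)) + d%:R / 2 * ln A).
  have -> : ln A = ln (ch beta) - ln W by rewrite ln_div ?posrE ?ch_gt0.
  have -> : ln (2 * ch (a *+ d)) = ln 2 + ln (ch (a *+ d)).
    by rewrite lnM ?posrE ?ch_gt0.
  by move: G0; rewrite /bethe -/W; lra.
move=> H V v M pM vd.
have cM : (#|V| * d)%N = (#|M| * 2)%N.
  rewrite -(card_pairing pM) -[RHS]sum1_card (partition_big v xpredT)//=.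
  rewrite -sum_nat_const; apply: eq_bigr => i _.
  by rewrite -(vd i) -sum1_card; apply: eq_bigl => h; rewrite !inE.
have -> : expR (#|V|%:R * (ln (2 * ch (a *+ d)) + d%:R / 2 * ln A)) =
    A ^+ #|M| * (expR (a *+ d) + expR (- (a *+ d))) ^+ #|V|.
  have c2 : 0 < 2 * ch (a *+ d) by rewrite mulr_gt0 ?ch_gt0.
  rewrite mulrDr expRD expRM_natl lnK ?posrE// mulrC.
  congr (_ * _); last by congr (_ ^+ _); rewrite /ch; field.
  rewrite mulrA (_ : _ * (d%:R / 2) = #|M|%:R) ?expRM_natl ?lnK//.
  by rewrite mulrA -natrM cM natrM mulfK.
have sh0 := sh_ge0 a0.
apply: (bethe_lower_bound (k := k) (m := m) pM vd).
- exact: ltW.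
- by rewrite /k divr_ge0 ?(ltW (ch_gt0 _))// mulr_ge0 ?sqr_ge0 ?sh_ge0// ltW.
- by rewrite /m divr_ge0 ?(ltW W0)// mulr_ge0 ?(ltW (ch_gt0 _))// mulr_ge0//; lra.
- move: am; rewrite -/W -/m ler_pdivrMr ?ch_gt0// /sh /ch; lra.
have chb := ch_gt0 beta.
have mW : m * W = b * sh a * ch a by rewrite /m divfK// gt_eqF.
have uui := expR_mulN a.
set u := expR a in uui; set ui := expR (- a) in uui.
have chE : ch beta = y - sh beta by rewrite /ch /sh -/y -/yi; field.
have chE' : ch beta = yi + sh beta by rewrite /ch /sh -/y -/yi; field.
(* Clears the denominators of the gauge equation: [t] is a product of two of the factors [m - 1] and
   [m + 1], and what is left is a polynomial identity. *)
have step (e t q c : R) : W ^+ 2 * t = c -> e * W = q * (ch beta + sh beta * c) ->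
    e = A * q * (1 + k * t).
  move=> <- h; apply: (mulIf (lt0r_neq0 W0)); rewrite h /A /k.
  by field; rewrite !gt_eqF.
pose x := b * sh a.
have WE : W = 1 + x * sh a by rewrite /W /x expr2 mulrA.
have sE : u - ui = 2 * sh a by rewrite /sh -/u -/ui; field.
have mp : W * (m - 1) = ui * (x - u).
  rewrite mulrBr [W * m]mulrC mW WE mulr1 mulrBr [ui * u]mulrC uui /x.
  by rewrite [in ch a]/ch -/u -/ui; move: sE; set s := sh a => sE; nra.
have mn : W * (m + 1) = u * (x + ui).
  rewrite mulrDr [W * m]mulrC mW WE mulr1 mulrDr uui /x.
  by rewrite [in ch a]/ch -/u -/ui; move: sE; set s := sh a => sE; nra.
have xy : x * sh beta = y * sh a by rewrite /x mulrAC byE.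
have W2 p q : W ^+ 2 * (p * q) = (W * p) * (W * q) by ring.
have uE : u = ui + 2 * sh a by lra.
have E1 : ui * ui = 1 - 2 * sh a * ui by move: uui; rewrite uE; lra.
have E2 : b * y = 2 * y + b * yi.
  move: byE; rewrite /sh -/y -/yi; lra.
have pm : expR (- beta) = A * (u * ui) * (1 + k * ((m - 1) * (m + 1))).
  rewrite uui mulr1; rewrite -/yi -[A]mulr1; apply: step; rewrite ?W2 ?mp ?mn//.
  rewrite mul1r WE.
  have -> : ui * (x - u) * (u * (x + ui)) = (x - u) * (x + ui).
    by ring: uui.
  have E3 : yi * x = y * x - 2 * y * sh a.
    transitivity (b * yi * sh a); first by rewrite /x; ring.
    by rewrite /x (_ : b * yi = b * y - 2 * y); [ring|lra].
  rewrite chE' uE; set S := sh beta in xy *; set t := sh a in E1 E3 xy *.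
  clearbody S t x y yi ui.
  have -> : (x - (ui + 2 * t)) * (x + ui) = x ^+ 2 - 2 * t * x - 1.
    by ring: E1.
  have -> : S * (x ^+ 2 - 2 * t * x - 1) = (x * S) * (x - 2 * t) - S by ring.
  by rewrite xy; ring: E3.
have pp : expR beta = A * (u * u) * (1 + k * ((m - 1) * (m - 1))).
  apply: step; rewrite ?W2 ?mp ?mn// -/y.
  transitivity (u * u * ch beta + sh beta * (x - u) ^+ 2); last first.
    transitivity (u * u * ch beta + (u * u * (ui * ui)) * sh beta * (x - u) ^+ 2).
      by rewrite [u * u * (ui * ui)]mulrACA uui !mul1r.
    by ring.
  have -> : sh beta * (x - u) ^+ 2 = x * sh beta * (x - 2 * u) + u * u * sh beta
    by ring.
  have E4 : u * u = 1 + 2 * sh a * u by rewrite uE; ring: E1.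
  by rewrite chE WE xy; ring: E4.
have nn : expR beta = A * (ui * ui) * (1 + k * ((m + 1) * (m + 1))).
  apply: step; rewrite ?W2 ?mp ?mn// -/y.
  transitivity (ui * ui * ch beta + sh beta * (x + ui) ^+ 2); last first.
    transitivity (ui * ui * ch beta + (u * u * (ui * ui)) * sh beta * (x + ui) ^+ 2).
      by rewrite [u * u * (ui * ui)]mulrACA uui !mul1r.
    by ring.
  have -> : sh beta * (x + ui) ^+ 2 = x * sh beta * (x + 2 * ui) + ui * ui * sh beta.
    by ring.
  by rewrite chE WE xy; ring: E1.
by move=> [] []; rewrite /= ?opprK ?mulr1 ?mulrN1 ?mulrN ?mulr1 ?opprK -/u -/ui //
  [ui * u]mulrC [_ * (m - 1)]mulrC.
Qed.
End BetheGap.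

(** * Concentration over uniform pairings *)

Section RandomTranspositions.
Context {R : realType} {H : finType} {X : Type}.
Variable a : {perm H} -> X -> X.
Hypothesis a1 : forall M, a 1%g M = M.
Hypothesis aM : forall t u M, a (t * u)%g M = a u (a t M).
Implicit Types (l : seq H) (f g : X -> R).

(* [shuffle l f M] is the average of [f] over the images of [M] under the
   permutations supported by [l], generated one transposition at a time. *)
Fixpoint shuffle l f : X -> R :=
  if l is x :: l' then
    fun M => (size l)%:R^-1 * \sum_(y <- l) shuffle l' f (a (tperm x y) M)
  else f.

Definition transp_lipschitz c f :=
  forall x y M, `|f (a (tperm x y) M) - f M| <= c.

(** Moving a transposition past another one conjugates it into a third transposition, so the
    constant does not deteriorate along the shuffle. *)
Lemma shuffle_lipschitz l c f : transp_lipschitz c f ->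
  transp_lipschitz c (shuffle l f).
Proof.
move=> fc; elim: l => //= z l IH x y M.
rewrite -mulrBr -sumrB normrM gtr0_norm ?invr_gt0 ?ltr0n//.
rewrite mulrC ler_pdivrMr ?ltr0n//.
apply: le_trans (ler_norm_sum _ _ _) _.
apply: (@le_trans _ _ (\sum_(w <- z :: l) c)); last first.
  by rewrite big_const_seq count_predT iter_addr addr0 mulr_natr.
by apply: ler_sum => w _; rewrite -!aM conjgC aM tpermJ; apply: IH.
Qed.

(** By induction on [l]. The sum over [y] is reindexed by the transposition of [u] and [v]; after
    conjugation, the transposition that remains acts inside the tail, where the induction hypothesis
    absorbs it. *)
Lemma shuffle_invariant l f : uniq l -> forall x y M, x \in l -> y \in l ->
  shuffle l f (a (tperm x y) M) = shuffle l f M.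
Proof.
elim: l => // x l IH /= /andP[xl ul].
set g := shuffle l f in IH *.
have inv u v M : u \in l -> v \in l -> g (a (tperm u v) M) = g M by exact: IH.
have main u v M : u \in x :: l -> v \in l ->
  \sum_(y <- x :: l) g (a (tperm x y) (a (tperm u v) M)) =
  \sum_(y <- x :: l) g (a (tperm x y) M).
  move=> ul' vl; have ux : uniq (x :: l) by rewrite /= xl.
  rewrite !big_uniq//= [RHS](reindex_inj (@perm_inj _ (tperm u v)))/=.
  have vx : v != x by apply: contraNneq xl => <-.
  have tl y : (tperm u v y \in x :: l) = (y \in x :: l).
    have vl' : v \in x :: l by rewrite inE vl orbT.
    by case: tpermP => // ->; rewrite ?ul' ?vl'.
  apply: eq_big => [y|y yl]; first by rewrite tl.
  rewrite -aM; move: ul'; rewrite inE => /orP[/eqP ux'|ul'].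
    rewrite ux'; have [yx|yx] := eqVneq y x.
      by rewrite yx tpermL tperm1 mulg1.
    have [yv|yv] := eqVneq y v.
      by rewrite yv tpermR tperm2 tperm1 a1.
    rewrite [tperm x v y]tpermD; [|by rewrite eq_sym|by rewrite eq_sym].
    rewrite conjgC aM tpermJ tpermL [tperm x y v]tpermD; [|by rewrite eq_sym|by []].
    by apply: inv; move: yl; rewrite inE (negbTE yx).
  have ux' : u != x by apply: contraNneq xl => <-.
  rewrite -[(tperm u v * _)%g](mulgKV (tperm u v)) aM inv//.
  congr (g (a _ M)).
  transitivity (tperm x y ^ tperm u v)%g; first by rewrite conjgE !tpermV mulgA.
  by rewrite tpermJ tpermD.
move=> u v M; rewrite !inE => /orP[/eqP ->|ul'] /orP[/eqP ->|vl].
- by rewrite tperm1 a1.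
- by congr (_ * _); apply: main => //; rewrite mem_head.
- by rewrite tpermC; congr (_ * _); apply: main => //; rewrite mem_head.
- by congr (_ * _); apply: main => //; rewrite inE ul' orbT.
Qed.

Lemma expR_le_quad (x : R) : `|x| <= 1 / 2 -> expR x <= 1 + x + 2 * x ^+ 2.
Proof.
rewrite ler_norml => /andP[x1 x2].
have h : (1 - x) * expR x <= 1.
  rewrite -[leRHS](expR_mulN x) mulrC ler_pM2l ?expR_gt0//.
  exact: expR_ge1Dx.
have x0 : 0 < 1 - x by lra.
rewrite -(ler_pM2l x0); apply: le_trans h _.
rewrite -subr_ge0.
have -> : (1 - x) * (1 + x + 2 * x ^+ 2) - 1 = x ^+ 2 * (1 - 2 * x) by ring.
by rewrite mulr_ge0 ?sqr_ge0//; lra.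
Qed.

(** Centred at the mean [mu], the linear term of [expR_le_quad] averages out. *)
Lemma mean_expR_le (I : Type) (r : seq I) (F : I -> R) (e : R) :
  (0 < size r)%N -> e <= 1 / 2 ->
  let mu := (size r)%:R^-1 * \sum_(i <- r) F i in
  (forall i, `|F i - mu| <= e) ->
  (size r)%:R^-1 * \sum_(i <- r) expR (F i) <= expR (mu + 2 * e ^+ 2).
Proof.
move=> r0 e2 mu Fmu; rewrite expRD.
have n0 : (0 : R) < (size r)%:R by rewrite ltr0n.
have e0 (i : I) : 0 <= e by apply: le_trans (Fmu i).
apply: (@le_trans _ _ (expR mu * (1 + 2 * e ^+ 2))); last first.
  by rewrite ler_pM2l ?expR_gt0// expR_ge1Dx.
rewrite mulrC ler_pdivrMr//.
apply: (@le_trans _ _ (\sum_(i <- r) expR mu * (1 + (F i - mu) + 2 * e ^+ 2))).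
  apply: ler_sum => i _; rewrite -{1}(subrK mu (F i)) addrC expRD.
  rewrite ler_pM2l ?expR_gt0//.
  apply: le_trans (expR_le_quad _) _; first exact: le_trans (Fmu i) e2.
  rewrite lerD2l ler_pM2l//.
  by rewrite -[leLHS]real_normK ?num_real// lerXn2r ?nnegrE ?(e0 i).
rewrite -mulr_sumr -mulrA ler_pM2l ?expR_gt0// !big_split/=.
rewrite sumrN !big_const_seq !count_predT !iter_addr !addr0.
have -> : \sum_(i <- r) F i = mu * (size r)%:R.
  by rewrite /mu mulrAC mulVf ?mul1r// gt_eqF.
rewrite -[mu *+ _]mulr_natr -[2 * _ *+ _]mulr_natr subrr addr0.
by rewrite [leRHS](_ : _ = (size r)%:R + 2 * e ^+ 2 * (size r)%:R)//; ring.
Qed.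

(** An Azuma bound, one transposition at a time: each image moves the value by at most [k c], hence
    lies within [2 k c] of the average over [y], and [mean_expR_le] costs [2 (2 k c)^2]. The
    condition [k c <= 1 / 4] keeps [2 k c] within the range of [expR_le_quad]. *)
Lemma shuffle_mgf l f c k : transp_lipschitz c f -> 0 <= k -> k * c <= 1 / 4 ->
  forall M, shuffle l (fun M => expR (k * f M)) M <=
    expR (k * shuffle l f M + (size l)%:R * (8 * (k * c) ^+ 2)).
Proof.
move=> fc k0 kc; elim: l => [|x l IH] M; first by rewrite /= mul0r addr0.
set S := size (x :: l); have S0 : (0 < S)%N by [].
have S0R : (0 : R) < S%:R by rewrite ltr0n.
rewrite [leLHS]/=.
apply: (@le_trans _ _ (S%:R^-1 * \sum_(y <- x :: l)
    expR (k * shuffle l f (a (tperm x y) M)) *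
      expR ((size l)%:R * (8 * (k * c) ^+ 2)))).
  rewrite ler_pM2l ?invr_gt0//; apply: ler_sum => y _.
  by rewrite -expRD; apply: IH.
rewrite -mulr_suml.
have gc := @shuffle_lipschitz l c f fc.
set g := shuffle l f in gc *.
pose mu := S%:R^-1 * \sum_(y <- x :: l) k * g (a (tperm x y) M).
have mug : mu = k * shuffle (x :: l) f M.
  by rewrite /mu -mulr_sumr mulrCA.
have dev0 y : `|k * g (a (tperm x y) M) - k * g M| <= k * c.
  by rewrite -mulrBr normrM ger0_norm// ler_wpM2l.
have dev1 : `|mu - k * g M| <= k * c.
  have -> : mu - k * g M = S%:R^-1 *
      \sum_(y <- x :: l) (k * g (a (tperm x y) M) - k * g M).
    rewrite big_split/= sumrN big_const_seq count_predT iter_addr addr0.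
    by rewrite mulrBr -[_ *+ size _]mulr_natr mulrCA mulVf ?mulr1// gt_eqF.
  rewrite normrM gtr0_norm ?invr_gt0// mulrC ler_pdivrMr//.
  apply: le_trans (ler_norm_sum _ _ _) _.
  apply: (@le_trans _ _ (\sum_(y <- x :: l) k * c)).
    by apply: ler_sum => y _; apply: dev0.
  by rewrite big_const_seq count_predT iter_addr addr0 mulr_natr.
have dev y : `|k * g (a (tperm x y) M) - mu| <= 2 * (k * c).
  by move: (dev0 y) dev1; rewrite !ler_norml => /andP[? ?] /andP[? ?];
    apply/andP; split; lra.
have ke : 2 * (k * c) <= 1 / 2 by lra.
have h := mean_expR_le S0 ke dev; rewrite -/S -/mu mug in h.
apply: (@le_trans _ _ (expR (k * shuffle (x :: l) f M + 2 * (2 * (k * c)) ^+ 2) *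
    expR ((size l)%:R * (8 * (k * c) ^+ 2)))).
by rewrite [S%:R^-1 * _]mulrA; apply: ler_wpM2r; rewrite ?expR_ge0.
rewrite -expRD ler_expR (_ : S%:R = (size l)%:R + 1); last by rewrite natr1.
rewrite [leRHS](_ : _ = k * shuffle (x :: l) f M + 2 * (2 * (k * c)) ^+ 2 +
  (size l)%:R * (8 * (k * c) ^+ 2))//.
set z := shuffle _ _ _; ring.
Qed.

End RandomTranspositions.

(** * Permutations of the half-edges acting on pairings *)

Section PairingAction.
Context {R : realType} {H : finType}.
Implicit Types (M : {set {set H}}) (t u : {perm H}) (s : H -> bool).

Definition pact t M : {set {set H}} :=
  [set [set t h | h in e]%SET | e : {set H} in M]%SET.

Lemma pact1 M : pact 1 M = M.
Proof.
rewrite /pact -[RHS](imset_id M); apply: eq_imset => /= e.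
by rewrite (eq_imset (g := id) _ (@perm1 H)) imset_id.
Qed.

Lemma pactM t u M : pact (t * u)%g M = pact u (pact t M).
Proof.
rewrite /pact -imset_comp; apply: eq_imset => e /=.
by rewrite -imset_comp; apply: eq_imset => h /=; rewrite permM.
Qed.

Lemma pact_inj t : injective (pact t).
Proof. by apply: imset_inj; apply: imset_inj; apply: perm_inj. Qed.

Lemma is_pairing_pact t M : is_pairing (pact t M) = is_pairing M.
Proof.
have aux u N : is_pairing N -> is_pairing (pact u N).
  move=> /andP[pN cN]; apply/andP; split.
    rewrite (_ : [set: H]%SET = [set u h | h in [set: H]]%SET).
      by rewrite (imset_partition _ _ (@perm_inj _ u)).
    apply/finset.setP => h; rewrite inE; apply/esym/imsetP.
    by exists (u^-1%g h); rewrite ?inE ?permKV.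
  apply/forall_inP => _ /imsetP[e eN ->]; rewrite card_imset; last exact: perm_inj.
  exact: (forall_inP cN).
apply/idP/idP; last exact: aux.
by move=> /(aux t^-1%g); rewrite -pactM mulgV pact1.
Qed.

Lemma energy_pact t M s :
  energy s (pact t M) = energy (fun h => s (t h)) M :> R.
Proof.
rewrite /energy /pact big_imset/=; last first.
  by move=> e e' _ _; apply: imset_inj; apply: perm_inj.
apply: eq_bigr => e _; rewrite /edge_spin big_imset//=.
by move=> h h' _ _; apply: perm_inj.
Qed.

Lemma card_tperm_neq s (x y : H) :
  (#|[set h | s (tperm x y h) != s h]%SET| <= 2)%N.
Proof.
apply: leq_trans (_ : #|[set x; y]%SET| <= 2)%N; last by rewrite cards2; case: eqVneq.
apply/subset_leq_card/fintype.subsetP => h; rewrite !inE.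
by case: tpermP => [->|->|_ _]; rewrite ?eqxx ?orbT.
Qed.

Lemma norm_energy_pact M s x y : is_pairing M ->
  `|energy s (pact (tperm x y) M) - energy s M| <= 4 :> R.
Proof.
move=> pM; rewrite energy_pact; apply: le_trans (norm_energyB _ _ pM) _.
rewrite (_ : 4 = 2 * 2%:R :> R); last by rewrite -natrM.
by rewrite ler_pM2l// ler_nat card_tperm_neq.
Qed.

Lemma pairing_subset M M' : is_pairing M -> is_pairing M' -> M \subset M' -> M = M'.
Proof.
move=> pM pM' sub; apply/eqP; rewrite eqEcard sub /=.
by rewrite -(leq_pmul2r (isT : 0 < 2)%N) -!card_pairing.
Qed.

Lemma pairing_edge M e h : is_pairing M -> e \in M -> h \in e ->
  exists2 h', h' != h & e = [set h; h']%SET.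
Proof.
move=> pM /(card_pairing_edge pM)/eqP/cards2P[x [y [xy ->]]].
rewrite !inE => /orP[/eqP ->|/eqP ->]; first by exists y; rewrite 1?eq_sym.
by exists x => //; rewrite finset.setUC.
Qed.

Lemma imset_set2 t x y : [set t h | h in [set x; y]]%SET = [set t x; t y]%SET.
Proof. by rewrite imsetU1 imset_set1. Qed.

(** If [{x, z}] is an edge of [M] only and [{x, y}] is the edge of [M'] at [x], then exchanging [z]
    and [y] creates the latter and keeps all common edges, none of which contains [z] or [y]. So the
    number of common edges grows. *)
Lemma pairing_transitive (A : Type) (g : {set {set H}} -> A) :
  (forall x y M, is_pairing M -> g (pact (tperm x y) M) = g M) ->
  forall M M', is_pairing M -> is_pairing M' -> g M = g M'.
Proof.
move=> ginv M M' pM pM'.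
have [k] := ubnP #|M :\: M'|%SET; elim: k => // k IH in M pM *.
rewrite ltnS => Mk.
have [sub|/fintype.subsetPn[e eM eM']] := boolP (M \subset M').
  by rewrite (pairing_subset pM pM' sub).
have /set0Pn[x xe] : e != finset.set0.
  by rewrite -card_gt0 (card_pairing_edge pM eM).
have [z zx eE] := pairing_edge pM eM xe.
have [e'M' xe'] := pblock_pairing x pM'.
set e' := finset.pblock M' x in e'M' xe'.
have [y yx e'E] := pairing_edge pM' e'M' xe'.
have zy : z != y by apply: contraNneq eM' => zy; rewrite eE zy -e'E.
pose t := tperm z y.
have uniqM (N : {set {set H}}) f f' h : is_pairing N -> f \in N -> f' \in N -> h
  \in f -> h \in f' -> f = f'.
  by move=> pN fN f'N hf hf'; rewrite -(pblock_pairingE pN fN hf)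
    (pblock_pairingE pN f'N hf').
rewrite -(ginv z y M pM); apply: IH; first by rewrite is_pairing_pact.
apply: leq_trans Mk.
have c1 : #|pact t M| = #|M|.
  by rewrite card_imset//; apply: imset_inj; apply: perm_inj.
have h1 := cardsID M' (pact t M); have h2 := cardsID M' M.
rewrite c1 -h2 in h1.
suff h3 : (#|M :&: M'| < #|pact t M :&: M'|)%N.
  by rewrite -(ltn_add2l #|M :&: M'|) -h1 ltn_add2r.
have sub : e' |: (M :&: M') \subset (pact t M :&: M').
  apply/fintype.subsetP => f; rewrite !inE => /orP[/eqP ->|/andP[fM fM']].
    rewrite e'M' andbT; apply/imsetP; exists e => //.
    by rewrite eE e'E imset_set2 tpermL tpermD.
  rewrite fM' andbT; apply/imsetP; exists f => //.
  have zf : z \notin f.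
    apply: contra eM' => zf; rewrite (uniqM _ _ _ z pM eM fM)//.
    by rewrite eE !inE eqxx orbT.
  have yf : y \notin f.
    apply: contra eM' => yf.
    have fe' : f = e' by apply: (uniqM _ _ _ y pM') => //; rewrite e'E !inE eqxx orbT.
    by rewrite (uniqM _ _ _ x pM eM fM)// fe'.
  rewrite -[LHS](imset_id f); apply: eq_in_imset => h hf.
  by rewrite tpermD//; [apply: contraNneq zf => ->|apply: contraNneq yf => ->].
apply: leq_trans (subset_leq_card sub).
rewrite cardsU1 inE negb_and.
suff -> : e' \notin M by rewrite add1n.
apply: contra eM' => e'M; rewrite (uniqM _ _ _ x pM eM e'M)//.
Qed.

End PairingAction.

Section Concentration.
Context {R : realType} {H : finType}.
Implicit Types (M : {set {set H}}) (f : {set {set H}} -> R).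

Definition pairing_set : {set {set {set H}}} := [set M | is_pairing M]%SET.

Definition pairing_avg f : R := (\sum_(M in pairing_set) f M) / #|pairing_set|%:R.

(** The transposition lemmas ask for a Lipschitz bound on all sets of sets of half-edges, whereas
    switching estimates hold for pairings; extending by 0 is harmless since permutations preserve
    pairings. *)
Definition pairing_ext f M : R := (is_pairing M)%:R * f M.

Lemma pairing_avg_ext f : pairing_avg (pairing_ext f) = pairing_avg f.
Proof.
congr (_ / _); apply: eq_bigr => M; rewrite inE /pairing_ext => ->.
by rewrite mul1r.
Qed.

Lemma sum_shuffle l f :
  \sum_(M in pairing_set) shuffle pact l f M = \sum_(M in pairing_set) f M.
Proof.
elim: l => //= x l IH; rewrite -mulr_sumr exchange_big/=.
rewrite (eq_bigr (fun=> \sum_(M in pairing_set) f M)) => [|y _]; last first.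
  rewrite -IH [RHS](reindex_inj (@pact_inj _ (tperm x y)))/=.
  by apply: eq_bigl => M; rewrite !inE is_pairing_pact.
rewrite big_const_seq count_predT iter_addr addr0 -(mulr_natr (\sum_(M in
  pairing_set) f M)) mulrCA.
by rewrite mulVf ?mulr1// pnatr_eq0.
Qed.

(** Shuffling over all half-edges is invariant under every transposition, hence constant on pairings
    by transitivity. As shuffling preserves the sum over pairings, this constant is the average. *)
Lemma shuffle_enum f M : is_pairing M ->
  shuffle pact (enum H) f M = pairing_avg f.
Proof.
move=> pM; rewrite /pairing_avg -(sum_shuffle (enum H)).
have P0 : #|pairing_set|%:R != 0 :> R.
  by rewrite pnatr_eq0 -lt0n card_gt0; apply/set0Pn; exists M; rewrite inE.
rewrite (eq_bigr (fun=> shuffle pact (enum H) f M)) => [|M']; last first.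
  rewrite inE => pM'; apply: pairing_transitive => // x y N _.
  by apply: shuffle_invariant; rewrite ?enum_uniq ?mem_enum//;
    [exact: pact1|exact: pactM].
by rewrite sumr_const -(mulr_natr (shuffle _ _ _ _)) mulfK.
Qed.

Lemma pairing_mgf f c k :
  (forall x y M, is_pairing M -> `|f (pact (tperm x y) M) - f M| <= c) ->
  0 <= k -> k * c <= 1 / 4 ->
  pairing_avg (fun M => expR (k * (f M - pairing_avg f))) <=
    expR (#|H|%:R * (8 * (k * c) ^+ 2)).
Proof.
move=> fc k0 kc.
have [P0|[M]] := set_0Vmem pairing_set.
  by rewrite /pairing_avg P0 cards0 invr0 mulr0 expR_ge0.
rewrite inE => pM.
have lip : transp_lipschitz pact c (pairing_ext f).
  move=> x y N; rewrite /pairing_ext is_pairing_pact.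
  have [pN|_] := boolP (is_pairing N); first by rewrite !mul1r fc.
  by rewrite !mul0r subrr normr0; apply: le_trans (fc x y M pM).
have := shuffle_mgf (@pactM H) (enum H) lip k0 kc M.
rewrite !shuffle_enum// pairing_avg_ext -cardE => h.
rewrite (_ : pairing_avg _ = pairing_avg (fun M => expR (k * pairing_ext f M)) *
    expR (- (k * pairing_avg f))); last first.
  set mu := pairing_avg f; rewrite /pairing_avg [RHS]mulrAC; congr (_ / _).
  rewrite mulr_suml; apply: eq_bigr => N; rewrite inE /pairing_ext => ->.
  by rewrite mul1r mulrBr expRD.
apply: le_trans (ler_wpM2r (expR_ge0 _) h) _.
by rewrite -expRD ler_expR addrAC subrr add0r.
Qed.

Lemma pairing_tail f c k e :
  (forall x y M, is_pairing M -> `|f (pact (tperm x y) M) - f M| <= c) ->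
  0 <= k -> k * c <= 1 / 4 ->
  #|[set M in pairing_set | e <= f M - pairing_avg f]%SET|%:R <=
    expR (#|H|%:R * (8 * (k * c) ^+ 2) - k * e) * #|pairing_set|%:R.
Proof.
move=> fc k0 kc.
have [P0|] := posnP #|pairing_set|.
  rewrite P0 mulr0 (_ : #|_| = 0%N)//; apply/eqP; rewrite -leqn0 -P0.
  by apply/subset_leq_card/fintype.subsetP => M; rewrite inE => /andP[].
move=> P0; have P0R : 0 < #|pairing_set|%:R :> R by rewrite ltr0n.
rewrite expRD expRN mulrAC ler_pdivlMr ?expR_gt0//.
have := pairing_mgf fc k0 kc; rewrite /pairing_avg ler_pdivrMr//.
apply: le_trans; rewrite -sum1_card natr_sum mulr_suml.
rewrite big_mkcond [leRHS]big_mkcond/=; apply: ler_sum => M _.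
rewrite inE; case: (M \in pairing_set) => //=.
case: ifP => [eM|_]; last exact: expR_ge0.
by rewrite mul1r ler_expR ler_wpM2l.
Qed.

Lemma pairing_concentration f c k e :
  (forall x y M, is_pairing M -> `|f (pact (tperm x y) M) - f M| <= c) ->
  0 <= k -> k * c <= 1 / 4 ->
  #|[set M in pairing_set | e <= `|f M - pairing_avg f|]%SET|%:R <=
    2 * expR (#|H|%:R * (8 * (k * c) ^+ 2) - k * e) * #|pairing_set|%:R.
Proof.
move=> fc k0 kc.
have h1 := pairing_tail e fc k0 kc.
have fNc x y M : is_pairing M -> `|- f (pact (tperm x y) M) - - f M| <= c.
  by move=> pM; rewrite -opprD normrN fc.
have := pairing_tail e fNc k0 kc.
have -> : pairing_avg (fun M => - f M) = - pairing_avg f.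
  by rewrite /pairing_avg sumrN mulNr.
move=> h2; rewrite -[leRHS]mulrA mulr_natl mulr2n.
apply: le_trans (lerD h1 h2); rewrite -natrD ler_nat.
apply: leq_trans (leq_card_setU _ _).
apply/subset_leq_card/fintype.subsetP => M; rewrite !inE => /andP[-> /=].
by rewrite ler_normr opprB opprK [- f M + _]addrC.
Qed.

End Concentration.

(** * First moment *)

Lemma central_bin_ge r : (4 ^ r <= (2 * r).+1 * 'C(2 * r, r))%N.
Proof.
elim: r => // r IH.
have e1 : 'C(2 * r.+1, r.+1) = (2 * 'C((2 * r).+1, r))%N.
  apply/eqP; rewrite -(eqn_pmul2l (ltn0Sn r)) (_ : 2 * r.+1 = (2 * r).+2)%N; last
    by lia.
  by rewrite -mul_bin_diag /= mulnA; apply/eqP; congr (_ * _)%N; lia.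
have e2 : ((2 * r).+1 * 'C(2 * r, r) = r.+1 * 'C((2 * r).+1, r))%N.
  by have := mul_bin_down (2 * r).+1 r; rewrite /= => ->; congr (_ * _)%N; lia.
rewrite expnS e1; move: IH; rewrite e2; nia.
Qed.

Section Annealed.
Context {R : realType} {H : finType}.
Implicit Types (M : {set {set H}}) (s : {ffun H -> bool}).

(** Same scheme as [pairing_transitive]: exchanging a plus of [s] outside [s'] with a plus of [s']
    outside [s] brings [s] closer to [s']. *)
Lemma ffun_transitive (A : Type) (g : {ffun H -> bool} -> A) :
  (forall x y s, g [ffun h => s (tperm x y h)] = g s) ->
  forall s s', #|[set h | s h]%SET| = #|[set h | s' h]%SET| -> g s = g s'.
Proof.
move=> ginv s s'.
have [k] := ubnP #|[set h | s h]%SET :\: [set h | s' h]%SET|.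
elim: k => // k IH in s *; rewrite ltnS => sk cs.
have cs' : #|[set h | s' h]%SET :\: [set h | s h]%SET| =
    #|[set h | s h]%SET :\: [set h | s' h]%SET|.
  apply/eqP; rewrite -(eqn_add2l #|[set h | s' h]%SET :&: [set h | s h]%SET|).
  by rewrite cardsID finset.setIC cardsID cs.
have [D0|] := set_0Vmem ([set h | s h]%SET :\: [set h | s' h]%SET).
  congr g; apply/ffunP => h.
  have /finset.setP/(_ h) := D0; rewrite !inE.
  have /finset.setP/(_ h) : [set h | s' h]%SET :\: [set h | s h]%SET = finset.set0.
    by apply/eqP; rewrite -cards_eq0 cs' D0 cards0.
  by rewrite !inE; case: (s h) (s' h) => [] [].
move=> [x xD]; have /card_gt0P[y yD] : (0 < #|[set h | s' h]%SET :\: [set h | s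
  h]%SET|)%N.
  by rewrite cs' card_gt0; apply/set0Pn; exists x.
move: (xD) (yD); rewrite !inE => /andP[nx sx] /andP[ny sy].
have xy : x != y by apply: contraNneq nx => ->.
rewrite -(ginv x y s); set s1 := finfun _.
have s1E h : s1 h = s (tperm x y h) by rewrite ffunE.
apply: IH.
  apply: leq_trans sk; apply: proper_card; apply/properP; split.
    apply/fintype.subsetP => h; rewrite !inE s1E => /andP[nh].
    case: tpermP => [hx|hy|_ _]; rewrite ?nh ?(negbTE ny)//.
    by move: nh; rewrite hy sy.
  by exists x; rewrite // !inE s1E tpermL (negbTE ny) andbF.
rewrite -cs; have -> : [set h | s1 h]%SET = [set tperm x y h | h in [set h | s
  h]]%SET.
  apply/finset.setP => h; rewrite inE s1E; apply/idP/imsetP.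
    by move=> sh; exists (tperm x y h); rewrite ?inE// tpermK.
  by move=> [h' + ->]; rewrite inE tpermK.
by rewrite card_imset//; apply: perm_inj.
Qed.

Definition annealed (beta : R) (s : H -> bool) : R :=
  \sum_(M in pairing_set) expR (beta * energy s M).

Lemma annealed_transitive beta s s' :
  #|[set h | s h]%SET| = #|[set h | s' h]%SET| ->
  annealed beta s = annealed beta s' :> R.
Proof.
apply: (ffun_transitive (g := fun s : {ffun H -> bool} => annealed beta s)) => x
  y {}s.
rewrite /annealed [RHS](reindex_inj (@pact_inj _ (tperm x y)))/=.
apply: eq_big => [M|M _]; first by rewrite !inE is_pairing_pact.
rewrite energy_pact; congr (expR (_ * _)).
by apply: eq_bigr => e _; apply: eq_bigr => h _; rewrite ffunE.
Qed.

(** Loop expansion with every half-edge as its own vertex and [m = 0]: a half-edge covered by a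
    nonempty [J] has degree 1, and its moment, a sum of -1 and 1, kills the term. *)
Lemma sum_expR_energy (beta : R) M : is_pairing M ->
  \sum_(s : {ffun H -> bool}) expR (beta * energy s M) =
  2 ^+ #|H| * ch beta ^+ #|M|.
Proof.
move=> pM; pose k := sh beta / ch beta.
have edgeE s e : e \in M -> expR (beta * edge_spin s e) =
    ch beta * (1 + k * \prod_(h in e) (0 - sg (s (id h)))).
  move=> /(card_pairing_edge pM)/eqP/cards2P[x [y [xy ->]]].
  rewrite /edge_spin !big_setU1 ?inE//= !big_set1 !sub0r mulrNN.
  have -> z : ch beta * (1 + k * z) = ch beta + sh beta * z.
    by rewrite /k; field; rewrite gt_eqF ?ch_gt0.
  by case: (s x); case: (s y); rewrite /= ?mulrNN ?mulr1 ?mulrN1 /ch /sh; field.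
transitivity (ch beta ^+ #|M| *
    \sum_(s : {ffun H -> bool}) (\prod_(i : H) (fun=> 1) (s i)) *
      \prod_(e in M) (1 + k * \prod_(h in e) (0 - sg (s (id h))))).
  rewrite mulr_sumr; apply: eq_bigr => s _.
  rewrite big1 // mul1r /energy mulr_sumr expR_sum (eq_bigr _ (edgeE s)) big_split/=.
  by rewrite prodr_const.
rewrite (loop_expansion id pM (fun=> 1)) mulrC; congr (_ * _).
rewrite (bigD1 finset.set0) ?finset.sub0set//= [X in _ + X]big1 ?addr0.
  rewrite cards0 expr0 mul1r -prodr_const; apply: eq_bigr => i _.
  rewrite (_ : loop_degree _ _ _ = 0%N); last first.
    apply/eqP; rewrite cards_eq0; apply/eqP/finset.setP => h.
    by rewrite !inE /finset.cover big_set0 inE.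
  by rewrite big_bool/= !expr0 !mul1r.
move=> J /andP[JM /set0Pn[e eJ]].
have eM : e \in M by apply: (fintype.subsetP JM).
have /set0Pn[h he] : e != finset.set0 by rewrite -card_gt0 (card_pairing_edge pM eM).
rewrite (bigD1 h)//= (_ : loop_degree _ _ _ = 1%N).
  by rewrite big_bool/= !expr1 !mul1r !sub0r opprK addNr mul0r mulr0.
rewrite /loop_degree -(cards1 h); apply: eq_card => x; rewrite !inE.
case: eqVneq => [->|]; rewrite ?andbF ?andbT//.
by apply/bigcupP; exists e.
Qed.

Lemma card_ffun_true k :
  #|[set s : {ffun H -> bool} | #|[set h | s h]%SET| == k]%SET| = 'C(#|H|, k).
Proof.
rewrite -card_draws -(card_imset _ (f := fun s : {ffun H -> bool} => [set h | s
  h]%SET)).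
  apply: eq_card => A; rewrite inE; apply/imsetP/idP => [[s + ->]|Ak].
    by rewrite inE.
  exists [ffun h => h \in A]; last by apply/finset.setP => h; rewrite inE ffunE.
  by rewrite inE (eq_card (B := A))// => h; rewrite inE ffunE.
by move=> s s' /finset.setP ss; apply/ffunP => h; have := ss h; rewrite !inE.
Qed.

(** By symmetry all balanced assignments of half-edge spins have the same annealed weight, and their
    total is at most the sum over all [2 ^ #|H|] assignments, which is known exactly. Dividing by
    the central binomial coefficient loses only the factor [#|H| + 1]. *)
Lemma annealed_balanced_le (beta : R) s : #|H| = (2 * #|[set h | s h]%SET|)%N ->
  annealed beta s <=
    #|@pairing_set H|%:R * (#|H|.+1%:R * ch beta ^+ (#|H| %/ 2)).
Proof.
set r := #|[set h | s h]%SET| => Hr.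
have b1 : 'C(#|H|, r)%:R * annealed beta s <=
    #|@pairing_set H|%:R * (2 ^+ #|H| * ch beta ^+ (#|H| %/ 2)).
  apply: (@le_trans _ _ (\sum_(s' : {ffun H -> bool}) annealed beta s')).
    rewrite -card_ffun_true mulr_natl -sumr_const.
    rewrite (eq_bigr (fun s' : {ffun H -> bool} => annealed beta s')) => [|s'];
      last first.
      by rewrite inE => /eqP ss; apply: annealed_transitive; rewrite ss.
    rewrite big_mkcond; apply: ler_sum => s' _; case: ifP => // _.
    by apply: sumr_ge0 => M _; apply: expR_ge0.
  rewrite /annealed exchange_big/= mulr_natl -sumr_const.
  apply: ler_sum => M; rewrite inE => pM.
  by rewrite sum_expR_energy// (card_pairing pM) mulnK.
have b2 : (2 : R) ^+ #|H| <= #|H|.+1%:R * 'C(#|H|, r)%:R.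
  rewrite Hr -natrX -natrM ler_nat expnM.
  exact: central_bin_ge.
have c0 : (0 : R) < 'C(#|H|, r)%:R by rewrite ltr0n bin_gt0 Hr; lia.
rewrite -(ler_pM2l c0); apply: le_trans b1 _.
rewrite [leRHS]mulrCA ler_wpM2l// [leRHS]mulrA.
by rewrite ler_wpM2r ?exprn_ge0 ?(ltW (ch_gt0 _))// mulrC.
Qed.

End Annealed.

(** * Fixed-spin partition functions *)

Lemma set2_ord_eq m (u v i j : 'I_m) : (u <= v)%N -> (i <= j)%N ->
  ([set u; v] == [set i; j])%SET = (i == u) && (j == v).
Proof.
move=> uv ij; apply/eqP/andP => [E|[/eqP -> /eqP ->]]//.
have ui : u \in [set i; j]%SET by rewrite -E !inE eqxx.
have vi : v \in [set i; j]%SET by rewrite -E !inE eqxx orbT.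
have iu : i \in [set u; v]%SET by rewrite E !inE eqxx.
have ju : j \in [set u; v]%SET by rewrite E !inE eqxx orbT.
move: ui vi iu ju; rewrite !inE.
by do 4![case/orP => /eqP/(congr1 val)/= ?]; split; apply/eqP/val_inj => /=; lia.
Qed.

Section Hamiltonian.
Context {R : realType} {n d : nat}.
Implicit Types (M : multigraph n d) (s : configuration n).

Definition hspin s (h : half_edge n d) : bool := s h.1.

Lemma pairingsE M : (M \in pairings n d) = is_pairing M.
Proof. by rewrite inE. Qed.

(** An edge is seen by exactly one pair [i <= j]. For a loop the pair is [(i, i)], and both sides
    give it the value 1, the square of a spin. *)
Lemma edge_sum_pairs M s : is_pairing M ->
  \sum_(i < n) \sum_(j < n | (i <= j)%N)
     (edge_mult M i j)%:R * spin R s i * spin R s j = energy (hspin s) M.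
Proof.
move=> pM; rewrite /energy.
pose T (e : {set half_edge n d}) (i j : 'I_n) : R :=
  ([set h.1 | h in e] == [set i; j])%SET%:R * spin R s i * spin R s j.
transitivity (\sum_(i < n) \sum_(j < n | (i <= j)%N) \sum_(e in M) T e i j).
  apply: eq_bigr => i _; apply: eq_bigr => j _.
  rewrite /edge_mult -sum1_card natr_sum !mulr_suml big_mkcond [RHS]big_mkcond/=.
  apply: eq_bigr => e _; rewrite inE /T.
  by case: (e \in M) => //=; case: eqP => //= _; rewrite !mul0r.
under eq_bigr do rewrite exchange_big/=.
rewrite exchange_big/=; apply: eq_bigr => e eM.
move: (card_pairing_edge pM eM) => /eqP/cards2P[x [y [xy eE]]].
have imE : [set h.1 | h in e]%SET = [set x.1; y.1]%SET by rewrite eE imsetU1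
  imset_set1.
wlog xley : x y xy eE imE / (x.1 <= y.1)%N.
  move=> wl; have /orP[h|h] := leq_total x.1 y.1; first exact: (wl x y).
  by apply: (wl y x); rewrite 1?eq_sym// 1?finset.setUC.
rewrite (bigD1 x.1)//= (bigD1 y.1)//= /T imE eqxx mul1r.
rewrite !big1 ?addr0 => [|i ix|j /andP[ij jy]].
- by rewrite /edge_spin eE big_setU1 ?inE//= big_set1.
- rewrite big1// => j ij; rewrite set2_ord_eq// (negbTE ix) !mul0r//.
- by rewrite set2_ord_eq// (negbTE jy) andbF !mul0r.
Qed.

Lemma sum_spin s : \sum_(i < n) spin R s i = 2 * (nplus s)%:R - n%:R.
Proof.
rewrite (eq_bigr (fun i => 2 * (s i)%:R - 1)); last first.
  by move=> i _; rewrite /spin; case: (s i) => /=; ring.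
rewrite big_split/= sumrN sumr_const card_ord -mulr_sumr; congr (_ * _ - _).
by rewrite -natr_sum /nplus -sum1_card big_mkcond/=; congr _%:R;
  rewrite [RHS]big_mkcond; apply: eq_bigr => i _; rewrite inE; case: (s i).
Qed.

Lemma hamiltonianE (beta B : R) M s : is_pairing M ->
  - hamiltonian beta B M s =
  beta * energy (hspin s) M + B * (2 * (nplus s)%:R - n%:R).
Proof.
by move=> pM; rewrite /hamiltonian edge_sum_pairs// sum_spin; ring.
Qed.

Definition zfix (beta : R) M (a : nat) : R :=
  \sum_(s : configuration n | nplus s == a) expR (beta * energy (hspin s) M).

Lemma partition_funE (beta B t : R) M a : is_pairing M ->
  Num.ceil (n%:R * t) = a%:Z ->
  partition_fun beta B M t = expR (B * (2 * a%:R - n%:R)) * zfix beta M a.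
Proof.
move=> pM at_; rewrite /partition_fun /zfix mulr_sumr at_.
apply: eq_big => [s|s /eqP]; first by [].
by move=> [<-]; rewrite hamiltonianE// expRD mulrC.
Qed.

Lemma nplus_le s : (nplus s <= n)%N.
Proof. by rewrite -[leqRHS]card_ord /nplus max_card. Qed.

Lemma zfix_gt0 beta M a : (a <= n)%N -> 0 < zfix beta M a.
Proof.
move=> an.
pose s : configuration n := [ffun i : 'I_n => (i < a)%N].
have sa : nplus s == a.
  rewrite /nplus -sum1_card (eq_bigl (fun i : 'I_n => (i < a)%N)); last first.
    by move=> i; rewrite inE ffunE.
  by rewrite (big_ord_narrow an)/= sum1_card card_ord.
rewrite /zfix (bigD1 s)//= ltr_pwDl ?expR_gt0//.
by apply: sumr_ge0 => ? _; apply: expR_ge0.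
Qed.

Lemma free_energyE (beta B t : R) M a : is_pairing M -> (a <= n)%N ->
  Num.ceil (n%:R * t) = a%:Z ->
  free_energy beta B M t = n%:R^-1 * (ln (zfix beta M a) + B * (2 * a%:R - n%:R)).
Proof.
move=> pM an at_; rewrite /free_energy (partition_funE _ _ pM at_).
by rewrite lnM ?posrE ?expR_gt0 ?zfix_gt0// expRK addrC.
Qed.

End Hamiltonian.

(** * Double counting of spin flips and spin swaps *)

Section Flips.
Context {R : realType} {n d : nat}.
Implicit Types (M : multigraph n d) (s : configuration n) (i j k : 'I_n).

Definition flip i s : configuration n := [ffun j => if j == i then ~~ s j else s j].

Definition swap j k s : configuration n := [ffun i => s (tperm j k i)].

Lemma flipK i : involutive (flip i).
Proof.
by move=> s; apply/ffunP => j; rewrite !ffunE; case: eqP; rewrite ?negbK.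
Qed.

Lemma swapK j k : involutive (swap j k).
Proof. by move=> s; apply/ffunP => i; rewrite !ffunE tpermK. Qed.

Lemma flip_id i s : flip i s i = ~~ s i.
Proof. by rewrite ffunE eqxx. Qed.

Lemma flip_neq i j s : j != i -> flip i s j = s j.
Proof. by rewrite ffunE => /negbTE ->. Qed.

Lemma nplus_flip i s : ~~ s i -> nplus (flip i s) = (nplus s).+1.
Proof.
move=> si; rewrite /nplus (_ : [set j | flip i s j]%SET = i |: [set j | s j]%SET).
  by rewrite cardsU1 inE si.
apply/finset.setP => j; rewrite !inE ffunE.
by case: eqP => [->|]; rewrite ?si.
Qed.

Lemma nplus_swap j k s : nplus (swap j k s) = nplus s.
Proof.
rewrite /nplus -(card_imset _ (@perm_inj _ (tperm j k))).
apply: eq_card => i; rewrite inE; apply/imsetP/idP => [[l + ->]|sl].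
  by rewrite inE ffunE.
by exists (tperm j k i); rewrite ?tpermK// inE ffunE tpermK.
Qed.

Lemma card_hspin_neq s s' (D : {set 'I_n}) :
  (forall i, i \notin D -> s i = s' i) ->
  (#|[set h : half_edge n d | hspin s h != hspin s' h]%SET| <= #|D| * d)%N.
Proof.
move=> sD; rewrite -[d in leqRHS]card_ord -cardsT -cardsX.
apply/subset_leq_card/fintype.subsetP => h; rewrite !inE andbT.
by apply: contraR => /sD; rewrite /hspin => ->.
Qed.

Lemma card_hspin_flip i s :
  #|[set h : half_edge n d | hspin s h != hspin (flip i s) h]%SET| = d.
Proof.
rewrite -[RHS](card_ord d) -[#|'I_d|]mul1n -(cards1 i) -[#|'I_d|]cardsT -cardsX.
apply: eq_card => h; rewrite !inE andbT /hspin ffunE.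
by case: (h.1 == i); rewrite ?eqxx//; case: (s _).
Qed.

Lemma norm_energy_flip M i s : is_pairing M ->
  `|energy (hspin (flip i s)) M - energy (hspin s) M| <= 2 * d%:R :> R.
Proof.
move=> pM; rewrite distrC; apply: le_trans (norm_energyB _ _ pM) _.
by rewrite card_hspin_flip.
Qed.

Lemma norm_energy_swap M j k s : is_pairing M ->
  `|energy (hspin (swap j k s)) M - energy (hspin s) M| <= 4 * d%:R :> R.
Proof.
move=> pM; rewrite distrC; apply: le_trans (norm_energyB _ _ pM) _.
rewrite (_ : 4 = 2 * 2%:R :> R); last by rewrite -natrM.
rewrite -mulrA ler_pM2l// -natrM ler_nat.
apply: leq_trans (card_hspin_neq (D := [set j; k]%SET) _) _.
  by move=> i; rewrite !inE negb_or => /andP[ij ik]; rewrite ffunE tpermD// eq_sym.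
by rewrite leq_mul2r cards2; case: (j == k); rewrite orbT.
Qed.

Lemma reindex_flip (F : configuration n -> R) i a :
  \sum_(s | (nplus s == a.+1) && s i) F s =
  \sum_(s | (nplus s == a) && ~~ s i) F (flip i s).
Proof.
rewrite (reindex_inj (inv_inj (flipK i)))/=; apply: eq_bigl => s.
rewrite flip_id; case si : (s i); rewrite /= ?andbF// !andbT.
by rewrite nplus_flip ?si// eqSS.
Qed.

Lemma sum_nplus (F : configuration n -> R) a :
  \sum_i \sum_(s | (nplus s == a) && s i) F s = a%:R * \sum_(s | nplus s == a) F s.
Proof.
rewrite (exchange_big_dep (fun s => nplus s == a))/=; last by move=> i s _ /andP[].
rewrite mulr_sumr; apply: eq_bigr => s /eqP sa.
rewrite (eq_bigl (fun i => s i)) => [|i]; last by rewrite sa eqxx.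
by rewrite sumr_const -[X in X%:R * _]sa mulr_natl; congr (_ *+ _);
  apply: eq_card => i; rewrite inE.
Qed.

Lemma card_minus s : #|[pred i | ~~ s i]| = (n - nplus s)%N.
Proof.
have E := cardC [set i | s i]%SET; rewrite card_ord in E.
apply/eqP; rewrite -(eqn_add2l (nplus s)) subnKC ?nplus_le// -[X in _ == X]E.
by rewrite eqn_add2l; apply/eqP/eq_card => i; rewrite !inE.
Qed.

Lemma sum_nminus (F : configuration n -> R) a :
  \sum_i \sum_(s | (nplus s == a) && ~~ s i) F s =
  (n - a)%:R * \sum_(s | nplus s == a) F s.
Proof.
rewrite (exchange_big_dep (fun s => nplus s == a))/=; last by move=> i s _ /andP[].
rewrite mulr_sumr; apply: eq_bigr => s /eqP sa.
rewrite (eq_bigl (fun i => ~~ s i)) => [|i]; last by rewrite sa eqxx.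
rewrite sumr_const mulr_natl -sa -card_minus; congr (_ *+ _).
Qed.

Section Weights.
Variables (M : multigraph n d) (beta : R).
Hypotheses (pM : is_pairing M) (beta0 : 0 <= beta).

Local Notation w s := (expR (beta * energy (hspin s) M)).

Lemma weight_le s s' (c : R) : energy (hspin s) M - energy (hspin s') M <= c ->
  w s <= expR (beta * c) * w s'.
Proof.
by move=> h; rewrite -expRD ler_expR -mulrDr ler_wpM2l// -lerBlDr.
Qed.

(** Pairs of a configuration and a flipped vertex are counted in two ways: [a + 1] plus spins can be
    turned down, [n - a] minus spins can be turned up, and a flip changes the energy by at most
    [2 d]. *)
Lemma zfix_flip_le a :
  a.+1%:R * zfix beta M a.+1 <= expR (beta * (2 * d%:R)) * ((n - a)%:R * zfix
    beta M a).
Proof.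
rewrite /zfix -sum_nplus -sum_nminus mulr_sumr; apply: ler_sum => i _.
rewrite reindex_flip mulr_sumr; apply: ler_sum => s _.
by apply: weight_le; have := norm_energy_flip i s pM; rewrite ler_norml => /andP[].
Qed.

Lemma zfix_flip_ge a :
  (n - a)%:R * zfix beta M a <= expR (beta * (2 * d%:R)) * (a.+1%:R * zfix beta M
    a.+1).
Proof.
rewrite /zfix -sum_nplus -sum_nminus mulr_sumr; apply: ler_sum => i _.
rewrite reindex_flip mulr_sumr; apply: ler_sum => s _.
by apply: weight_le; have := norm_energy_flip i s pM; rewrite distrC ler_norml =>
  /andP[].
Qed.

(** The minus spin of [j] is exchanged with the plus spin of some [k]: there are [a] choices of [k],
    and a configuration with [j] plus is reached at most once for each of its [n - a] minus
    vertices. The exchange changes the energy by at most [4 d]. *)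
Lemma swap_weight_le i j a : i != j ->
  a%:R * \sum_(s | (nplus s == a) && ~~ s i && ~~ s j) w s <=
  expR (beta * (4 * d%:R)) *
    ((n - a)%:R * \sum_(s | (nplus s == a) && ~~ s i && s j) w s).
Proof.
move=> ij.
pose P s := (nplus s == a) && ~~ s i && ~~ s j.
have -> : a%:R * \sum_(s | P s) w s = \sum_k \sum_(s | P s && s k) w s.
  rewrite (exchange_big_dep P)/=; last by move=> k s _ /andP[].
  rewrite mulr_sumr; apply: eq_bigr => s Ps.
  rewrite (eq_bigl (fun k => s k)) => [|k]; last by rewrite Ps.
  have /andP[/andP[/eqP <- _] _] := Ps.
  by rewrite sumr_const mulr_natl; congr (_ *+ _); apply: eq_card => k; rewrite inE.
apply: (@le_trans _ _ (\sum_k \sum_(s | P s && s k)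
    expR (beta * (4 * d%:R)) * w (swap j k s))).
  apply: ler_sum => k _; apply: ler_sum => s _; apply: weight_le.
  by have := norm_energy_swap j k s pM; rewrite distrC ler_norml => /andP[].
under eq_bigr do rewrite -mulr_sumr.
rewrite -mulr_sumr ler_pM2l ?expR_gt0//.
pose Q s := (nplus s == a) && ~~ s i && s j.
apply: (@le_trans _ _ (\sum_k \sum_(s | Q s && ~~ s k) w s)).
  apply: ler_sum => k _.
  rewrite (reindex_inj (inv_inj (swapK j k)))/=.
  rewrite [leLHS]big_mkcond [leRHS]big_mkcond/=; apply: ler_sum => s _.
  rewrite swapK /P /Q nplus_swap !ffunE tpermL tpermR.
  case: ifPn => [/andP[/andP[/andP[-> si] sk] sj]|_]; last by case: ifP; rewrite
    ?expR_ge0.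
  have ik : i != k by apply: contraNneq si => ->; rewrite tpermR.
  by move: si; rewrite tpermD 1?eq_sym// => -> /=; rewrite sj sk.
rewrite (exchange_big_dep Q)/=; last by move=> k s _ /andP[].
rewrite mulr_sumr; apply: ler_sum => s Qs.
rewrite (eq_bigl (fun k => ~~ s k)) => [|k]; last by rewrite Qs.
have /andP[/andP[/eqP <- _] _] := Qs.
by rewrite sumr_const mulr_natl -card_minus.
Qed.

End Weights.
End Flips.

Section Drop.
Context {R : realType} {n d : nat}.
Variables (M : multigraph n d) (beta : R).
Hypotheses (pM : is_pairing M) (beta0 : 0 <= beta) (d0 : (0 < d)%N).
Implicit Types (s : configuration n) (i j : 'I_n).

Local Notation w s := (expR (beta * energy (hspin s) M)).

(* Of the [d] edges at [i], the one through the half-edge [(i, 0)] does not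
   lose energy in the flip of [i] as soon as its other end [j] is [i] or has
   spin 1. *)
Lemma flip_gain i : exists j, forall s, ~~ s i -> (j == i) || s j ->
  expR (beta * (2 - 2 * d%:R)) * w s <= w (flip i s).
Proof.
pose h : half_edge n d := (i, Ordinal d0).
have [eM he] := pblock_pairing h pM.
have [h' h'h eE] := pairing_edge pM eM he.
exists h'.1 => s si good.
set e := finset.pblock M h in eM he eE.
have le_e : edge_spin (hspin s) e <= edge_spin (hspin (flip i s)) e :> R.
  rewrite eE /edge_spin !big_setU1 ?inE 1?eq_sym//= !big_set1 /hspin/= flip_id.
  case/orP: good => [/eqP ->|sj]; first by rewrite flip_id; case: (s i); rewrite
    /= ?mulrNN.
  have ji : h'.1 != i by apply: contraNneq si => <-.
  by rewrite flip_neq// sj (negbTE si)/= !mulr1; lra.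
have dif : [exists x in e, hspin s x != hspin (flip i s) x].
  by apply/exists_inP; exists h; rewrite // /hspin flip_id; case: (s i).
have := energyB_edge pM eM le_e dif; rewrite card_hspin_flip => gain.
rewrite -expRD ler_expR -mulrDr ler_wpM2l//.
by move: gain; set E1 := energy _ _; set E2 := energy _ _; lra.
Qed.

Lemma weight_flip_sum i a (c : R) : 0 <= c <= 1 ->
  c * (n - a)%:R <= a%:R * expR (- (beta * (4 * d%:R))) ->
  (n - a)%:R != 0 :> R ->
  expR (- (beta * (2 * d%:R))) * (1 + (expR (2 * beta) - 1) * (c / 2)) *
    \sum_(s | (nplus s == a) && ~~ s i) w s <=
  \sum_(s | (nplus s == a) && ~~ s i) w (flip i s).
Proof.
move=> /andP[c0 c1] ca na0; have [j good] := flip_gain i.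
pose A s := (nplus s == a) && ~~ s i; pose g s := (j == i) || s j.
have flip_lo s : expR (- (beta * (2 * d%:R))) * w s <= w (flip i s).
  rewrite -mulrN -expRD ler_expR -mulrDr ler_wpM2l//.
  have := @norm_energy_flip R _ _ _ i s pM; rewrite ler_norml => /andP[+ _].
  by set E1 := energy _ _; set E2 := energy _ _; lra.
have gw : c / 2 * \sum_(s | A s) w s <= \sum_(s | A s && g s) w s.
  have sum0 (P : pred (configuration n)) : 0 <= \sum_(s | P s) w s.
    by apply: sumr_ge0 => ? _; apply: expR_ge0.
  have [ji|ji] := eqVneq j i.
    rewrite [leRHS](eq_bigl A) => [|s]; last by rewrite /g ji eqxx andbT.
    by rewrite ler_piMl//; lra.
  have ij : i != j by rewrite eq_sym.
  rewrite [leRHS](eq_bigl (fun s => A s && s j)) => [|s]; last first.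
    by rewrite /g (negbTE ji).
  rewrite [X in _ * X](bigID (fun s => s j))/=.
  have := swap_weight_le pM beta0 a ij; rewrite -/(A _).
  set U := \sum_(s | A s && ~~ s j) _; set W := \sum_(s | A s && s j) _ => sw.
  have W0 : 0 <= W by exact: sum0.
  have U0 : 0 <= U by exact: sum0.
  have na : 0 < (n - a)%:R :> R by rewrite lt_neqAle eq_sym na0 ler0n.
  (* [U] and [W] are the weights with [j] minus and with [j] plus; [c U <= W] and [c W <= W] add up
     to the fraction [c / 2]. *)
  have cU : c * U <= W.
    rewrite -(ler_pM2l na) mulrA [_ * c]mulrC.
    apply: le_trans (ler_wpM2r U0 ca) _.
    have e1 : expR (- (beta * (4 * d%:R))) * expR (beta * (4 * d%:R)) = 1.
      by rewrite mulrC expR_mulN.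
    have := ler_wpM2l (expR_ge0 (- (beta * (4 * d%:R)))) sw.
    by rewrite [leRHS]mulrA e1 mul1r mulrCA mulrA.
  have cW : c * W <= W by rewrite ler_piMl.
  lra.
rewrite -mulrA; set D := expR (- _); set S := \sum_(s | _) w s in gw *.
apply: (@le_trans _ _ (D * (S + (expR (2 * beta) - 1) * \sum_(s | A s && g s) w s))).
  rewrite ler_pM2l ?expR_gt0// mulrDl mul1r -mulrA lerD2l ler_wpM2l//.
  by have := expR_ge1Dx (2 * beta); have := beta0; lra.
rewrite big_mkcondr/= mulr_sumr /S -big_split/= mulr_sumr; apply: ler_sum => s As.
case: ifPn => [gs|_]; last by rewrite mulr0 addr0 flip_lo.
have si : ~~ s i by case/andP: As.
apply: le_trans (good s si gs).
rewrite mulrBl mul1r addrC subrK mulrA /D -expRD.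
rewrite le_eqVlt; apply/orP; left; apply/eqP; congr (expR _ * _).
by ring.
Qed.

Lemma zfix_drop a (c : R) : 0 <= c <= 1 ->
  c * (n - a)%:R <= a%:R * expR (- (beta * (4 * d%:R))) ->
  expR (- (beta * (2 * d%:R))) * (1 + (expR (2 * beta) - 1) * (c / 2)) *
    ((n - a)%:R * zfix beta M a) <= a.+1%:R * zfix beta M a.+1.
Proof.
move=> c01 ca; have [na|na] := eqVneq (n - a)%:R (0 : R).
  by rewrite na mul0r mulr0 mulr_ge0// sumr_ge0// => *; apply: expR_ge0.
rewrite /zfix -sum_nplus -sum_nminus mulr_sumr; apply: ler_sum => i _.
by rewrite reindex_flip; apply: weight_flip_sum.
Qed.

End Drop.

(** * Regularity of the logarithm in the number of plus spins and in beta *)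

Section LogBounds.
Context {R : realType}.

Lemma ln_le_sqrt (x : R) : 0 < x -> ln x <= 2 * Num.sqrt x.
Proof.
move=> x0; have s0 : 0 < Num.sqrt x by rewrite sqrtr_gt0.
rewrite -[in ln x](sqr_sqrtr (ltW x0)) lnXn// -[ln _ *+ 2]mulr_natl ler_wpM2l//.
exact/ltW/ln_sublinear.
Qed.

Lemma sqrtr_succ_ge (m : nat) :
  1 <= 2 * Num.sqrt m.+1%:R * (Num.sqrt m.+1%:R - Num.sqrt m%:R) :> R.
Proof.
have := sqr_sqrtr (ler0n R m.+1); have := sqr_sqrtr (ler0n R m).
have := sqrtr_ge0 (m%:R : R); have := sqrtr_ge0 (m.+1%:R : R).
rewrite -natr1; set x := Num.sqrt _; set y := Num.sqrt _ => *; nra.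
Qed.

(** The logarithm is bounded by a square root to make the bound telescope in [m]: [1 / sqrt (m + 1)]
    is at most twice the increment of the square root. *)
Lemma ln_ratio_le (n m : nat) : (m < n)%N ->
  ln (n%:R / m.+1%:R) <= 4 * Num.sqrt n%:R * (Num.sqrt m.+1%:R - Num.sqrt m%:R) :> R.
Proof.
move=> mn; have n0 : (0 : R) < n%:R by rewrite ltr0n; lia.
apply: le_trans (ln_le_sqrt _) _; first by rewrite divr_gt0// ltr0n.
rewrite sqrtrM ?ler0n// sqrtrV ?ler0n//.
have s0 : (0 : R) < Num.sqrt m.+1%:R by rewrite sqrtr_gt0 ltr0n.
rewrite mulrA ler_pdivrMr// -mulrA.
have := sqrtr_succ_ge m; have := sqrtr_ge0 (n%:R : R).
set x := Num.sqrt m.+1%:R in s0 *; set y := Num.sqrt m%:R; set z := Num.sqrt _.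
by nra.
Qed.

Lemma sqrtrB_le (a b : R) : 0 <= a -> a <= b ->
  Num.sqrt b - Num.sqrt a <= Num.sqrt (b - a).
Proof.
move=> a0 ab; have b0 : 0 <= b by apply: le_trans ab.
have ba : 0 <= b - a by rewrite subr_ge0.
have := sqr_sqrtr a0; have := sqr_sqrtr b0; have := sqr_sqrtr ba.
have := sqrtr_ge0 a; have := sqrtr_ge0 b; have := sqrtr_ge0 (b - a).
set x := Num.sqrt b; set y := Num.sqrt a; set z := Num.sqrt (b - a).
move=> z0 x0 y0 h1 h2 h3; rewrite leNgt; apply/negP => zxy; nra.
Qed.

Context {n d : nat}.
Variable M : multigraph n d.
Hypothesis pM : is_pairing M.

Definition lnz (beta : R) (a : nat) : R := ln (zfix beta M a).

Lemma lnz_step (beta : R) a : 0 <= beta -> (a < n)%N ->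
  `|lnz beta a.+1 - lnz beta a| <= beta * (2 * d%:R) +
     4 * Num.sqrt n%:R * ((Num.sqrt a.+1%:R - Num.sqrt (n - a.+1)%:R) -
                          (Num.sqrt a%:R - Num.sqrt (n - a)%:R)).
Proof.
move=> b0 an.
have z1 : 0 < zfix beta M a.+1 by apply: zfix_gt0.
have z0 : 0 < zfix beta M a by apply: zfix_gt0; apply: ltnW.
have n0 : (0 : R) < n%:R by rewrite ltr0n; lia.
have a1 : (0 : R) < a.+1%:R by rewrite ltr0n.
have na : (0 : R) < (n - a)%:R by rewrite ltr0n subn_gt0.
have r1 := ln_ratio_le an.
have r2 : ln (n%:R / (n - a)%:R) <=
    4 * Num.sqrt n%:R * (Num.sqrt (n - a)%:R - Num.sqrt (n - a.+1)%:R) :> R.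
  have -> : (n - a = (n - a.+1).+1)%N by lia.
  by apply: ln_ratio_le; lia.
have r1' : 0 <= ln (n%:R / a.+1%:R) :> R.
  by rewrite ln_ge0// ler_pdivlMr// mul1r ler_nat.
have r2' : 0 <= ln (n%:R / (n - a)%:R) :> R.
  by rewrite ln_ge0// ler_pdivlMr// mul1r ler_nat leq_subr.
have := zfix_flip_le pM b0 a; have := zfix_flip_ge pM b0 a.
rewrite -ler_ln ?posrE ?mulr_gt0 ?expR_gt0// lnM ?posrE// => h1.
rewrite -ler_ln ?posrE ?mulr_gt0 ?expR_gt0// lnM ?posrE//.
move: h1; rewrite !lnM ?posrE ?mulr_gt0 ?expR_gt0// !expRK -/(lnz _ _) -/(lnz _ _).
move: r1 r2 r1' r2'; rewrite !ln_div ?posrE// ler_norml.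
set X := ln n%:R; set Y := ln a.+1%:R; set Z := ln (n - a)%:R.
set p := Num.sqrt a.+1%:R; set q := Num.sqrt a%:R.
set u := Num.sqrt (n - a)%:R; set v := Num.sqrt (n - a.+1)%:R.
set t := 4 * _; set c := beta * _.
rewrite !mulrBr; move: (t * p) (t * q) (t * u) (t * v) => tp tq tu tv.
move=> *; apply/andP; split; lra.
Qed.

(** Single steps can be of order [ln n] near [a = 0] and [a = n], but the bounds of [lnz_step]
    telescope. After division by [n] the result is a modulus of continuity free of [n], valid up to
    both ends. *)
Lemma lnz_lipschitz (beta : R) a b : 0 <= beta -> (a <= b)%N -> (b <= n)%N ->
  `|lnz beta b - lnz beta a| <= beta * (2 * d%:R) * (b - a)%:R +
     8 * Num.sqrt n%:R * Num.sqrt (b - a)%:R.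
Proof.
move=> b0 ab bn.
have tel : `|lnz beta b - lnz beta a| <= beta * (2 * d%:R) * (b - a)%:R +
     4 * Num.sqrt n%:R * ((Num.sqrt b%:R - Num.sqrt (n - b)%:R) -
                          (Num.sqrt a%:R - Num.sqrt (n - a)%:R)).
  elim: b ab bn => [|b IH].
    by rewrite leqn0 => /eqP -> _; rewrite !subrr normr0 !mulr0 addr0.
  rewrite leq_eqVlt => /orP[/eqP <- _|]; first by rewrite subnn !subrr normr0
    !mulr0 addr0.
  rewrite ltnS => ab bn; have {}IH := IH ab (ltnW bn).
  have st := lnz_step b0 bn.
  rewrite (_ : lnz beta b.+1 - _ =
    (lnz beta b.+1 - lnz beta b) + (lnz beta b - lnz beta a)); last by ring.
  apply: le_trans (ler_normD _ _) _; apply: le_trans (lerD st IH) _.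
  by rewrite subSn// -[(b - a).+1%:R]natr1; lra.
apply: le_trans tel _; rewrite lerD2l.
have h1 : Num.sqrt b%:R - Num.sqrt a%:R <= Num.sqrt (b - a)%:R :> R.
  by rewrite natrB//; apply: sqrtrB_le; rewrite ?ler0n ?ler_nat.
have h2 : Num.sqrt (n - a)%:R - Num.sqrt (n - b)%:R <= Num.sqrt (b - a)%:R :> R.
  have -> : (b - a = (n - a) - (n - b))%N by lia.
  have nba : (n - b <= n - a)%N by lia.
  by rewrite (natrB _ nba); apply: sqrtrB_le; rewrite ?ler0n ?ler_nat.
have := sqrtr_ge0 (n%:R : R); nra.
Qed.

Lemma card_M : (n * d = #|M| * 2)%N.
Proof. by rewrite -(card_pairing pM) card_prod !card_ord. Qed.

Lemma zfix_le_weights (b1 b2 c : R) (M' : multigraph n d) a :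
  (forall s : configuration n,
     b1 * energy (hspin s) M <= c + b2 * energy (hspin s) M') -> (a <= n)%N ->
  lnz b1 a <= c + ln (zfix b2 M' a).
Proof.
move=> h an; rewrite /lnz -ler_expR expRD !lnK ?posrE ?zfix_gt0//.
by rewrite /zfix mulr_sumr; apply: ler_sum => s _; rewrite -expRD ler_expR.
Qed.

Lemma lnz_beta_lipschitz (b1 b2 : R) a : (a <= n)%N ->
  `|lnz b1 a - lnz b2 a| <= `|b1 - b2| * (n * d)%:R.
Proof.
move=> an.
have key (x y : R) : lnz x a <= `|x - y| * (n * d)%:R + lnz y a.
  apply: zfix_le_weights => // s.
  rewrite -lerBlDr -mulrBl; apply: le_trans (ler_norm _) _; rewrite normrM.
  rewrite ler_wpM2l//; apply: le_trans (norm_energy _ pM) _.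
  by rewrite card_M ler_nat leq_pmulr.
have := key b1 b2; have := key b2 b1; rewrite [`|b2 - _|]distrC => h1 h2.
by rewrite ler_norml; apply/andP; split; lra.
Qed.

Lemma lnz_bound (beta : R) a : 0 <= beta -> (a <= n)%N ->
  `|lnz beta a| <= (1 + beta * d%:R) * n%:R.
Proof.
move=> b0 an.
have h := lnz_beta_lipschitz beta 0 an; rewrite subr0 [`|beta|]ger0_norm// in h.
have z0 : 0 <= lnz 0 a <= n%:R.
  have zE : zfix (0 : R) M a = #|[set s : configuration n | nplus s == a]%SET|%:R.
    transitivity (\sum_(s : configuration n | nplus s == a) (1 : R)).
      by apply: eq_bigr => s _; rewrite mul0r expR0.
    by rewrite sumr_const; congr _%:R; apply: eq_card => s; rewrite inE.
  have := @zfix_gt0 R _ _ 0 M _ an; rewrite /lnz zE ltr0n => c0.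
  rewrite ln_ge0 ?ler1n//=.
  apply: le_trans (_ : ln (2 ^+ n) <= _).
    rewrite ler_ln ?posrE ?ltr0n ?exprn_gt0// -natrX ler_nat.
    by apply: leq_trans (max_card _) _; rewrite card_ffun card_bool card_ord.
  rewrite lnXn// -[ln 2 *+ n]mulr_natr -[leRHS]mul1r ler_wpM2r//.
  by have := @le_ln1Dx R 1; lra.
move: h; rewrite natrM !ler_norml => /andP[h1 h2]; move: z0 => /andP[z1 z2].
by apply/andP; split; lra.
Qed.

(** Each weight at [beta = 1] is at most the sum [S], so its power [beta] is at most
    [S ^ (beta - 1)] times the weight. *)
Lemma lnz_power (beta : R) a : 1 <= beta -> (a <= n)%N ->
  lnz beta a <= beta * lnz 1 a.
Proof.
move=> b1 an; have z1 := @zfix_gt0 R _ _ 1 M _ an.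
rewrite /lnz -ler_expR lnK ?posrE ?zfix_gt0//.
set S := zfix 1 M a in z1 *.
have -> : expR (beta * ln S) = expR ((beta - 1) * ln S) * S.
  by rewrite -[in RHS](lnK z1) ?posrE// -expRD expRK; congr expR; ring.
rewrite /S [in leRHS]/zfix mulr_sumr -/S; apply: ler_sum => s sa.
rewrite mul1r -expRD ler_expR.
suff : energy (hspin s) M <= ln S by move=> h; nra.
rewrite -ler_expR lnK ?posrE// /S /zfix (bigD1 s)//= mul1r lerDl.
by apply: sumr_ge0 => ? _; apply: expR_ge0.
Qed.

Lemma zfix_sym (beta : R) a : (a <= n)%N -> zfix beta M a = zfix beta M (n - a).
Proof.
move=> an.
pose neg (s : configuration n) : configuration n := [ffun i => ~~ s i].
have negK : involutive neg by move=> s; apply/ffunP => i; rewrite !ffunE negbK.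
rewrite /zfix (reindex_inj (inv_inj negK))/=; apply: eq_big => [s|s _].
  have -> : nplus (neg s) = (n - nplus s)%N.
    rewrite -card_minus /nplus; apply: eq_card => i; rewrite !inE ffunE//.
  by have := nplus_le s; lia.
congr (expR (_ * _)); apply: eq_bigr => e /(card_pairing_edge pM)/eqP/cards2P.
move=> [x [y [xy ->]]]; rewrite /edge_spin !big_setU1 ?inE//= !big_set1 /hspin !ffunE.
by case: (s _); case: (s _); rewrite /= ?mulrNN ?mulr1 ?mul1r.
Qed.

Lemma lnz0_ge (beta : R) : beta * (n * d)%:R / 2 <= lnz beta 0.
Proof.
rewrite /lnz -ler_expR lnK ?posrE ?zfix_gt0//.
pose s : configuration n := [ffun=> false].
rewrite /zfix (bigD1 s)/=; last first.
  by rewrite /nplus cards_eq0; apply/eqP/finset.setP => i; rewrite !inE ffunE.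
rewrite (@energy_const _ _ _ _ false pM) => [|h]; last by rewrite /hspin ffunE.
rewrite card_M natrM mulrA mulfK// lerDl.
by apply: sumr_ge0 => ? _; apply: expR_ge0.
Qed.

(** Pigeonhole over the [n + 1] possible numbers of plus spins, then spin reversal to reach
    [2 a <= n]. The [a] obtained depends on [M]. *)
Lemma lnz_ge_Bethe (beta Q : R) :
  expR (n%:R * Q) <= \sum_(s : configuration n) expR (beta * energy (hspin s) M) ->
  exists2 a, (2 * a <= n)%N & n%:R * Q - ln n.+1%:R <= lnz beta a.
Proof.
move=> hQ.
have [a an ha] : exists2 a, (a <= n)%N & n%:R * Q - ln n.+1%:R <= lnz beta a.
  have tot : \sum_(s : configuration n) expR (beta * energy (hspin s) M) =
      \sum_(a < n.+1) zfix beta M a.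
    rewrite (partition_big (fun s => inord (nplus s) : 'I_n.+1) xpredT)//=.
    apply: eq_bigr => a _; apply: eq_bigl => s.
    by rewrite -val_eqE/= inordK// ltnS nplus_le.
  rewrite tot in hQ; apply/not_exists2P => hn; move: hQ; apply/negP; rewrite -ltNge.
  have lt_ (a : 'I_n.+1) : zfix beta M a < expR (n%:R * Q) / n.+1%:R.
    have an : (a <= n)%N by rewrite -ltnS.
    case: (hn a) => [|/negP]; first by move/(_ an).
    rewrite -ltNge => hlt; have zpos := zfix_gt0 beta M an.
    rewrite -[ltLHS]lnK ?posrE// -[n.+1%:R]lnK ?posrE ?ltr0n// -expRB ltr_expR.
    exact: hlt.
  apply: (@lt_le_trans _ _ (\sum_(a < n.+1) expR (n%:R * Q) / n.+1%:R)).
    by apply: ltr_sum => //; apply/hasP; exists ord0; rewrite ?mem_index_enum.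
  by rewrite sumr_const card_ord -[_ / _ *+ _]mulr_natr divfK ?pnatr_eq0.
have [a2|a2] := leqP (2 * a) n; first by exists a.
exists (n - a)%N; first by lia.
by rewrite /lnz -zfix_sym.
Qed.

End LogBounds.

Lemma double_succ_bounds (n a : nat) : (2 * a.+1 <= n)%N ->
  [/\ (a <= n)%N, (a.+1 <= n)%N, (a.+1 <= n - a)%N &
      (4 * a < n - a)%N -> (a.+1 * 2 <= n - a)%N].
Proof. by move=> ?; split; lia. Qed.

Section LogDrop.
Context {R : realType}.

(** [eta] must depend neither on [n] nor on [a]. If [n - a <= 4 a], the plus spins have positive
    density and [zfix_drop] gives the factor [1 + delta]. Otherwise [n - a >= 2 (a + 1)], and
    [zfix_flip_ge] gives a factor 2 from entropy alone. *)
Lemma lnz_drop_step (d : nat) (beta : R) : (0 < d)%N -> 0 < beta ->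
  exists2 eta, 0 < eta & forall n (M : multigraph n d) a, is_pairing M ->
    (2 * a.+1 <= n)%N -> lnz M beta a - lnz M beta a.+1 <= beta * (2 * d%:R) - eta.
Proof.
move=> d0 b0; pose c : R := expR (- (beta * (4 * d%:R))) / 4.
have x0 := expR_gt0 (- (beta * (4 * d%:R))).
have c0 : 0 < c by rewrite divr_gt0.
have c1 : c <= 1.
  have : expR (- (beta * (4 * d%:R))) <= 1.
    by rewrite -expR0 ler_expR oppr_le0 mulr_ge0 ?(ltW b0)// mulr_ge0.
  by rewrite /c; lra.
have e1 : 1 < expR (2 * beta) by rewrite expR_gt1; lra.
pose delta := (expR (2 * beta) - 1) * (c / 2).
have delta0 : 0 < delta by rewrite mulr_gt0 ?divr_gt0// subr_gt0.
have b0' := ltW b0.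
exists (Num.min (ln 2) (ln (1 + delta))).
  by rewrite lt_min !ln_gt0//; lra.
move=> n M a pM an.
have [an0 an1 an2 an3] := double_succ_bounds an.
have z1 : 0 < zfix beta M a.+1 by apply: zfix_gt0.
have z0 : 0 < zfix beta M a by apply: zfix_gt0.
have a1 : (0 : R) < a.+1%:R by rewrite ltr0n.
have y0 := expR_gt0 (beta * (2 * d%:R)).
suff [eta [eta0 le_eta h]] : exists eta, [/\ 0 < eta, Num.min (ln 2) (ln (1 +
  delta)) <= ln eta &
    eta * zfix beta M a <= expR (beta * (2 * d%:R)) * zfix beta M a.+1].
  move: h; rewrite -ler_ln ?posrE ?mulr_gt0// !lnM ?posrE// expRK -/(lnz _ _ _)
    -/(lnz _ _ _).
  move: le_eta; set m := Num.min _ _; lra.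
have [na|na] := leqP (n - a) (4 * a).
  exists (1 + delta); split; [lra|by rewrite ge_min lexx orbT|].
  have ca : c * (n - a)%:R <= a%:R * expR (- (beta * (4 * d%:R))).
    have na' : (n - a)%:R <= 4 * a%:R :> R by rewrite -natrM ler_nat.
    by rewrite /c; move: x0 na'; set x := expR _; nra.
  have c01 : 0 <= c <= 1 by rewrite c1 ltW.
  have := zfix_drop pM b0' d0 c01 ca; rewrite -/delta => h.
  (* The counting factors may be dropped because [2 (a + 1) <= n] gives [a + 1 <= n - a]. *)
  have h2 : expR (- (beta * (2 * d%:R))) * (1 + delta) * zfix beta M a <= zfix
    beta M a.+1.
    rewrite -(ler_pM2l a1); apply: le_trans h.
    rewrite [leRHS]mulrCA; apply: ler_wpM2r; last by rewrite ler_nat.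
    by apply: mulr_ge0 (ltW z0); apply: mulr_ge0 (expR_ge0 _) _; lra.
  have := ler_wpM2l (ltW y0) h2.
  by rewrite !mulrA expR_mulN mul1r.
exists 2; split; [lra|by rewrite ge_min lexx|].
rewrite -(ler_pM2l a1) [leLHS]mulrA; apply: le_trans (_ : (n - a)%:R * zfix beta
  M a <= _).
  by rewrite ler_pM2r// -natrM ler_nat an3.
by rewrite [leRHS]mulrCA; apply: zfix_flip_ge.
Qed.

Lemma lnz_drop (d : nat) (beta : R) : (0 < d)%N -> 0 < beta ->
  exists2 eta, 0 < eta & forall n (M : multigraph n d) a b, is_pairing M ->
    (a <= b)%N -> (2 * b <= n)%N ->
    lnz M beta a - lnz M beta b <= (beta * (2 * d%:R) - eta) * (b - a)%:R.
Proof.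
move=> d0 b0; have [eta eta0 h] := lnz_drop_step d0 b0.
exists eta => // n M a b pM; elim: b => [|b IH].
  by rewrite leqn0 => /eqP -> _; rewrite !subrr mulr0.
rewrite leq_eqVlt => /orP[/eqP <- _|]; first by rewrite subnn !subrr mulr0.
rewrite ltnS => ab bn; have {}IH := IH ab (leq_trans (leq_mul (leqnn 2) (leqnSn
  b)) bn).
have := h n M b pM bn; rewrite subSn// -[(b - a).+1%:R]natr1.
by lra.
Qed.

Lemma lnz_pact n d (M : multigraph n d) (beta : R) a x y : 0 <= beta ->
  is_pairing M -> (a <= n)%N ->
  `|lnz (pact (tperm x y) M) beta a - lnz M beta a| <= 4 * beta.
Proof.
move=> b0 pM an.
have en (s : configuration n) := @norm_energy_pact R _ M (hspin s) x y pM.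
have h1 : lnz (pact (tperm x y) M) beta a <= 4 * beta + lnz M beta a.
  apply: zfix_le_weights => // s; have := en s; rewrite ler_norml => /andP[_ h].
  by rewrite -lerBlDr -mulrBr mulrC ler_wpM2r.
have h2 : lnz M beta a <= 4 * beta + lnz (pact (tperm x y) M) beta a.
  apply: zfix_le_weights => // s; have := en s; rewrite ler_norml => /andP[h _].
  by rewrite -lerBlDr -mulrBr mulrC ler_wpM2r//; move: h; set u := energy _ _;
    set v := energy _ _; lra.
by rewrite ler_norml; apply/andP; split; lra.
Qed.

End LogDrop.

Section PairingMean.
Context {R : realType} {H : finType}.
Implicit Types (f g : {set {set H}} -> R).
Hypothesis P0 : (0 < #|@pairing_set H|)%N.

Lemma pairing_avg_const (c : R) : pairing_avg (fun _ : {set {set H}} => c) = c.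
Proof.
by rewrite /pairing_avg sumr_const -[c *+ _]mulr_natr mulfK// pnatr_eq0 -lt0n.
Qed.

Lemma le_pairing_avg f g : (forall M, is_pairing M -> f M <= g M) ->
  pairing_avg f <= pairing_avg g.
Proof.
move=> fg; rewrite ler_wpM2r ?invr_ge0//; apply: ler_sum => M.
by rewrite inE; apply: fg.
Qed.

Lemma pairing_avgD f g :
  pairing_avg (fun M => f M + g M) = pairing_avg f + pairing_avg g.
Proof. by rewrite /pairing_avg big_split mulrDl. Qed.

Lemma pairing_avgZ (c : R) f : pairing_avg (fun M => c * f M) = c * pairing_avg f.
Proof. by rewrite /pairing_avg -mulr_sumr mulrA. Qed.

Lemma norm_pairing_avgB f g (c : R) : (forall M, is_pairing M -> `|f M - g M| <= c) ->
  `|pairing_avg f - pairing_avg g| <= c.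
Proof.
move=> fg; rewrite -mulN1r -pairing_avgZ -pairing_avgD ler_norml.
rewrite -[X in _ && (_ <= X)]pairing_avg_const -[X in X <= _]pairing_avg_const.
by apply/andP; split; apply: le_pairing_avg => M /fg; rewrite mulN1r ler_norml =>
  /andP[].
Qed.

(** Jensen's inequality through the tangent of the logarithm at [c]: [ln x <= x / c + ln c - 1]. *)
Lemma pairing_avg_ln f (c : R) : 0 < c -> (forall M, is_pairing M -> 0 < f M) ->
  pairing_avg f <= c -> pairing_avg (fun M => ln (f M)) <= ln c.
Proof.
move=> c0 f0 fc.
apply: (@le_trans _ _ (pairing_avg (fun M => c^-1 * f M + (ln c - 1)))).
  apply: le_pairing_avg => M pM; have fM := f0 M pM.
  have -> : ln (f M) = ln (1 + (f M / c - 1)) + ln c.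
    rewrite addrCA subrr addr0 ln_div ?posrE// subrK//.
  have := @le_ln1Dx R (f M / c - 1).
  have : 0 < f M / c by rewrite divr_gt0.
  by rewrite [c^-1 * _]mulrC; set u := f M / c => u0 /(_ _)/wrap[]; lra.
rewrite pairing_avgD pairing_avgZ pairing_avg_const.
have : c^-1 * pairing_avg f <= 1 by rewrite mulrC ler_pdivrMr// mul1r.
lra.
Qed.

End PairingMean.

Section MeanLog.
Context {R : realType}.
Variables (d : nat) (beta : R).
Hypothesis beta0 : 0 <= beta.

Definition mlnz n a : R := pairing_avg (fun M : multigraph n d => lnz M beta a).

(** Jensen reduces the claim to the annealed sum. By regularity a balanced configuration is also
    balanced on half-edges, so [annealed_balanced_le] applies to each of them, and there are at most
    [2 ^ n]. *)
Lemma mlnz_half_le a : (0 < #|@pairing_set (half_edge (2 * a) d)|)%N ->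
  mlnz (2 * a) a <= (2 * a)%:R * ln 2 + ln (2 * a * d).+1%:R +
    (a * d)%:R * ln (ch beta).
Proof.
move=> P0; have PR : (0 : R) < #|@pairing_set (half_edge (2 * a) d)|%:R by
  rewrite ltr0n.
set n := (2 * a)%N.
have -> : n%:R * ln 2 + ln (n * d).+1%:R + (a * d)%:R * ln (ch beta) =
    ln (2 ^+ n * ((n * d).+1%:R * ch beta ^+ (a * d))) :> R.
  have p1 : (0 : R) < 2 ^+ n by rewrite exprn_gt0.
  have p2 : (0 : R) < (n * d).+1%:R by rewrite ltr0n.
  have p3 : 0 < ch beta ^+ (a * d) by rewrite exprn_gt0// ch_gt0.
  rewrite lnM ?posrE ?mulr_gt0// lnM ?posrE// lnXn// lnXn ?ch_gt0//.
  by rewrite addrA !mulr_natl.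
apply: pairing_avg_ln => //.
- by rewrite !mulr_gt0 ?exprn_gt0 ?ch_gt0 ?ltr0n.
- by move=> M _; apply: zfix_gt0; rewrite /n; lia.
rewrite ler_pdivrMr// exchange_big/=.
apply: (@le_trans _ _ (\sum_(s : configuration n | nplus s == a)
    #|@pairing_set (half_edge n d)|%:R * ((n * d).+1%:R * ch beta ^+ (a * d)))).
  apply: ler_sum => s /eqP sa; rewrite -/(annealed _ _).
  have cH : #|half_edge n d| = (2 * #|[set h : half_edge n d | hspin s h]%SET|)%N.
    rewrite card_prod !card_ord /n -mulnA -[in LHS]sa; congr (2 * _)%N.
    rewrite /nplus -[d in LHS]card_ord -[#|'I_d|]cardsT -cardsX.
    by apply: eq_card => h; rewrite !inE andbT.
  pose sf : {ffun half_edge n d -> bool} := [ffun h => hspin s h].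
  have := @annealed_balanced_le R _ beta sf.
  have cE : #|[set h | sf h]%SET| =
      #|[set h : half_edge n d | hspin s h]%SET|.
    by apply: eq_card => h; rewrite !inE ffunE.
  rewrite cE -cH => /(_ erefl).
  have -> : #|half_edge n d| = (n * d)%N by rewrite card_prod !card_ord.
  rewrite [(n * d %/ 2)%N](_ : _ = (a * d)%N); last by rewrite /n -mulnA mulKn.
  apply: le_trans; rewrite le_eqVlt; apply/orP; left; apply/eqP.
  apply: eq_bigr => M _; congr (expR (_ * _)).
  by apply: eq_bigr => e _; apply: eq_bigr => h _; rewrite ffunE.
rewrite sumr_const -[leLHS]mulr_natl [leRHS](_ : _ = 2 ^+ n *
  (#|@pairing_set (half_edge n d)|%:R * ((n * d).+1%:R * ch beta ^+ (a * d))));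
    last by ring.
apply: ler_wpM2r.
  by rewrite mulr_ge0// mulr_ge0// exprn_ge0// (ltW (ch_gt0 _)).
rewrite -natrX ler_nat; apply: leq_trans (max_card _) _.
by rewrite card_ffun card_bool card_ord.
Qed.

(* [pairing_concentration] with a switching constant [c] and a parameter [k]
   small enough for the quadratic term to absorb half of [k * e * n]. *)
Lemma lnz_concentration (e : R) : 0 < e -> exists2 r : R, 0 < r &
  forall n a, (a <= n)%N ->
    #|[set M in @pairing_set (half_edge n d) |
        e * n%:R <= `|lnz M beta a - mlnz n a|]%SET|%:R <=
    2 * expR (- (r * n%:R)) * #|@pairing_set (half_edge n d)|%:R.
Proof.
(* The added 1 keeps [c] positive at [beta = 0], for the divisions in [k]. *)
move=> e0; pose c := 4 * beta + 1; have c0 : 0 < c by rewrite /c ltr_wpDl// mulr_ge0.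
pose k := Num.min (1 / (4 * c)) (e / (16 * c ^+ 2 * (d%:R + 1))).
have dd : 0 < 16 * c ^+ 2 * (d%:R + 1) :> R.
  have d1 : 0 < d%:R + 1 :> R by rewrite ltr_wpDl.
  by apply: mulr_gt0 d1; apply: mulr_gt0 => //; apply: exprn_gt0.
have k0 : 0 < k by rewrite lt_min !divr_gt0// mulr_gt0.
have kc : k * c <= 1 / 4.
  apply: (@le_trans _ _ (1 / (4 * c) * c)); first by rewrite ler_pM2r// ge_min lexx.
  by rewrite le_eqVlt; apply/orP; left; apply/eqP; field; rewrite gt_eqF.
have ke : k * (16 * c ^+ 2 * (d%:R + 1)) <= e.
  by rewrite -ler_pdivlMr// ge_min lexx orbT.
exists (k * e / 2); first by rewrite divr_gt0// mulr_gt0.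
move=> n a an.
have lip x y (M : multigraph n d) : is_pairing M ->
    `|lnz (pact (tperm x y) M) beta a - lnz M beta a| <= c.
  by move=> pM; apply: le_trans (lnz_pact x y beta0 pM an) _; rewrite /c; lra.
apply: le_trans (pairing_concentration (e * n%:R) lip (ltW k0) kc) _.
rewrite ler_wpM2r// ler_pM2l// ler_expR card_prod !card_ord natrM.
have n0 := ler0n R n; have kn : 0 <= k * n%:R by rewrite mulr_ge0// ltW.
have : k * n%:R * (k * (16 * c ^+ 2 * (d%:R + 1))) <= k * n%:R * e by rewrite
  ler_wpM2l.
have : 0 <= k * n%:R * (k * (16 * c ^+ 2)).
  by rewrite mulr_ge0// mulr_ge0 ?(ltW k0)// mulr_ge0// exprn_ge0// ltW.
rewrite exprMn; lra.
Qed.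

End MeanLog.

(** * The configuration model *)

Local Open Scope classical_set_scope.
Local Open Scope ring_scope.

Section ConfigurationModel.
Context {R : realType} {dsp : measure_display} {T : measurableType dsp}.
Variables (P : probability T R) (d : nat) (G : forall n : nat, T -> multigraph n d).
Hypothesis modelG : configuration_model P G.

Lemma pairing_setE n : pairings n d = @pairing_set (half_edge n d).
Proof. by apply/finset.setP => M; rewrite pairingsE. Qed.

Lemma integral_model n (f : multigraph n d -> R) : ~~ odd (n * d) ->
  (\int[P]_w (f (G n w))%:E = (pairing_avg f)%:E)%E.
Proof.
move=> nd; have mG M := (modelG nd M).1.
have -> : (\int[P]_w (f (G n w))%:E =
    \int[P]_w (\sum_(M : multigraph n d) (f M)%:E * (\1_(G n @^-1` [set M]) w)%:E))%E.
  apply: eq_integral => w _.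
  rewrite (bigD1 (G n w))//= big1 => [|M MG]; last first.
    rewrite indicE memNset ?mule0// => /= E; by rewrite E eqxx in MG.
  by rewrite adde0 indicE mem_set// mule1.
have iG M : P.-integrable [set: T] (fun w => (\1_(G n @^-1` [set M]) w)%:E).
  exact: integrable_indic.
rewrite integral_sum//; last by move=> M; apply: integrableZl.
rewrite (eq_bigr (fun M => (f M * ((M \in pairings n d)%:R / #|pairings n
  d|%:R))%:E)).
  rewrite sumEFin; congr EFin; rewrite /pairing_avg pairing_setE mulr_suml.
  rewrite [RHS]big_mkcond; apply: eq_bigr => M _.
  by case: ifP => _; rewrite ?mul1r ?mul0r ?mulr0.
move=> M _; rewrite integralZl// integral_indic// setIT EFinM; congr (_ * _)%E.
exact: (modelG nd M).2.
Qed.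

(** No pairing is constructed: if there were none, the average of 1 would be 0 by the convention
    [x / 0 = 0], against the total mass 1 of [P]. *)
Lemma card_pairing_set_gt0 n : ~~ odd (n * d) ->
  (0 < #|@pairing_set (half_edge n d)|)%N.
Proof.
move=> nd; have := integral_model (fun=> 1) nd.
have -> : (\int[P]_w 1%:E = 1%:E :> \bar R)%E.
  by rewrite -[RHS](expectation_cst P 1) unlock.
move=> [E1]; rewrite lt0n; apply: contra_eq_neq E1 => P0.
by rewrite /pairing_avg P0 invr0 mulr0 oner_eq0.
Qed.

Lemma measurable_model n (A : pred (multigraph n d)) : ~~ odd (n * d) ->
  measurable [set w | A (G n w)].
Proof.
move=> nd; have -> : [set w | A (G n w)] = \bigcup_(M in [set M | A M]) (G n
  @^-1` [set M]).
  apply/seteqP; split => [w Aw|w [M AM /= ->]]//.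
  by exists (G n w).
apply: fin_bigcup_measurable => [|M _]; last exact: (modelG nd M).1.
exact: finite_finset.
Qed.

Lemma probability_model n (A : pred (multigraph n d)) : ~~ odd (n * d) ->
  P [set w | A (G n w)] =
  (#|[set M in @pairing_set (half_edge n d) | A M]%SET|%:R /
     #|@pairing_set (half_edge n d)|%:R)%:E.
Proof.
move=> nd; have mA := measurable_model A nd.
rewrite -[LHS]expectation_indic// unlock.
transitivity (pairing_avg (fun M => (A M)%:R : R))%:E.
  rewrite -integral_model//; apply: eq_integral => w _.
  rewrite indicE; congr (_%:R%:E); congr nat_of_bool.
  by apply/idP/idP => [/set_mem|Aw]; [|apply: mem_set].
congr EFin.
rewrite /pairing_avg -natr_sum; congr (_%:R / _).
rewrite -sum1_card big_mkcond [RHS]big_mkcond/=; apply: eq_bigr => M _.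
by rewrite !inE; case: (is_pairing M); case: (A M).
Qed.

Lemma mean_free_energyE n (beta B t : R) a : ~~ odd (n * d) -> (a <= n)%N ->
  Num.ceil (n%:R * t) = a%:Z ->
  mean_free_energy P G n beta B t =
    n%:R^-1 * (mlnz d beta n a + B * (2 * a%:R - n%:R)).
Proof.
move=> nd an at_; rewrite /mean_free_energy unlock.
rewrite (integral_model (fun M => free_energy beta B M t) nd)/=.
rewrite -(pairing_avg_const (card_pairing_set_gt0 nd) (B * _)) -pairing_avgD.
rewrite -pairing_avgZ; congr (_ / _); apply: eq_bigr => M; rewrite inE => pM.
exact: free_energyE.
Qed.

Lemma ceil_scaled n (t : R) : 0 <= t <= 1 ->
  exists2 a, (a <= n)%N & Num.ceil (n%:R * t) = a%:Z.
Proof.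
move=> /andP[t0 t1]; have nt0 : 0 <= n%:R * t by rewrite mulr_ge0.
have c0 : 0 <= Num.ceil (n%:R * t) by rewrite ceil_ge0 (lt_le_trans _ nt0).
exists `|Num.ceil (n%:R * t)|%N; last by rewrite gez0_abs.
rewrite -lez_nat gez0_abs// ceil_le_int_tmp.
by rewrite -[leRHS]mulr1 ler_wpM2l.
Qed.

End ConfigurationModel.

Section BorelCantelli.
Context {R : realType} {dsp : measure_display} {T : measurableType dsp}.
Variable P : probability T R.

Lemma borel_cantelli_geometric (A : nat -> set T) (r : R) : 0 < r ->
  (forall n, measurable (A n)) ->
  (forall n, (P (A n) <= (2 * expR (- (r * n%:R)))%:E)%E) ->
  {ae P, forall w, \forall n \near \oo, ~ A n w}.
Proof.
move=> r0 mA PA; pose q := expR (- r).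
have q0 : 0 < q := expR_gt0 _.
have q1 : `|q| < 1 by rewrite gtr0_norm// expR_lt1 oppr_lt0.
have sum_fin : (\sum_(n <oo) P (A n) < +oo)%E.
  apply: (@le_lt_trans _ _ (2 * (1 - q)^-1)%:E); last exact: ltry.
  apply: lime_le; first by apply: is_cvg_nneseries => n _ _; exact: measure_ge0.
  apply: nearW => n.
  apply: (@le_trans _ _ (\sum_(0 <= i < n) (2 * q ^+ i)%:E)%E).
    apply: lee_sum => i _; apply: le_trans (PA i) _; rewrite lee_fin.
    by rewrite /q -expRM_natl mulrN [_ * r]mulrC.
  rewrite sumEFin lee_fin; have := @geometric_le_lim R n 2 q (ler0n _ _) q0 q1.
  exact.
have null := lim_sup_set_cvg0 mA sum_fin.
have mL : measurable (lim_sup_set A).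
  by apply: bigcap_measurable => // n _; apply: bigcup_measurable.
exists (lim_sup_set A); split => // w /= nw n _.
apply: contrapT => nA; apply: nw; exists n => //= m nm Am.
by apply: nA; exists m.
Qed.

End BorelCantelli.

Section AlmostSure.
Context {R : realType} {dsp : measure_display} {T : measurableType dsp}.
Variables (P : probability T R) (d : nat) (G : forall n : nat, T -> multigraph n d).
Hypothesis modelG : configuration_model P G.

Lemma free_energy_concentration (beta B t e : R) :
  0 <= beta -> 0 < t < 1 -> 0 < e ->
  {ae P, forall w, \forall n \near \oo, ~~ odd (n * d) ->
     `|free_energy beta B (G n w) t - mean_free_energy P G n beta B t| < e}.
Proof.
move=> b0 /andP[t0 t1] e0; have [r r0 hr] := lnz_concentration d b0 e0.
have t01 : 0 <= t <= 1 by rewrite !ltW.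
have ceilt n : exists a, (a <= n)%N /\ Num.ceil (n%:R * t) = a%:Z.
  by have [a ? ?] := ceil_scaled n t01; exists a.
have [a /all_and2[an at_]] := choice ceilt.
(* Values that are not pairings count as bad, at no cost in probability; outside the bad event
   [free_energyE] is then available. *)
pose bad n (M : multigraph n d) :=
  (M \notin @pairing_set (half_edge n d)) ||
  (e * n%:R <= `|lnz M beta (a n) - mlnz d beta n (a n)|).
pose A n : set T := if odd (n * d) then set0 else [set w | bad n (G n w)].
have mA n : measurable (A n).
  by rewrite /A; case: ifPn => // nd; apply: (measurable_model modelG).
have PA n : (P (A n) <= (2 * expR (- (r * n%:R)))%:E)%E.
  rewrite /A; case: ifPn => nd.
    by rewrite measure0 lee_fin mulr_ge0 ?expR_ge0.
  rewrite (probability_model modelG)// lee_fin ler_pdivrMr; last first.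
    by rewrite ltr0n (card_pairing_set_gt0 modelG).
  apply: le_trans (hr n (a n) (an n)); rewrite ler_nat.
  apply/subset_leq_card/fintype.subsetP => M; rewrite !inE /bad => /andP[pM].
  by rewrite !inE pM.
have := borel_cantelli_geometric r0 mA PA.
apply: filterS => w [N _ hN]; exists N.+1 => // n /= Nn nd.
have := hN n (ltnW Nn); rewrite /A (negbTE nd) /bad /= => /negP.
rewrite negb_or negbK inE => /andP[pM]; rewrite -ltNge => h.
have n0 : (0 : R) < n%:R by rewrite ltr0n (leq_trans _ Nn).
rewrite (free_energyE _ _ pM (an n) (at_ n)).
rewrite (mean_free_energyE modelG _ _ nd (an n) (at_ n)).
rewrite -mulrBr opprD addrACA subrr addr0 normrM gtr0_norm ?invr_gt0//.
by rewrite mulrC ltr_pdivrMr.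
Qed.

Lemma free_energy_as_cvg (beta B t : R) : 0 <= beta -> 0 < t < 1 ->
  {ae P, forall w,
     (fun n => free_energy beta B (G n w) t - mean_free_energy P G n beta B t)
       @ within [set n : nat | ~~ odd (n * d)] \oo --> (0 : R)}.
Proof.
move=> b0 t01.
have : {ae P, forall w k, \forall n \near \oo, ~~ odd (n * d) ->
     `|free_energy beta B (G n w) t - mean_free_energy P G n beta B t| < k.+1%:R^-1}.
  by apply: ae_foralln => k; apply: free_energy_concentration; rewrite // invr_gt0.
apply: filterS => w h; apply/cvgrPdist_lt => e e0.
have [k ke] : exists k : nat, k.+1%:R^-1 < e.
  exists (Num.bound e^-1); rewrite invf_plt ?posrE ?ltr0n//.
  apply: lt_trans (archi_boundP _) _; first by rewrite invr_ge0 ltW.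
  by rewrite ltr_nat.
have [N _ hN] := h k; exists N => // n /= Nn nd.
by rewrite sub0r normrN; apply: lt_trans ke; apply: hN.
Qed.

End AlmostSure.

(** * Uniform limits along a subsequence *)

Section UltraLimit.
Context {R : realType}.

Lemma ultra_bounded_cvg (F : set_system nat) (x : nat -> R) (C : R) :
  UltraFilter F -> (forall m, `|x m| <= C) ->
  exists l : R, forall e, 0 < e -> F [set m | `|x m - l| < e].
Proof.
move=> UF xC.
have [l [_ cl]] : `[- C, C] `&` cluster (x @ F) !=set0.
  apply: segment_compact.
  by apply: (@filterE _ F) => m /=; rewrite in_itv/= -ler_norml.
exists l => e e0.
have [//|nF] := in_ultra_setVsetC [set m | `|x m - l| < e] UF.
have bl : nbhs l (ball l e) by exact: nbhsx_ballx.
have fn : (x @ F) (~` ball l e).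
  apply: (@filterS _ F _ _ _ _ nF) => m /= h bm; apply: h.
  by move: bm; rewrite /ball/= distrC.
by have [y [? ?]] := cl _ _ fn bl.
Qed.

End UltraLimit.

Section UniformSubsequence.
Context {R : realType}.
Variables (u : nat -> R -> R -> R) (D : R) (C : R -> R) (w : R -> R -> R).
Hypothesis D0 : 0 <= D.
Hypothesis w_mono : forall b x y, 0 <= b -> 0 <= x -> x <= y -> w b x <= w b y.
Hypothesis w_small : forall b e, 0 <= b -> 0 < e -> exists2 x, 0 < x & w b x < e.
Hypothesis u_bound : forall m b t, 0 <= b -> 0 <= t <= 1 -> `|u m b t| <= C b.
Hypothesis u_lip : forall m b b' t, 0 <= b -> 0 <= b' -> 0 <= t <= 1 ->
  `|u m b t - u m b' t| <= `|b - b'| * D.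
Hypothesis u_mod : forall m b s t, 0 <= b -> 0 <= s <= 1 -> 0 <= t <= 1 ->
  `|u m b t - u m b s| <= w b (`|t - s| + m.+1%:R^-1).

Lemma pointwise_limit : exists (F : set_system nat) (phi : R -> R -> R),
  [/\ UltraFilter F, \oo `<=` F &
      forall b t e, 0 <= b -> 0 <= t <= 1 -> 0 < e ->
        F [set m | `|u m b t - phi b t| < e]].
Proof.
have [F [UF ooF]] := @ultraFilterLemma nat \oo _.
have ex (bt : R * R) : exists l : R, 0 <= bt.1 -> 0 <= bt.2 <= 1 ->
    forall e, 0 < e -> F [set m | `|u m bt.1 bt.2 - l| < e].
  have [[b0 t01]|n01] := pselect (0 <= bt.1 /\ 0 <= bt.2 <= 1).
    have [l hl] := ultra_bounded_cvg UF (fun m => u_bound m b0 t01).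
    by exists l.
  by exists 0 => b0 t01; case: n01.
have [phi hphi] := choice ex.
exists F, (fun b t => phi (b, t)); split=> // b t e b0 t01 e0.
exact: (hphi (b, t)).
Qed.

Lemma near_inv_lt (e : R) : 0 < e -> exists N : nat, forall m, (N <= m)%N ->
  m.+1%:R^-1 < e.
Proof.
move=> e0; exists (Num.bound e^-1) => m Nm; rewrite invf_plt ?posrE ?ltr0n//.
apply: lt_le_trans (archi_boundP _) _; first by rewrite invr_ge0 ltW.
by rewrite ler_nat (leq_trans Nm).
Qed.

(** Step [k] controls a grid of mesh [1 / (k + 1)] in both variables, up to [b = k + 1]. Between
    grid points the Lipschitz bound in [b] and the modulus in [t], both inherited by [phi], take
    over; hence one subsequence serves every [b]. *)
Lemma uniform_subsequence : exists (mk : nat -> nat) (phi : R -> R -> R),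
  [/\ {homo mk : i j / (i < j)%N},
    forall b s t x, 0 <= b -> 0 <= s <= 1 -> 0 <= t <= 1 -> `|t - s| < x ->
      `|phi b t - phi b s| <= w b x &
    forall b e, 0 <= b -> 0 < e -> \forall k \near \oo,
      forall t, 0 <= t <= 1 -> `|u (mk k) b t - phi b t| < e].
Proof.
have [F [phi [UF ooF Fphi]]] := pointwise_limit.
have Flarge N : F [set m | (N <= m)%N] by apply: ooF; exists N.
have phi_lip b b' t : 0 <= b -> 0 <= b' -> 0 <= t <= 1 ->
    `|phi b t - phi b' t| <= `|b - b'| * D.
  move=> b0 b0' t01; apply/ler_addgt0Pr => e e0.
  have e2 : 0 < e / 2 by rewrite divr_gt0.
  have [m [/= h1 h2]] := filter_ex (filterI (Fphi b t _ b0 t01 e2) (Fphi b' t _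
    b0' t01 e2)).
  have := u_lip m b0 b0' t01; move: h1 h2.
  rewrite (_ : phi b t - phi b' t =
    (u m b t - u m b' t) - (u m b t - phi b t) + (u m b' t - phi b' t)); last by ring.
  move=> h1 h2 h3; apply: le_trans (ler_normD _ _) _.
  by have := ler_normB (u m b t - u m b' t) (u m b t - phi b t); lra.
have phi_mod b s t x : 0 <= b -> 0 <= s <= 1 -> 0 <= t <= 1 -> `|t - s| < x ->
    `|phi b t - phi b s| <= w b x.
  move=> b0 s01 t01 tsx; apply/ler_addgt0Pr => e e0.
  have e2 : 0 < e / 2 by rewrite divr_gt0.
  have [|N hN] := @near_inv_lt (x - `|t - s|); first by rewrite subr_gt0.
  have [m [[/= h1 h2] Nm]] := filter_ex (filterI (filterI (Fphi b t _ b0 t01 e2)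
    (Fphi b s _ b0 s01 e2)) (Flarge N)).
  have h3 := u_mod m b0 s01 t01.
  have h4 : w b (`|t - s| + m.+1%:R^-1) <= w b x.
    apply: w_mono; rewrite ?addr_ge0 ?invr_ge0//.
    by rewrite -lerBrDl; exact/ltW/(hN _ Nm).
  rewrite (_ : phi b t - phi b s =
    (u m b t - u m b s) - (u m b t - phi b t) + (u m b s - phi b s)); last by ring.
  apply: le_trans (ler_normD _ _) _.
  by have := ler_normB (u m b t - u m b s) (u m b t - phi b t); lra.
pose grid (K : nat) (i : nat) : R := i%:R / K.+1%:R.
have grid01 K (j : 'I_K.+2) : 0 <= grid K j <= 1.
  by rewrite divr_ge0//= ler_pdivrMr ?ltr0n// mul1r ler_nat -ltnS.
have sel K N : exists m, [/\ (N < m)%N, (K <= m)%N &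
    forall (i : 'I_(K.+1 * K.+1).+1) (j : 'I_K.+2),
      `|u m (grid K i) (grid K j) - phi (grid K i) (grid K j)| < K.+1%:R^-1].
  have fin : F [set m | forall ij : 'I_(K.+1 * K.+1).+1 * 'I_K.+2,
      `|u m (grid K ij.1) (grid K ij.2) - phi (grid K ij.1) (grid K ij.2)| <
        K.+1%:R^-1].
    apply: filter_forall => -[i j] /=; apply: Fphi; rewrite ?invr_gt0 ?ltr0n//.
    by rewrite divr_ge0.
  have [m [[/= h1 h2] h3]] := filter_ex (filterI (filterI (Flarge N.+1) (Flarge
    K)) fin).
  by exists m; split=> // i j; apply: (h3 (i, j)).
have [g hg] := choice (fun KN : nat * nat => sel KN.1 KN.2).
(* The index is taken beyond the previous one, for strict monotonicity, and at least [k], so that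
   the lattice term [1 / (m + 1)] of [u_mod] does not exceed the mesh. *)
pose mk := fix mk (k : nat) : nat := g (k, if k is k'.+1 then mk k' else 0%N).
have mkP k : (k <= mk k)%N /\ forall (i : 'I_(k.+1 * k.+1).+1) (j : 'I_k.+2),
      `|u (mk k) (grid k i) (grid k j) - phi (grid k i) (grid k j)| < k.+1%:R^-1.
  by case: k => [|k]; [have [_ ? ?] := hg (0, 0)%N|have [_ ? ?] := hg (k.+1, mk k)].
exists mk, phi; split=> //.
  apply: (@homo_ltn _ mk (fun i j => (i < j)%N)) => [j i k|i]; first exact: ltn_trans.
  by have [] := hg (i.+1, mk i).
move=> b e b0 e0; have e8 : 0 < e / 8 by rewrite divr_gt0.
have [x x0 wx] := w_small b0 e8.
have [|N1 hN1] := @near_inv_lt (x / 4); first by rewrite divr_gt0.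
have [|N2 hN2] := @near_inv_lt (e / 8 / (D + 1)); first by rewrite divr_gt0//
  ltr_wpDl.
exists (maxn (Num.truncn b).+1 (maxn N1 N2)) => // k /=.
rewrite !geq_max => /and3P[kb kN1 kN2] t t01.
have k1 := hN1 k kN1; have := hN2 k kN2.
have D1 : 0 < D + 1 by rewrite ltr_wpDl.
rewrite ltr_pdivlMr// => k2.
have K0 : (0 : R) < k.+1%:R by rewrite ltr0n.
have apx y : 0 <= y -> let i := Num.truncn (y * k.+1%:R) in
    `|y - grid k i| <= k.+1%:R^-1 /\ i%:R <= y * k.+1%:R.
  move=> y0 i; have := @truncn_itv R (y * k.+1%:R); rewrite mulr_ge0// => /(_
    isT)/andP[i1 i2].
  split=> //; rewrite /grid.
  have -> : y - i%:R / k.+1%:R = (y * k.+1%:R - i%:R) / k.+1%:R by field; rewrite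
    gt_eqF.
  rewrite normrM [`|_^-1|]gtr0_norm ?invr_gt0// -[leRHS]mul1r ler_pM2r ?invr_gt0//.
  by rewrite ger0_norm ?subr_ge0// lerBlDr; rewrite addrC natr1 ltW.
have [] := apx b b0; set ib := Num.truncn _ => bi ib_le.
have t0 : 0 <= t by case/andP: t01.
have [] := apx t t0; set jt := Num.truncn _ => tj jt_le.
have ibK : (ib < (k.+1 * k.+1).+1)%N.
  rewrite ltnS -(ler_nat R) natrM; apply: le_trans ib_le _.
  rewrite ler_pM2r//; apply: le_trans (ltW (truncnS_gt b)) _.
  by rewrite ler_nat; apply: leq_trans kb _.
have jtK : (jt < k.+2)%N.
  rewrite ltnS -(ler_nat R); apply: le_trans jt_le _.
  by rewrite ler_piMl//; case/andP: t01.
have [mkk /(_ (Ordinal ibK) (Ordinal jtK)) /= h] := mkP k.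
set bg := grid k ib in bi h; set tg := grid k jt in tj h.
have bg0 : 0 <= bg by rewrite divr_ge0.
have tg01 : 0 <= tg <= 1 by exact: (grid01 k (Ordinal jtK)).
have mi : (mk k).+1%:R^-1 <= k.+1%:R^-1 :> R.
  by rewrite lef_pV2 ?posrE ?ltr0n// ler_nat.
set K := k.+1%:R^-1 in k1 k2 bi tj h mi *.
have KK : 0 < K by rewrite invr_gt0.
have a1 : `|u (mk k) b t - u (mk k) b tg| <= w b x.
  apply: le_trans (u_mod _ b0 tg01 t01) _; apply: w_mono; rewrite // ?addr_ge0
    ?invr_ge0//.
  by apply: le_trans (lerD tj mi) _; move: k1 KK; clearbody K; lra.
have a2 : `|phi b t - phi b tg| <= w b x by apply: phi_mod => //; lra.
have a3 := u_lip (mk k) b0 bg0 tg01.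
have a4 := phi_lip b bg tg b0 bg0 tg01.
have a5 : `|b - bg| * D <= K * D by rewrite ler_wpM2r.
have KD : K * D + K < e / 8 by move: k2; rewrite mulrDr mulr1.
(* Path through a grid point: move [t], then [b], compare [u] with [phi] there, and return in [b],
   then in [t]. *)
rewrite (_ : u (mk k) b t - phi b t = (u (mk k) b t - u (mk k) b tg) +
  (u (mk k) b tg - u (mk k) bg tg) + (u (mk k) bg tg - phi bg tg) -
  (phi b tg - phi bg tg) - (phi b t - phi b tg)); last by ring.
have n1 := ler_normB ((u (mk k) b t - u (mk k) b tg) +
  (u (mk k) b tg - u (mk k) bg tg) + (u (mk k) bg tg - phi bg tg) -
  (phi b tg - phi bg tg)) (phi b t - phi b tg).
have n2 := ler_normB ((u (mk k) b t - u (mk k) b tg) +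
  (u (mk k) b tg - u (mk k) bg tg) + (u (mk k) bg tg - phi bg tg)) (phi b tg -
    phi bg tg).
have n3 := ler_normD ((u (mk k) b t - u (mk k) b tg) +
  (u (mk k) b tg - u (mk k) bg tg)) (u (mk k) bg tg - phi bg tg).
have n4 := ler_normD (u (mk k) b t - u (mk k) b tg) (u (mk k) b tg - u (mk k) bg tg).
have KDD : 0 <= K * D by rewrite mulr_ge0// ltW.
by move: n1 n2 n3 n4 a1 a2 a3 a4 a5 h wx; lra.
Qed.

End UniformSubsequence.

(** * Transfer of the bounds to the mean over pairings *)

Section MeanBounds.
Context {R : realType}.
Variables (d n : nat).
Hypothesis P0 : (0 < #|@pairing_set (half_edge n d)|)%N.

Lemma mlnz_lipschitz (beta : R) a b : 0 <= beta -> (a <= b)%N -> (b <= n)%N ->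
  `|mlnz d beta n b - mlnz d beta n a| <= beta * (2 * d%:R) * (b - a)%:R +
     8 * Num.sqrt n%:R * Num.sqrt (b - a)%:R.
Proof.
by move=> b0 ab bn; apply: norm_pairing_avgB => // M pM; apply: lnz_lipschitz.
Qed.

Lemma mlnz_beta_lipschitz (b1 b2 : R) a : (a <= n)%N ->
  `|mlnz d b1 n a - mlnz d b2 n a| <= `|b1 - b2| * (n * d)%:R.
Proof.
by move=> an; apply: norm_pairing_avgB => // M pM; apply: lnz_beta_lipschitz.
Qed.

Lemma mlnz_bound (beta : R) a : 0 <= beta -> (a <= n)%N ->
  `|mlnz d beta n a| <= (1 + beta * d%:R) * n%:R.
Proof.
move=> b0 an; have := @norm_pairing_avgB R _ P0
  (fun M : multigraph n d => lnz M beta a) (fun=> 0) ((1 + beta * d%:R) * n%:R).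
rewrite pairing_avg_const// subr0; apply=> M pM.
by rewrite subr0; apply: lnz_bound.
Qed.

Lemma mlnz_power (beta : R) a : 1 <= beta -> (a <= n)%N ->
  mlnz d beta n a <= beta * mlnz d 1 n a.
Proof.
move=> b1 an; rewrite /mlnz -pairing_avgZ; apply: le_pairing_avg => M pM.
exact: lnz_power.
Qed.

Lemma mlnz0_ge (beta : R) : beta * (n * d)%:R / 2 <= mlnz d beta n 0.
Proof.
rewrite -[leLHS](pairing_avg_const P0); apply: le_pairing_avg => M pM.
exact: lnz0_ge.
Qed.

End MeanBounds.

Section MeanGap.
Context {R : realType}.
Variable d : nat.

Lemma mlnz_drop (beta : R) : (0 < d)%N -> 0 < beta ->
  exists2 eta, 0 < eta & forall n a b, (0 < #|@pairing_set (half_edge n d)|)%N ->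
    (a <= b)%N -> (2 * b <= n)%N ->
    mlnz d beta n a - mlnz d beta n b <= (beta * (2 * d%:R) - eta) * (b - a)%:R.
Proof.
move=> d0 b0; have [eta eta0 h] := lnz_drop d0 b0.
exists eta => // n a b P0 ab bn.
rewrite /mlnz -mulN1r -pairing_avgZ -pairing_avgD -[leRHS](pairing_avg_const P0).
by apply: le_pairing_avg => M pM; rewrite mulN1r; apply: h.
Qed.

Lemma ln_small (D : nat) (e : R) : 0 < e ->
  exists N, forall n, (N <= n)%N -> ln (n * D).+1%:R <= e * n%:R.
Proof.
move=> e0; have e2 : 0 < e ^+ 2 by rewrite exprn_gt0.
exists (Num.bound (4 * D.+1%:R / e ^+ 2)).+1 => n Nn.
have n0 : (0 < n)%N by apply: leq_trans Nn.
apply: le_trans (ln_le_sqrt _) _; first by rewrite ltr0n.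
have en : 0 <= e * n%:R / 2 by rewrite divr_ge0// mulr_ge0// ltW.
suff : Num.sqrt (n * D).+1%:R <= e * n%:R / 2 by lra.
rewrite -(ger0_norm en) -sqrtr_sqr ler_wsqrtr//.
apply: (@le_trans _ _ (n%:R * D.+1%:R)).
  by rewrite -natrM ler_nat mulnS; lia.
have h : 4 * D.+1%:R <= e ^+ 2 * n%:R.
  suff : 4 * D.+1%:R / e ^+ 2 <= n%:R by rewrite ler_pdivrMr// [_ * e ^+ 2]mulrC.
  apply: le_trans (ltW (archi_boundP _)) _; first by rewrite divr_ge0 ?ltW.
  by rewrite ler_nat; apply: leq_trans Nn.
have nR : (0 : R) <= n%:R by [].
have := ler_wpM2l nR h; set x := n%:R; set y := D.+1%:R => h2.
rewrite (_ : (e * x / 2) ^+ 2 = x * (e ^+ 2 * x) / 4); last by field.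
by rewrite ler_pdivlMr//; lra.
Qed.

(** The count given by [lnz_ge_Bethe] varies with the pairing. By a union bound over the [n + 1]
    counts, some pairing is close to the mean at all of them, so its own count can be used for the
    mean. *)
Lemma mlnz_ge_Bethe (beta Q e : R) : 0 <= beta -> 0 < e ->
  (forall n (M : multigraph n d), is_pairing M ->
     expR (n%:R * Q) <= \sum_(s : configuration n) expR (beta * energy (hspin s)
       M)) ->
  exists N, forall n, (N <= n)%N -> (0 < #|@pairing_set (half_edge n d)|)%N ->
    exists2 a, (2 * a <= n)%N & n%:R * (Q - e) <= mlnz d beta n a.
Proof.
move=> b0 e0 hQ; have e2 : 0 < e / 2 by rewrite divr_gt0.
have [r r0 hr] := lnz_concentration d b0 e2.
have [N1 hN1] := @ln_small 1 (e / 2) e2.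
(* [8 / r ^ 2 <= n] makes [1 + (r n)^2 / 2], a lower bound of [expR (r n)], exceed [2 (n + 1)], so
   the union bound is below 1. *)
exists (maxn N1 (Num.bound (8 / r ^+ 2)).+1) => n; rewrite geq_max => /andP[n1 n2] P0.
have [M pM Mgood] : exists2 M : multigraph n d, is_pairing M &
    forall a, (a <= n)%N -> `|lnz M beta a - mlnz d beta n a| < e / 2 * n%:R.
  apply: contrapT => nM.
  pose bad (a : 'I_n.+1) := [set M in @pairing_set (half_edge n d) |
        e / 2 * n%:R <= `|lnz M beta a - mlnz d beta n a|]%SET.
  have PR : (0 : R) < #|@pairing_set (half_edge n d)|%:R by rewrite ltr0n.
  have cover_bad : #|@pairing_set (half_edge n d)|%:R <= \sum_(a < n.+1) #|bad
    a|%:R :> R.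
    rewrite -sum1_card natr_sum.
    apply: (@le_trans _ _ (\sum_(M in @pairing_set (half_edge n d))
        \sum_(a < n.+1) (M \in bad a)%:R)).
      apply: ler_sum => M; rewrite inE => pM.
      have [a an Ma] : exists2 a, (a <= n)%N &
          e / 2 * n%:R <= `|lnz M beta a - mlnz d beta n a|.
        apply: contrapT => na; apply: nM; exists M => // a an.
        by rewrite ltNge; apply/negP => h; apply: na; exists a.
      have an' : (a < n.+1)%N by [].
      rewrite (bigD1 (Ordinal an'))//= !inE pM Ma lerDl.
      by apply: sumr_ge0.
    rewrite exchange_big/=; apply: ler_sum => a _.
    rewrite -natr_sum ler_nat -sum1_card big_mkcond [leqRHS]big_mkcond/=.
    by apply: leq_sum => M _; rewrite !inE; case: (is_pairing M).
  have : #|@pairing_set (half_edge n d)|%:R <=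
      n.+1%:R * (2 * expR (- (r * n%:R)) * #|@pairing_set (half_edge n d)|%:R) :> R.
    apply: le_trans cover_bad _; rewrite mulr_natl -[n.+1 in leRHS]card_ord
      -sumr_const.
    by apply: ler_sum => a _; apply: hr; rewrite -ltnS.
  rewrite mulrA -[leLHS]mul1r ler_pM2r// mulrA expRN ler_pdivlMr ?expR_gt0// mul1r.
  apply/negP; rewrite -ltNge.
  have rn0 : 0 <= r * n%:R by rewrite mulr_ge0// ltW.
  have n1R : (1 : R) <= n%:R by rewrite ler1n (leq_trans _ n2).
  have r2 : 8 <= r ^+ 2 * n%:R.
    suff : 8 / r ^+ 2 <= n%:R by rewrite ler_pdivrMr ?exprn_gt0// [_ * r ^+ 2]mulrC.
    apply: le_trans (ltW (archi_boundP _)) _; first by rewrite divr_ge0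
      ?exprn_ge0 ?ltW.
    by rewrite ler_nat; apply: leq_trans n2.
  apply: lt_le_trans (expR_ge1Dxn 1 rn0); rewrite -natr1 /=.
  have : n%:R * 8 <= n%:R * (r ^+ 2 * n%:R) by rewrite ler_wpM2l.
  rewrite (_ : 2`! = 2)%N// exprMn; move: n1R; set x := n%:R; lra.
have [a a2 ha] := lnz_ge_Bethe pM (hQ n M pM).
exists a => //; have := Mgood a; have := hN1 n n1; rewrite muln1 => hl /(_ _)/wrap[].
  by lia.
rewrite ltr_norml => /andP[_ h]; move: ha h hl; set x := n%:R; lra.
Qed.

End MeanGap.

(** * The limit function and its critical field *)

Section Limit.
Context {R : realType} {dsp : measure_display} {T : measurableType dsp}.
Variables (P : probability T R) (d : nat) (G : forall n : nat, T -> multigraph n d).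
Hypothesis modelG : configuration_model P G.

Lemma ceil_scaled_itv n (t : R) : 0 <= t <= 1 ->
  exists a, [/\ (a <= n)%N, Num.ceil (n%:R * t) = a%:Z,
    n%:R * t <= a%:R & a%:R < n%:R * t + 1].
Proof.
move=> t01; have [a an at_] := ceil_scaled n t01; exists a; split=> //.
  by have /andP[_] := ceil_itv (n%:R * t); rewrite at_.
by have /andP[+ _] := ceil_itv (n%:R * t); rewrite at_ intrD ltrBlDr.
Qed.

(** An even number of vertices makes [n d] even for every [d] and puts [t = 1 / 2] on the lattice,
    with exactly half of the spins plus. The successor excludes [n = 0]. *)
Definition even_energy (m : nat) (b t : R) : R :=
  mean_free_energy P G (2 * m.+1) b 0 t.

Lemma even_double m : ~~ odd (2 * m.+1 * d).
Proof. by rewrite !oddM. Qed.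

Let P0 m : (0 < #|@pairing_set (half_edge (2 * m.+1) d)|)%N.
Proof. exact: (card_pairing_set_gt0 modelG (even_double m)). Qed.

Let n0 m : (0 : R) < (2 * m.+1)%:R.
Proof. by rewrite ltr0n. Qed.

Lemma even_energyE m (b t : R) a : (a <= 2 * m.+1)%N ->
  Num.ceil ((2 * m.+1)%:R * t) = a%:Z ->
  even_energy m b t = mlnz d b (2 * m.+1) a / (2 * m.+1)%:R.
Proof.
move=> an at_; rewrite /even_energy (mean_free_energyE modelG _ _ (even_double m)
  an at_).
by rewrite mul0r addr0 mulrC.
Qed.

Lemma mean_free_energy_field m (b B t : R) : 0 <= t <= 1 ->
  `|mean_free_energy P G (2 * m.+1) b B t - (even_energy m b t + B * (2 * t - 1))| <=
    2 * `|B| / (2 * m.+1)%:R.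
Proof.
move=> t01; have [a [an at_ a1 a2]] := ceil_scaled_itv (2 * m.+1) t01.
rewrite (even_energyE _ an at_) (mean_free_energyE modelG _ _ (even_double m) an at_).
move: a1 a2; have := n0 m; set n := (2 * m.+1)%:R => np a1 a2.
rewrite (_ : _ - _ = 2 * B * (a%:R - n * t) / n); last by field; rewrite gt_eqF.
rewrite normrM [`|n^-1|]gtr0_norm ?invr_gt0// ler_pM2r ?invr_gt0//.
rewrite !normrM [`|2|]gtr0_norm// ler_piMr ?mulr_ge0//.
by rewrite ger0_norm; lra.
Qed.

(** This is the bound of [lnz_lipschitz] divided by [n], with [x] for the difference of the counts
    over [n]. *)
Definition energy_modulus (b x : R) : R := b * (2 * d%:R) * x + 8 * Num.sqrt x.

Lemma energy_modulus_mono b x y : 0 <= b -> 0 <= x -> x <= y ->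
  energy_modulus b x <= energy_modulus b y.
Proof.
move=> b0 x0 xy; apply: lerD.
  by rewrite ler_wpM2l// !mulr_ge0.
by rewrite ler_pM2l// ler_wsqrtr.
Qed.

Lemma energy_modulus_small b e : 0 <= b -> 0 < e ->
  exists2 x, 0 < x & energy_modulus b x < e.
Proof.
move=> b0 e0; pose D := b * (2 * d%:R) + 8.
have D0 : 8 <= D by rewrite lerDr !mulr_ge0.
pose y := Num.min 1 (e / (D + 1)).
have D1 : 0 < D + 1 by lra.
have y0 : 0 < y by rewrite lt_min ltr01 divr_gt0.
have y1 : y <= 1 by rewrite ge_min lexx.
have yD : y * (D + 1) <= e by rewrite -ler_pdivlMr// ge_min lexx orbT.
exists (y ^+ 2); first by rewrite exprn_gt0.
rewrite /energy_modulus sqrtr_sqr gtr0_norm//.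
have bd : 0 <= b * (2 * d%:R) by rewrite !mulr_ge0.
have : b * (2 * d%:R) * y ^+ 2 <= b * (2 * d%:R) * y.
  by rewrite ler_wpM2l// expr2 ler_piMr// ltW.
by move: yD; rewrite /D; set c := b * _; nra.
Qed.

Lemma even_energy_bound m b t : 0 <= b -> 0 <= t <= 1 ->
  `|even_energy m b t| <= 1 + b * d%:R.
Proof.
move=> b0 t01; have [a [an at_ _ _]] := ceil_scaled_itv (2 * m.+1) t01.
rewrite (even_energyE _ an at_) normrM [`|_^-1|]gtr0_norm ?invr_gt0//.
by rewrite ler_pdivrMr//; apply: (mlnz_bound (P0 m)).
Qed.

Lemma even_energy_lip m b b' t : 0 <= b -> 0 <= b' -> 0 <= t <= 1 ->
  `|even_energy m b t - even_energy m b' t| <= `|b - b'| * d%:R.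
Proof.
move=> b0 b0' t01; have [a [an at_ _ _]] := ceil_scaled_itv (2 * m.+1) t01.
rewrite !(even_energyE _ an at_) -mulrBl normrM [`|_^-1|]gtr0_norm ?invr_gt0//.
rewrite ler_pdivrMr//; apply: le_trans (mlnz_beta_lipschitz (P0 m) b b' an) _.
by rewrite natrM -mulrA [d%:R * _]mulrC.
Qed.

Lemma mlnz_scaled m b a c (x : R) : 0 <= b -> (a <= c)%N -> (c <= 2 * m.+1)%N ->
  (c - a)%:R <= x * (2 * m.+1)%:R -> 0 <= x ->
  `|mlnz d b (2 * m.+1) c / (2 * m.+1)%:R - mlnz d b (2 * m.+1) a / (2 * m.+1)%:R|
    <= energy_modulus b x.
Proof.
move=> b0 ac cn cax x0.
rewrite -mulrBl normrM [`|_^-1|]gtr0_norm ?invr_gt0// ler_pdivrMr//.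
apply: le_trans (mlnz_lipschitz (P0 m) b0 ac cn) _.
have := n0 m; set n := (2 * m.+1)%:R in cax * => np.
rewrite /energy_modulus [leRHS]mulrDl; apply: lerD.
  by rewrite -[leRHS]mulrA ler_wpM2l// !mulr_ge0.
rewrite -!mulrA ler_pM2l// (_ : Num.sqrt x * n = Num.sqrt n * Num.sqrt (x * n)).
  by rewrite ler_wpM2l ?sqrtr_ge0// ler_wsqrtr.
by rewrite sqrtrM// mulrCA -expr2 sqr_sqrtr// ltW.
Qed.

Lemma ceil_diff n (s t : R) a c : s <= t ->
  Num.ceil (n%:R * s) = a%:Z -> Num.ceil (n%:R * t) = c%:Z ->
  (a <= c)%N /\ (c - a)%:R <= n%:R * (t - s) + 1.
Proof.
move=> st as_ ct.
have ac : (a <= c)%N by rewrite -lez_nat -as_ -ct le_ceil// ler_wpM2l.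
split=> //; rewrite natrB//.
have /andP[_] := ceil_itv (n%:R * s); rewrite as_ => h1.
have /andP[+ _] := ceil_itv (n%:R * t); rewrite ct intrD ltrBlDr => h2.
by move: h1 h2; rewrite /= mulrBr; lra.
Qed.

Lemma even_energy_mod m b s t : 0 <= b -> 0 <= s <= 1 -> 0 <= t <= 1 ->
  `|even_energy m b t - even_energy m b s| <= energy_modulus b (`|t - s| +
    m.+1%:R^-1).
Proof.
move=> b0; wlog st : s t / s <= t => [wl|] s01 t01.
  have /orP[st|ts] := le_total s t; first exact: wl.
  by rewrite distrC [`|t - s|]distrC; apply: wl.
have [a [an as_ _ _]] := ceil_scaled_itv (2 * m.+1) s01.
have [c [cn ct _ _]] := ceil_scaled_itv (2 * m.+1) t01.
rewrite (even_energyE _ an as_) (even_energyE _ cn ct).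
have [ac h] := ceil_diff st as_ ct.
apply: mlnz_scaled; rewrite ?addr_ge0 ?invr_ge0 //.
apply: le_trans h _; rewrite ger0_norm ?subr_ge0// mulrDl mulrC lerD2l.
by rewrite natrM mulrCA mulVf ?pnatr_eq0// mulr1 ler1n.
Qed.

Variables (mk : nat -> nat) (phi : R -> R -> R).
Hypothesis mk_inc : {homo mk : i j / (i < j)%N}.
Hypothesis phi_mod : forall b s t x, 0 <= b -> 0 <= s <= 1 -> 0 <= t <= 1 ->
  `|t - s| < x -> `|phi b t - phi b s| <= energy_modulus b x.
Hypothesis phi_lim : forall b e, 0 <= b -> 0 < e -> \forall k \near \oo,
  forall t, 0 <= t <= 1 -> `|even_energy (mk k) b t - phi b t| < e.

Lemma mk_ge k : (k <= mk k)%N.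
Proof.
elim: k => // k IH; apply: leq_ltn_trans IH _; exact: mk_inc.
Qed.

Lemma phi_approx (b e : R) N : 0 <= b -> 0 < e -> exists2 m, (N <= m)%N &
  forall t, 0 <= t <= 1 -> `|even_energy m b t - phi b t| < e.
Proof.
move=> b0 e0; have [K _ hK] := phi_lim b0 e0.
exists (mk (maxn K N)); first exact: leq_trans (leq_maxr _ _) (mk_ge _).
by apply: hK => /=; apply: leq_maxl.
Qed.

Lemma half01 : 0 <= (1 / 2 : R) <= 1.
Proof. by apply/andP; split; lra. Qed.

Lemma ceil_half m : Num.ceil ((2 * m.+1)%:R * (1 / 2) : R) = m.+1%:Z.
Proof.
rewrite natrM (_ : 2 * _ * _ = (m.+1%:Z)%:~R :> R); last by rewrite -pmulrn; field.
exact: (intrKceil (m.+1%:Z)).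
Qed.

Lemma phi_half_le (b : R) : 0 <= b -> phi b (1 / 2) <= ln 2 + d%:R / 2 * ln (ch b).
Proof.
move=> b0; apply/ler_addgt0Pr => e e0; have e2 : 0 < e / 2 by rewrite divr_gt0.
have [N hN] := @ln_small R d (e / 2) e2.
have [m Nm /(_ (1 / 2) half01)] := phi_approx N b0 e2.
rewrite (even_energyE _ _ (ceil_half m)); last by lia.
have := mlnz_half_le b0 (P0 m).
have := hN (2 * m.+1)%N _; move=> /(_ ltac:(lia)).
rewrite [(m.+1 * d)%:R](_ : _ = (2 * m.+1)%:R * (d%:R / 2)); last by rewrite
  !natrM; field.
have := n0 m; set n := (2 * m.+1)%:R => np h1 h2.
rewrite ltr_norml => /andP[h3 _].
have h4 : mlnz d b (2 * m.+1) m.+1 / n <= ln 2 + e / 2 + d%:R / 2 * ln (ch b).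
  rewrite ler_pdivrMr//; apply: le_trans h2 _; move: h1.
  set l := ln _; set q := ln 2; set p := ln (ch b); nra.
move: h3 h4; set X := _ / n; set Y := phi _ _; set Z := d%:R / 2 * _; set W := ln
  2. lra.
Qed.

Lemma ceil0_nat n : Num.ceil (n%:R * 0 : R) = 0%N%:Z.
Proof. by rewrite mulr0 ceil0. Qed.

Lemma phi_zero_ge (b : R) : 0 <= b -> b * d%:R / 2 <= phi b 0.
Proof.
move=> b0; apply/ler_addgt0Pr => e e0.
have [m _ /(_ 0 _)] := phi_approx 0 b0 e0; rewrite lexx ler01 => /(_ isT).
rewrite (even_energyE _ _ (ceil0_nat _))// ltr_norml => /andP[_ h].
have h2 : b * d%:R / 2 <= mlnz d b (2 * m.+1) 0 / (2 * m.+1)%:R.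
  rewrite ler_pdivlMr//; apply: le_trans (mlnz0_ge (P0 m) b).
  by rewrite natrM le_eqVlt; apply/orP; left; apply/eqP; ring.
move: h h2; set X := _ / (2 * _)%:R; set Y := phi _ _; set Z := _ / 2; lra.
Qed.

Lemma phi_power (b : R) : 1 <= b -> phi b (1 / 2) <= b * phi 1 (1 / 2).
Proof.
move=> b1; have b0 : 0 <= b by apply: le_trans b1.
apply/ler_addgt0Pr => e e0; pose e' := e / (b + 1).
have bb : 0 < b + 1 by rewrite ltr_wpDl.
have e'0 : 0 < e' by rewrite divr_gt0.
have [K1 _ h1] := phi_lim b0 e'0; have [K2 _ h2] := phi_lim ler01 e'0.
(* Both limits are taken at the same index, as the inequality compares two temperatures at the same
   size. *)
pose k := maxn K1 K2; have {}h1 := h1 k (leq_maxl _ _) _ half01.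
have {}h2 := h2 k (leq_maxr _ _) _ half01; move: h1 h2; set m := mk k.
have m2 : (m.+1 <= 2 * m.+1)%N by lia.
rewrite !(even_energyE _ m2 (ceil_half m)).
have h3 : mlnz d b (2 * m.+1) m.+1 / (2 * m.+1)%:R <=
    b * (mlnz d 1 (2 * m.+1) m.+1 / (2 * m.+1)%:R).
  rewrite mulrA ler_pM2r ?invr_gt0//; exact: mlnz_power.
move: h3; set X := mlnz d b _ _ / _; set Y := mlnz d 1 _ _ / _.
set Z := phi b _; set W := phi 1 _ => h3.
rewrite !ltr_norml => /andP[h4 _] /andP[_ h5].
have h6 : b * (Y - W) <= b * e' by rewrite ler_wpM2l// ltW.
have h7 : b * e' + e' = e by rewrite /e'; field; rewrite gt_eqF.
by move: h3 h4 h6 h7; rewrite mulrBr; lra.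
Qed.

Lemma phi_drop (b : R) : (0 < d)%N -> 0 < b -> exists2 eta, 0 < eta &
  forall s t, 0 < s -> s < t -> t < 1 / 2 ->
    phi b s - phi b t <= (b * (2 * d%:R) - eta) * (t - s).
Proof.
move=> d0 b0; have [eta eta0 h] := @mlnz_drop R d b d0 b0.
have bd : 0 < b * (2 * d%:R) by rewrite !mulr_gt0 ?ltr0n.
(* Capping [eta] keeps the slope [K] nonnegative, so that it can multiply the upper bound on
   [c - a], to which rounding adds 1. *)
pose eta' := Num.min eta (b * (2 * d%:R)); exists eta'.
  by rewrite lt_min eta0.
move=> s t s0 st t2.
have eK : eta' <= eta by rewrite ge_min lexx.
pose K := b * (2 * d%:R) - eta'.
have K0 : 0 <= K by rewrite subr_ge0 ge_min lexx orbT.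
apply/ler_addgt0Pr => e e0; have e3 : 0 < e / 3 by rewrite divr_gt0.
have [|N hN] := @near_inv_lt R (e / 3 / (K + 1)).
  by rewrite divr_gt0// ltr_wpDl.
have [m Nm hm] := phi_approx N (ltW b0) e3.
have s01 : 0 <= s <= 1 by apply/andP; split; lra.
have t01 : 0 <= t <= 1 by apply/andP; split; lra.
have := hm s s01; have := hm t t01.
have [a [an as_ _ _]] := ceil_scaled_itv (2 * m.+1) s01.
have [c [cn ct _ c1]] := ceil_scaled_itv (2 * m.+1) t01.
rewrite (even_energyE _ an as_) (even_energyE _ cn ct).
have [ac hc] := ceil_diff (ltW st) as_ ct.
have c2 : (2 * c <= 2 * m.+1)%N.
  rewrite leq_pmul2l// -ltnS -(ltr_nat R).
  have : (2 * m.+1)%:R * t <= m.+1%:R.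
    have -> : m.+1%:R = (2 * m.+1)%:R * (1 / 2) :> R by rewrite natrM; field.
    by rewrite ler_pM2l// ltW.
  rewrite -[m.+2%:R]natr1; move: c1; lra.
have := h (2 * m.+1)%N a c (P0 m) ac c2.
have := hN m Nm; rewrite ltr_pdivlMr ?ltr_wpDl// => hK.
have n1 : (2 * m.+1)%:R^-1 <= m.+1%:R^-1 :> R.
  have m2 : (m.+1 <= 2 * m.+1)%N by rewrite leq_pmull.
  by rewrite lef_pV2 ?ler_nat// posrE ?n0 ?ltr0n.
have ni : 0 < (2 * m.+1)%:R^-1 :> R by rewrite invr_gt0.
have := mulVf (lt0r_neq0 (n0 m)).
move: n1 ni hc; set i := (2 * m.+1)%:R^-1; set n := (2 * m.+1)%:R.
set X := mlnz _ _ _ a; set Y := mlnz _ _ _ c => n1 ni hc nn hXY.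
rewrite !ltr_norml => /andP[_ h4] /andP[h5 _].
have q0 : (0 : R) <= (c - a)%:R by [].
have k1 : (X - Y) * i <= K * ((t - s) + i).
  apply: (@le_trans _ _ ((b * (2 * d%:R) - eta) * (c - a)%:R * i)).
    by rewrite ler_pM2r.
  apply: (@le_trans _ _ (K * ((c - a)%:R * i))).
    rewrite [leRHS]mulrA; apply: ler_wpM2r; first exact: ltW.
    by apply: ler_wpM2r => //; rewrite /K; lra.
  rewrite ler_wpM2l//.
  have : (c - a)%:R * i <= (n * (t - s) + 1) * i by rewrite ler_wpM2r// ltW.
  by rewrite mulrDl mul1r mulrAC [n * i]mulrC nn mul1r.
have k2 : K * i <= e / 3.
  have := ler_wpM2l K0 n1; move: hK.
  have : 0 <= m.+1%:R^-1 :> R by rewrite invr_ge0.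
  by set j := m.+1%:R^-1; lra.
rewrite -/K; move: k1 h4 h5; rewrite mulrDr mulrBl.
by set u := X * i; set v := Y * i; set p := phi b s; set q := phi b t; lra.
Qed.

Lemma phi_Bethe (b Q e : R) : 0 <= b -> 0 < e ->
  (forall n (M : multigraph n d), is_pairing M ->
     expR (n%:R * Q) <= \sum_(s : configuration n) expR (b * energy (hspin s) M)) ->
  exists2 t0, 0 <= t0 <= 1 / 2 & Q - e <= phi b t0.
Proof.
move=> b0 e0 hQ; have e2 : 0 < e / 2 by rewrite divr_gt0.
have [N hN] := mlnz_ge_Bethe b0 e2 hQ.
have [m Nm hm] := phi_approx N b0 e2.
have [|a a2 ha] := hN (2 * m.+1)%N _ (P0 m); first by lia.
(* A lattice point, so that rounding [n t0] gives back [a] itself. *)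
pose t0 : R := a%:R / (2 * m.+1)%:R.
have t02 : 0 <= t0 <= 1 / 2.
  rewrite /t0 divr_ge0//= ler_pdivrMr// natrM.
  have : a%:R <= m.+1%:R :> R by rewrite ler_nat; lia.
  by lra.
have t01 : 0 <= t0 <= 1 by case/andP: t02 => ? ?; apply/andP; split; lra.
exists t0 => //.
have cl : Num.ceil ((2 * m.+1)%:R * t0) = a%:Z.
  rewrite /t0 mulrCA mulfV ?gt_eqF// mulr1; exact: (intrKceil a%:Z).
have := hm t0 t01; rewrite (even_energyE _ _ cl); last by lia.
rewrite ltr_norml => /andP[_ h1].
have h2 : Q - e / 2 <= mlnz d b (2 * m.+1) a / (2 * m.+1)%:R.
  by rewrite ler_pdivlMr// mulrC.
move: h1 h2; set X := _ / (2 * _)%:R; set Y := phi _ _; lra.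
Qed.

(** Since [2 (t - s) <= 1], the quotient is at least the drop of [phi] from [s] to [t]. The points 0
    and [1 / 2] are excluded from the supremum, so continuity is used to move both ends inwards
    without using up the strict margin over [delta]. *)
Lemma B_c_ge (b t0 delta : R) (f : R -> R) : 0 <= b -> f =1 phi b ->
  0 <= t0 < 1 / 2 -> 0 < delta -> delta < phi b t0 - phi b (1 / 2) ->
  (delta%:E <= B_c f)%E.
Proof.
move=> b0 fphi /andP[t00 t02] delta0 hd.
pose g := phi b t0 - phi b (1 / 2) - delta; have g0 : 0 < g by rewrite subr_gt0.
have [|x x0 wx] := @energy_modulus_small b (g / 2) b0; first by rewrite divr_gt0.
pose y := Num.min x (1 / 2 - t0) / 4.
have y0 : 0 < y by rewrite divr_gt0// lt_min x0 subr_gt0.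
have yx : y < x.
  have : Num.min x (1 / 2 - t0) <= x by rewrite ge_min lexx.
  by rewrite /y; lra.
have yt : 4 * y <= 1 / 2 - t0.
  have : Num.min x (1 / 2 - t0) <= 1 / 2 - t0 by rewrite ge_min lexx orbT.
  by rewrite /y; lra.
pose s := t0 + y; pose t := 1 / 2 - y.
have s01 : 0 <= s <= 1 by apply/andP; rewrite /s; split; lra.
have t01 : 0 <= t <= 1 by apply/andP; rewrite /t; split; lra.
have t0_01 : 0 <= t0 <= 1 by apply/andP; split; lra.
have h1 : `|phi b s - phi b t0| <= energy_modulus b x.
  by apply: phi_mod => //; rewrite /s addrAC subrr add0r gtr0_norm.
have h2 : `|phi b (1 / 2) - phi b t| <= energy_modulus b x.
  by apply: phi_mod => //; rewrite ?half01// /t opprB addrCA subrr addr0 gtr0_norm.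
have st : s < t by rewrite /s /t; lra.
have num : delta < phi b s - phi b t.
  move: h1 h2 wx; rewrite !ler_norml /g => /andP[h1 _] /andP[h2 _].
  by move: hd h1 h2; set A := phi b s; set B := phi b t0; set C := phi b (1 / 2);
    set D := phi b t; set w := energy_modulus b x; lra.
apply: (@le_trans _ _ ((f s - f t) / (2 * (t - s)))%:E).
  rewrite lee_fin !fphi ler_pdivlMr; last by rewrite mulr_gt0// subr_gt0.
  apply: le_trans (ltW num); rewrite -[leRHS]mulr1 ler_pM2l//.
  by rewrite /s /t; lra.
apply: ereal_sup_ubound; exists s, t; split=> //.
  by rewrite ltr_wpDl.
by rewrite ltrBlDr ltrDl.
Qed.

(** The [eta] of [phi_drop] is uniform in [s] and [t], which keeps the supremum itself, and not only
    each quotient, away from [b d]. *)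
Lemma B_c_lt (b : R) (f : R -> R) : (0 < d)%N -> 0 < b -> f =1 phi b ->
  (B_c f < (b * d%:R)%:E)%E.
Proof.
move=> d0 b0 fphi; have [eta eta0 h] := phi_drop d0 b0.
apply: (@le_lt_trans _ _ (b * d%:R - eta / 2)%:E); last by rewrite lte_fin; lra.
apply: ub_ereal_sup => _ [s [t [s0 st t2 ->]]].
rewrite lee_fin !fphi ler_pdivrMr; last by rewrite mulr_gt0// subr_gt0.
by apply: le_trans (h s t s0 st t2) _; lra.
Qed.

End Limit.

(** The tightest case is [d = 3]. As [ln (ch 1) = 1 + ln (1 + e^-2) - ln 2], rough bounds on [ln 2]
    and [e^-2] suffice; they come from raising [1 + x <= expR x] to a power. *)
Lemma half_energy_gap {R : realType} (d : nat) : (3 <= d)%N ->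
  ln 2 + d%:R / 2 * ln (ch (1 : R)) < d%:R / 2.
Proof.
move=> d3; have d3R : 3 <= d%:R :> R by rewrite ler_nat.
have e2 : expR (- 2) < 1 / 6 :> R.
  have e15 : 6 / 5 <= expR (1 / 5) :> R by have := @expR_ge1Dx R (1 / 5); lra.
  have : 6 < expR 2 :> R.
    have -> : expR 2 = expR (1 / 5 : R) ^+ 10 by rewrite -expRM_natl; congr expR;
      field.
    apply: lt_le_trans (_ : (6 / 5) ^+ 10 <= _); first by lra.
    by apply: lerXn2r; rewrite ?nnegrE ?expR_ge0//; lra.
  by have := expR_mulN (2 : R); have := expR_gt0 (- 2 : R); nra.
have l2 : 3 / 5 < ln 2 :> R.
  rewrite -ltr_expR lnK ?posrE//.
  have e1 : 9 / 10 <= expR (- (1 / 10)) :> R by have := @expR_ge1Dx R (- (1 /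
    10)); lra.
  have : 1 / 2 < expR (- (3 / 5)) :> R.
    have -> : expR (- (3 / 5)) = expR (- (1 / 10) : R) ^+ 6.
      by rewrite -expRM_natl; congr expR; field.
    apply: lt_le_trans (_ : (9 / 10) ^+ 6 <= _); first by lra.
    by apply: lerXn2r; rewrite ?nnegrE ?expR_ge0//; lra.
  by have := expR_mulN (3 / 5 : R); have := expR_gt0 (3 / 5 : R); nra.
have lc : ln (ch (1 : R)) <= 1 + expR (- 2) - ln 2.
  have -> : ch (1 : R) = expR 1 * (1 + expR (- 2)) / 2.
    by rewrite /ch mulrDr mulr1 -expRD; congr ((_ + expR _) / _); field.
  have p : 0 < 1 + expR (- 2 : R) by rewrite ltr_wpDl// expR_gt0.
  rewrite ln_div ?posrE ?mulr_gt0 ?expR_gt0// lnM ?posrE ?expR_gt0// expRK.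
  by rewrite lerD2r lerD2l le_ln1Dx//; have := expR_gt0 (- 2 : R); lra.
nra.
Qed.

Lemma uniform_cvgP {R : realType} (K : set R) (u : nat -> R -> R) (f : R -> R) :
  (forall e, 0 < e -> \forall k \near \oo, forall t, K t -> `|u k t - f t| < e) ->
  {uniform K, u @ \oo --> f}.
Proof.
move=> h A /uniform_nbhs[E [entE EA]].
move: entE; rewrite -entourage_ballE => -[e /= e0 eE].
apply: filterS (h e e0) => k hk; apply: EA => t Kt; apply: eE.
by rewrite /= /ball /= distrC; apply: hk.
Qed.

Unset Implicit Arguments.
Set Strict Implicit.

Theorem proposition1p3 (R : realType) (dsp : measure_display)
    (T : measurableType dsp) (P : probability T R) (d : nat)
    (G : forall n : nat, T -> multigraph n d) :
  (3 <= d)%N -> configuration_model P G ->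
  (forall beta B t : R, 0 <= beta -> 0 <= B -> 0 < t -> t < 1 ->
     {ae P, forall w,
       (fun n => free_energy beta B (G n w) t - mean_free_energy P G n beta B t)
         @ within [set n : nat | ~~ odd (n * d)] \oo --> (0 : R)}) /\
  (exists (nk : nat -> nat) (phi : R -> R -> R -> R),
     [/\ {homo nk : i j / (i < j)%N},
         forall k, (0 < nk k)%N /\ ~~ odd (nk k * d),
         forall beta B : R, 0 <= beta -> 0 <= B ->
           [/\ forall K : set R, compact K -> K `<=` `[0, 1] ->
                 {uniform K, (fun k => mean_free_energy P G (nk k) beta B) @ \oo
                               --> phi beta B},
               {within `[0, 1], continuous (phi beta B)} &
               forall t : R, 0 <= t <= 1 ->
                 phi beta B t = phi beta 0 t + B * (2 * t - 1)],
         forall beta : R, beta_c R d < beta ->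
           (0 < B_c (phi beta 0%R))%E /\ (B_c (phi beta 0%R) < (beta * d%:R)%:E)%E &
         exists2 c : R, 0 < c &
           forall beta : R, 12 <= beta ->
             ((c * beta)%:E <= B_c (phi beta 0%R))%E]).
Proof.
move=> d3 modelG; split.
  by move=> beta B t b0 B0 t0 t1; apply: free_energy_as_cvg => //; rewrite t0.
have d0 : (0 < d)%N by apply: leq_trans d3.
have [mk [phi [mk_inc phi_mod phi_lim]]] :=
  uniform_subsequence (ler0n R d) (@energy_modulus_mono R d)
    (@energy_modulus_small R d)
    (@even_energy_bound R dsp T P d G modelG) (@even_energy_lip R dsp T P d G modelG)
    (@even_energy_mod R dsp T P d G modelG).
exists (fun k => 2 * (mk k).+1)%N, (fun b B t => phi b t + B * (2 * t - 1)).
have phi0 b : (fun t => phi b t + 0 * (2 * t - 1)) =1 phi b.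
  by move=> t; rewrite mul0r addr0.
split.
- by move=> i j ij; rewrite ltn_pmul2l// ltnS; apply: mk_inc.
- by move=> k; split=> //; apply: even_double.
- move=> b B b0 B0; split; last by move=> t _; rewrite mul0r addr0.
  + move=> K _ K01; apply: uniform_cvgP => e e0.
    have e2 : 0 < e / 2 by rewrite divr_gt0.
    have [N1 _ h1] := phi_lim b _ b0 e2.
    have [|N2 h2] := @near_inv_lt R (e / 2 / (2 * B + 1)).
      by rewrite divr_gt0// ltr_wpDl// mulr_ge0.
    exists (maxn N1 N2) => // k /=; rewrite geq_max => /andP[k1 k2] t /K01 /=.
    rewrite in_itv/= => t01.
    have := h1 k k1 t t01; have := mean_free_energy_field modelG (mk k) b B t01.
    have := h2 (mk k) (leq_trans k2 (mk_ge mk_inc k)).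
    have B1 : 0 < 2 * B + 1 by rewrite ltr_wpDl// mulr_ge0.
    rewrite ltr_pdivlMr// (ger0_norm B0) => h3 h4 h5.
    have h6 : 2 * B / (2 * (mk k).+1)%:R <= e / 2.
      have i1 : (2 * (mk k).+1)%:R^-1 <= (mk k).+1%:R^-1 :> R.
        have m2 : ((mk k).+1 <= 2 * (mk k).+1)%N by rewrite leq_pmull.
        by rewrite lef_pV2 ?ler_nat// posrE ltr0n.
      have i0 : 0 <= (mk k).+1%:R^-1 :> R by rewrite invr_ge0.
      apply: le_trans (_ : 2 * B * (mk k).+1%:R^-1 <= _).
        by rewrite ler_wpM2l// mulr_ge0.
      by move: h3; set j := (mk k).+1%:R^-1 in i0 *; nra.
    rewrite (_ : _ - _ = (mean_free_energy P G (2 * (mk k).+1) b B t -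
      (even_energy P G (mk k) b t + B * (2 * t - 1))) +
      (even_energy P G (mk k) b t - phi b t)); last by ring.
    apply: le_lt_trans (ler_normD _ _) _; move: h4 h5 h6.
    by set x := `|_|; set y := `|_|; set z := _ / _; lra.
  + apply/subspace_continuousP => t /=; rewrite in_itv/= => t01.
    apply: cvgD; last first.
      apply: cvg_within_filter; apply: cvgM; first exact: cvg_cst.
      apply: cvgB; last exact: cvg_cst.
      by apply: cvgM; [exact: cvg_cst|exact: cvg_id].
    apply/cvgrPdist_lt => e e0.
    have [x x0 wx] := @energy_modulus_small R d b e b0 e0.
    rewrite near_withinE; exists x => //= s ts.
    rewrite in_itv/= => s01.
    exact: le_lt_trans (phi_mod b s t x b0 s01 t01 ts) wx.
- move=> b bc; have [b0 _] := beta_c_lt d3 bc; have b0' := ltW b0.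
  split; last exact: (B_c_lt modelG mk_inc phi_lim d0 b0 (phi0 b)).
  have [Q Qgt hQ] := bethe_gap d3 bc.
  have hQ' n (M : multigraph n d) : is_pairing M ->
      expR (n%:R * Q) <= \sum_(s : configuration n) expR (b * energy (hspin s) M).
    move=> pM; rewrite -[n in n%:R]card_ord; apply: (hQ _ _ (@fst _ _) M pM) => i.
    rewrite -[RHS](card_ord d) -[#|'I_d|]mul1n -(cards1 i) -[#|'I_d|]cardsT -cardsX.
    by apply: eq_card => h; rewrite !inE andbT.
  (* The gap is cut into thirds: one is lost in [phi_Bethe], one is the lower bound on [B_c], and
     one leaves the strict margin. *)
  pose g := Q - (ln 2 + d%:R / 2 * ln (ch b)); have g0 : 0 < g by rewrite subr_gt0.
  have g3 : 0 < g / 3 by rewrite divr_gt0.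
  have [t0 /andP[t00 t02] ht0] := phi_Bethe modelG mk_inc phi_lim b0' g3 hQ'.
  have half := phi_half_le modelG mk_inc phi_lim b0'.
  have gap : g / 3 < phi b t0 - phi b (1 / 2).
    by move: ht0 half; rewrite /g; set A := phi b t0; set B := phi b _; set C :=
      _ / _ * _;
      set D := ln 2; move: g3; rewrite /g -/C -/D; lra.
  have t0lt : t0 < 1 / 2.
    rewrite lt_neqAle t02 andbT; apply: contraTneq gap => ->.
    by rewrite subrr -leNgt ltW.
  apply: (@lt_le_trans _ _ (g / 3)%:E); first by rewrite lte_fin.
  by apply: (B_c_ge phi_mod b0' (phi0 b) _ g3 gap); rewrite t00.
(* [phi_zero_ge] and [phi_power] both scale linearly in [b], so the gap at [beta = 1], which depends
   on [d] alone, is multiplied by [b]. Halving it makes the inequality strict, as [B_c_ge]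
   requires. *)
- pose g : R := d%:R / 2 - (ln 2 + d%:R / 2 * ln (ch 1)).
  have g0 : 0 < g by rewrite subr_gt0; apply: half_energy_gap.
  have g2 : 0 < g / 2 by rewrite divr_gt0.
  exists (g / 2) => // b b12.
  have b1 : 1 <= b by apply: le_trans b12; rewrite ler1n.
  have b0 : 0 < b by apply: lt_le_trans b1.
  have half := phi_half_le modelG mk_inc phi_lim ler01.
  have pw := phi_power modelG phi_lim b1.
  have z := phi_zero_ge modelG mk_inc phi_lim (ltW b0).
  have gap : g / 2 * b < phi b 0 - phi b (1 / 2).
    have : b * phi 1 (1 / 2) <= b * (ln 2 + d%:R / 2 * ln (ch 1)) by rewrite ler_pM2l.
    have : b * (g / 2) < b * g by rewrite ltr_pM2l//; lra.
    have -> : b * g = b * d%:R / 2 - b * (ln 2 + d%:R / 2 * ln (ch 1)).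
      by rewrite /g; ring.
    move: pw z; set A := b * phi 1 _; set B := phi b 0; set C := b * (_ + _).
    by set D := b * d%:R / 2; set E := phi b _; rewrite [g / 2 * b]mulrC; lra.
  apply: (B_c_ge phi_mod (ltW b0) (phi0 b) _ _ gap); last by rewrite mulr_gt0.
  by apply/andP; split; lra.
Qed.
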